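(* In the setting described in the context, let the Regularity Assumption (A.1)-(A.3) and the Approximation Assumption hold. Then for all $\varepsilon>0$ small enough the learning problem $(\mathcal{P}_\varepsilon)$ admits at least one minimizing triplet $(\mathbf{y}^*_\varepsilon,\mathbf{p}^*_\varepsilon,\theta^*_\varepsilon)\in \mathcal{C}(Y_0;W_T)^2\times\mathcal{R}_\varepsilon$.
   Context: Setting. Let $n,m\in\mathbb{N}$, $T>0$, $I=(0,T)$, $\bar I=[0,T]$; $W_T=\{y\in L^2(I;\mathbb{R}^n):\dot y\in L^2(I;\mathbb{R}^n)\}$ with $\|y\|_{W_T}^2=\|\dot y\|_{L^2}^2+\|y\|_{L^2}^2$, and $\imath:W_T\to\mathcal{C}(\bar I;\mathbb{R}^n)$ is the continuous embedding. Let $f:\bar I\times\mathbb{R}^n\to\mathbb{R}^n$, $g:\bar I\times\mathbb{R}^n\to\mathbb{R}^{n\times m}$, with Nemytskii operators $\mathbf{f}(y)(t)=f(t,y(t))$, $(\mathbf{g}(y)u)(t)=g(t,y(t))u(t)$. Let $Q_1,Q_2\in\mathbb{R}^{n\times n}$ be symmetric positive semi-definite, $\beta>0$, $y_d\in L^2(I;\mathbb{R}^n)$, and $y_d^T\in\mathbb{R}^n$ a desired terminal state; $\mathbf{Q}_1$ denotes pointwise multiplication by $Q_1$. For $t\in\bar I$ put $$J_t(y,u)=\tfrac12\int_t^T\big(|Q_1(y(s)-y_d(s))|^2+\beta|u(s)|^2\big)\,ds+\tfrac12|Q_2(y(T)-y_d^T)|^2,\qquad J=J_0.$$ For $y_0\in\mathbb{R}^n$,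 problem $(P_{y_0})$ is: minimize $J(y,u)$ over $(y,u)\in W_T\times L^2(I;\mathbb{R}^m)$ subject to $\dot y=\mathbf{f}(y)+\mathbf{g}(y)u$, $y(0)=y_0$. The value function is $V^*(t_0,y_0)=\inf J_{t_0}(y,u)$ over $y\in H^1(t_0,T;\mathbb{R}^n)$, $u\in L^2(t_0,T;\mathbb{R}^m)$ with $\dot y=f(\cdot,y)+g(\cdot,y)u$, $y(t_0)=y_0$; so $V^*(T,y_0)=\frac12|Q_2(y_0-y_d^T)|^2$. $\partial_y,\partial_{yy}$ denote gradient and Hessian in $y$. $Y_0\subset\mathbb{R}^n$ is compact. Regularity Assumption. (A.1) $f,g$ are twice continuously differentiable, and their Jacobians and Hessians with respect to $y$ are Lipschitz continuous on compact sets, uniformly in $t$. (A.2) There is $M_{Y_0}>0$ such that, with $\widehat M=M_{Y_0}\|\imath\|$, $V^*$ is twice continuously differentiable on $\bar I\times\bar B_{2\widehat M}(0)$ with gradient and Hessian Lipschitz continuous (w.r.t. $y$, uniformly in $t$). Let $\mathcal{Y}_{ad}=\{y\in W_T:\|y\|_{W_T}\le 2M_{Y_0}\}$ and $\mathcal{F}^*(y)(t)=-\frac1\beta g(t,y(t))^\top\partial_yV^*(t,y(t))$ for $y\in\mathcal{Y}_{ad}$. (A.3) For every $y_0\in Y_0$ there is a unique $y=\mathbf{y}^*(y_0)\in W_T$ with $\dot y=\mathbf{f}(y)+\mathbf{g}(y)\mathcal{F}^*(y)$, $y(0)=y_0$, $\|y\|_{W_T}\le M_{Y_0}$, and $(\mathbf{y}^*(y_0),\mathcal{F}^*(\mathbf{y}^*(y_0)))$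 is a minimizer of $(P_{y_0})$. Approximation Assumption. Let $\varepsilon_0>0$. For each $0<\varepsilon\le\varepsilon_0$, $\mathcal{R}_\varepsilon\simeq\mathbb{R}^{N_\varepsilon}$ is a finite-dimensional parameter space with Hilbert norm $\|\cdot\|_{\mathcal{R}_\varepsilon}$, and $(\theta,t,y)\mapsto V^\varepsilon_\theta(t,y)$ belongs to $\mathcal{C}^4(\mathcal{R}_\varepsilon\times\mathbb{R}\times\mathbb{R}^n)$ with $V^\varepsilon_\theta(T,y)=\frac12|Q_2(y-y_d^T)|^2$ for all $y,\theta$. There are $\theta_\varepsilon\in\mathcal{R}_\varepsilon$ and $c>0$ independent of $\varepsilon$ with $$\max_{t\in\bar I,\,|y|\le2\widehat M}\big(|V^\varepsilon_{\theta_\varepsilon}-V^*|+|\partial_y(V^\varepsilon_{\theta_\varepsilon}-V^* )|+\|\partial_{yy}(V^\varepsilon_{\theta_\varepsilon}-V^* )\|\big)(t,y)\le c\varepsilon .$$ Put $F^\varepsilon_\theta(t,y)=-\frac1\beta g(t,y)^\top\partial_yV^\varepsilon_\theta(t,y)$ and $\mathcal{F}^\varepsilon_\theta(y)(t)=F^\varepsilon_\theta(t,y(t))$. Learning problem. $\mathcal{C}(Y_0;W_T)$ carries the norm $\|\mathbf{y}\|_{\mathcal{C}}=\max_{y_0\in Y_0}\|\mathbf{y}(y_0)\|_{W_T}$. $\mathcal{L}$ is normalized Lebesgue measure on $Y_0$; $\omega\in L^\infty(Y_0)$ with $\omega\ge c_\omega>0$ a.e.; $\gamma_1,\gamma_2\ge0$,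 $\gamma_\varepsilon>0$. Put $$J_\varepsilon(y,p,\theta)=J(y,\mathcal{F}^\varepsilon_\theta(y))+\int_0^T\tfrac{\gamma_1}2|V^\varepsilon_\theta(t,y(t))-J_t(y,\mathcal{F}^\varepsilon_\theta(y))|^2+\tfrac{\gamma_2}2|\partial_yV^\varepsilon_\theta(t,y(t))-p(t)|^2\,dt .$$ $\mathbf{Y}_{ad}=\{\mathbf{y}\in\mathcal{C}(Y_0;W_T):\|\mathbf{y}\|_{\mathcal{C}}\le2M_{Y_0}\}$, $\mathbf{U}_{ad}=L^2(Y_0;L^2(I;\mathbb{R}^m))$. $(\mathcal{P}_\varepsilon)$ is: minimize $\mathcal{J}_\varepsilon(\mathbf{y},\mathbf{p},\theta)=\int_{Y_0}\omega(y_0)J_\varepsilon(\mathbf{y}(y_0),\mathbf{p}(y_0),\theta)\,d\mathcal{L}(y_0)+\frac{\gamma_\varepsilon}2\|\theta\|^2_{\mathcal{R}_\varepsilon}$ over $\mathbf{y}\in\mathbf{Y}_{ad}$, $\mathbf{p}\in\mathcal{C}(Y_0;W_T)$, $\theta\in\mathcal{R}_\varepsilon$ with $\mathcal{F}^\varepsilon_\theta(\mathbf{y})\in\mathbf{U}_{ad}$ (where $\mathcal{F}^\varepsilon_\theta(\mathbf{y})(y_0)=\mathcal{F}^\varepsilon_\theta(\mathbf{y}(y_0))$), such that for $\mathcal{L}$-a.e. $y_0\in Y_0$ the pair $(y,p)=(\mathbf{y}(y_0),\mathbf{p}(y_0))$ satisfies $y\in\mathcal{Y}_{ad}$ and $$\dot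 y=\mathbf{f}(y)+\mathbf{g}(y)\mathcal{F}^\varepsilon_\theta(y),\ y(0)=y_0,\qquad -\dot p=D\mathbf{f}(y)^\top p+[D\mathbf{g}(y)^\top\mathcal{F}^\varepsilon_\theta(y)]p+\mathbf{Q}_1^\top\mathbf{Q}_1(y-y_d),\ p(T)=Q_2^\top Q_2(y(T)-y_d^T).$$ Here $D\mathbf{f}(y)^\top$ is pointwise multiplication by $D_yf(t,y(t))^\top$ and $([D\mathbf{g}(y)^\top u]p)_k=\sum_{i,j}\partial_{y_k}g_{ij}(t,y(t))u_j(t)p_i(t)$. *)

(* Defs.v *)
From HB Require Import structures.
From mathcomp Require Import all_boot all_order all_algebra.
From mathcomp Require Import all_classical all_reals all_analysis.
Set Implicit Arguments.
Unset Strict Implicit.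
Unset Printing Implicit Defensive.
Import Order.TTheory GRing.Theory Num.Theory.
Import numFieldNormedType.Exports.
Local Open Scope classical_set_scope.
Local Open Scope ring_scope.

(* 'cV[R]_n carries the sigma-algebra generated by the coordinates, i.e. the
   Borel sets of R^n. *)
Definition cV_display : measure_display -> measure_display.
Proof. exact. Qed.

Section cV_measurable.
Context {R : realType} {n : nat}.

Definition cV_coor (i : 'I_n) (x : 'cV[R]_n) : R := x i ord0.

Let cV_set0 : g_sigma_preimage cV_coor set0.
Proof. exact: sigma_algebra0. Qed.

Let cV_setC A : g_sigma_preimage cV_coor A -> g_sigma_preimage cV_coor (~` A).
Proof. exact: sigma_algebraC. Qed.

Let cV_bigcup (F : (set 'cV[R]_n)^nat) :
  (forall i, g_sigma_preimage cV_coor (F i)) ->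
  g_sigma_preimage cV_coor (\bigcup_i (F i)).
Proof. exact: sigma_algebra_bigcup. Qed.

HB.instance Definition _ := @isMeasurable.Build
  (cV_display default_measure_display)
  'cV[R]_n (g_sigma_preimage cV_coor) cV_set0 cV_setC cV_bigcup.

Lemma measurable_cV_coor (i : 'I_n) :
  measurable_fun [set: 'cV[R]_n] (fun x : 'cV[R]_n => x i ord0).
Proof.
move=> _ Y mY; rewrite setTI; apply: sub_sigma_algebra => /=.
rewrite -bigcup_seq/=; exists i => /=; first by rewrite mem_index_enum.
by exists Y => //; rewrite setTI.
Qed.

Lemma measurable_fun_cV d (X : measurableType d) (f : X -> 'cV[R]_n) :
  (forall i, measurable_fun [set: X] (fun x => f x i ord0)) ->
  measurable_fun [set: X] f.
Proof.
move=> mf _ A; rewrite setTI.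
suff : g_sigma_preimage cV_coor `<=` [set B | measurable (f @^-1` B)].
  by apply.
apply: smallest_sub.
  split => /=.
  - by rewrite preimage_set0.
  - by move=> B mB; rewrite setTD preimage_setC; exact: measurableC.
  - by move=> F mF; rewrite preimage_bigcup; exact: bigcup_measurable.
rewrite -bigcup_seq => B [i _] [C mC <-] /=.
by rewrite setTI; have := mf i measurableT C mC; rewrite setTI.
Qed.

End cV_measurable.

Section cons_cV.
Context {R : realType} {n : nat}.

Definition cons_cV (p : R * 'cV[R]_n) : 'cV[R]_n.+1 :=
  \col_i oapp (fun j => p.2 j ord0) p.1 (unlift ord0 i).

Lemma cons_cV0 p : cons_cV p ord0 ord0 = p.1.
Proof. by rewrite mxE unlift_none. Qed.

Lemma cons_cVS p (i : 'I_n) : cons_cV p (lift ord0 i) ord0 = p.2 i ord0.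
Proof. by rewrite mxE liftK. Qed.

Lemma cons_cV_surj (x : 'cV[R]_n.+1) :
  cons_cV (x ord0 ord0, \col_j x (lift ord0 j) ord0) = x.
Proof.
apply/colP => i; have [j ->|->] := unliftP ord0 i.
  by rewrite cons_cVS mxE.
by rewrite cons_cV0.
Qed.

Lemma cons_cVK p :
  (cons_cV p ord0 ord0, \col_j cons_cV p (lift ord0 j) ord0) = p.
Proof.
case: p => a x; rewrite cons_cV0; congr pair.
by apply/colP => i; rewrite mxE cons_cVS.
Qed.

Lemma measurable_cons_cV : measurable_fun [set: R * 'cV[R]_n] cons_cV.
Proof.
apply: measurable_fun_cV => i.
have [j ->|->] := unliftP ord0 i.
- under eq_fun do rewrite cons_cVS.
  exact: (measurableT_comp (measurable_cV_coor j) measurable_snd).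
- by under eq_fun do rewrite cons_cV0; exact: measurable_fst.
Qed.

Lemma measurable_uncons_cV : measurable_fun [set: 'cV[R]_n.+1]
  (fun x : 'cV[R]_n.+1 => (x ord0 ord0, \col_j x (lift ord0 j) ord0) : R * 'cV[R]_n).
Proof.
apply/measurable_fun_pairP; split => /=.
  exact: measurable_cV_coor.
apply: measurable_fun_cV => i.
under eq_fun do rewrite /= mxE.
exact: measurable_cV_coor.
Qed.

End cons_cV.

Lemma sigma_finite_product d1 d2 (T1 : measurableType d1)
    (T2 : measurableType d2) (R : realType)
    (m1 : {sigma_finite_measure set T1 -> \bar R})
    (m2 : {sigma_finite_measure set T2 -> \bar R}) :
  sigma_finite setT (m1 \x m2)%E.
Proof.
have /sigma_finiteP[F [TF ndF Foo]] := sigma_finiteT m1.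
have /sigma_finiteP[G [TG ndG Goo]] := sigma_finiteT m2.
exists (fun n => F n `*` G n).
  rewrite -setXTT TF TG predeqE => -[x y]; split.
    move=> [/= [n _ Fnx] [k _ Gky]]; exists (maxn n k) => //; split.
    - by move: x Fnx; exact/subsetPset/ndF/leq_maxl.
    - by move: y Gky; exact/subsetPset/ndG/leq_maxr.
  by move=> [n _ []/= ? ?]; split; exists n.
move=> k; have [? ?] := Foo k; have [? ?] := Goo k.
split; first exact: measurableX.
by rewrite product_measure1E// lte_mul_pinfty// ?measure_ge0// ge0_fin_numE.
Qed.

Section lebesgue_cV.
Local Open Scope ereal_scope.
Context {R : realType}.

Section step.
Variables (n : nat) (mu : {sigma_finite_measure set 'cV[R]_n -> \bar R}).

Definition lebesgue_cVS : set 'cV[R]_n.+1 -> \bar R :=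
  pushforward (@lebesgue_measure R \x mu) cons_cV.

Let measurable_pre A : measurable A -> measurable (@cons_cV R n @^-1` A).
Proof. by move=> mA; rewrite -[X in measurable X]setTI; exact: measurable_cons_cV. Qed.

Let lebesgue_cVS0 : lebesgue_cVS set0 = 0.
Proof. by rewrite /lebesgue_cVS /pushforward preimage_set0 measure0. Qed.

Let lebesgue_cVS_ge0 A : 0 <= lebesgue_cVS A.
Proof. exact: (measure_ge0 (@lebesgue_measure R \x mu)). Qed.

Let lebesgue_cVS_sigma_additive : semi_sigma_additive lebesgue_cVS.
Proof.
move=> F mF tF mUF; rewrite /lebesgue_cVS /pushforward preimage_bigcup.
apply: (@measure_semi_sigma_additive _ _ _ (@lebesgue_measure R \x mu)).
- by move=> k; exact: measurable_pre.
- apply/trivIsetP => /= i j _ _ ij; rewrite -preimage_setI.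
  by move/trivIsetP : tF => /(_ _ _ _ _ ij) ->//; rewrite preimage_set0.
- by rewrite -preimage_bigcup; exact: measurable_pre.
Qed.

HB.instance Definition _ := isMeasure.Build _ _ _ lebesgue_cVS
  lebesgue_cVS0 lebesgue_cVS_ge0 lebesgue_cVS_sigma_additive.

Let lebesgue_cVS_sigma_finite : sigma_finite [set: 'cV[R]_n.+1] lebesgue_cVS.
Proof.
have [F TF Foo] := @sigma_finite_product _ _ _ _ _ (@lebesgue_measure R) mu.
pose u := fun x : 'cV[R]_n.+1 =>
  (x ord0 ord0, \col_j x (lift ord0 j) ord0) : R * 'cV[R]_n.
exists (fun k => u @^-1` F k).
  by rewrite -preimage_bigcup -TF preimage_setT.
move=> k; have [mFk Fkoo] := Foo k; split.
  by rewrite -[X in measurable X]setTI; exact: measurable_uncons_cV.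
rewrite /lebesgue_cVS /pushforward.
rewrite (_ : _ @^-1` _ = F k)//; apply/seteqP.
by split=> p; rewrite /preimage/= /u cons_cVK.
Qed.

HB.instance Definition _ := Measure_isSigmaFinite.Build _ _ _ lebesgue_cVS
  lebesgue_cVS_sigma_finite.

End step.

(* Lebesgue measure on R^n as the n-fold product of the Lebesgue measure on R;
   see lebesgue_cV_box for the volume of boxes. *)
Fixpoint lebesgue_cV n : {sigma_finite_measure set 'cV[R]_n -> \bar R} :=
  match n return {sigma_finite_measure set 'cV[R]_n -> \bar R} with
  | 0 => dirac (0%R : 'cV[R]_0)
  | k.+1 => lebesgue_cVS (lebesgue_cV k)
  end.

Lemma lebesgue_cV_box n (a b : 'cV[R]_n) : (forall i, (a i ord0 <= b i ord0)%R) ->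
  lebesgue_cV n [set x | forall i, x i ord0 \in `[a i ord0, b i ord0]] =
  (\prod_i (b i ord0 - a i ord0))%:E.
Proof.
elim: n a b => [|n IH] a b ab /=.
  rewrite big_ord0 diracE mem_set//= => -[].
  by move=> i.
rewrite /lebesgue_cVS /pushforward.
rewrite (_ : _ @^-1` _ = `[a ord0 ord0, b ord0 ord0] `*`
  [set x : 'cV[R]_n | forall i, x i ord0 \in
    `[(\col_j a (lift ord0 j) ord0) i ord0, (\col_j b (lift ord0 j) ord0) i ord0]]); last first.
  apply/seteqP; split => [p /= H|p [/= H0 H] i].
    split => /=; first by have := H ord0; rewrite cons_cV0.
    by move=> i; have := H (lift ord0 i); rewrite cons_cVS !mxE.
  have [j ->|->] := unliftP ord0 i.
    by have := H j; rewrite cons_cVS !mxE.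
  by rewrite cons_cV0.
rewrite product_measure1E//=; last first.
  have -> : [set x : 'cV[R]_n | forall i, x i ord0 \in
    `[(\col_j a (lift ord0 j) ord0) i ord0, (\col_j b (lift ord0 j) ord0) i ord0]] =
    \bigcap_i ((fun x : 'cV[R]_n => x i ord0) @^-1`
     `[(\col_j a (lift ord0 j) ord0) i ord0, (\col_j b (lift ord0 j) ord0) i ord0]).
    by apply/seteqP; split => [x /= H i _|x H i]; [exact: H|exact: (H i)].
  apply: fin_bigcap_measurable; first exact: finite_finset.
  by move=> i _; rewrite -[X in measurable X]setTI; exact: measurable_cV_coor.
rewrite IH; last by move=> i; rewrite !mxE.
rewrite big_ord_recl EFinM lebesgue_measure_itv/= lte_fin.
congr (_ * _).
  case: ltP => // ba; congr EFin.
  by apply/esym/eqP; rewrite subr_eq0 eq_le ba ab.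
by congr EFin; apply: eq_bigr => i _; rewrite !mxE.
Qed.

End lebesgue_cV.

Section norms.
Context {R : realType}.

(* Euclidean norm of vectors, Frobenius norm of matrices; the library norm on
   matrices is the sup norm. *)
Definition enorm (p q : nat) (A : 'M[R]_(p, q)) : R :=
  Num.sqrt (\sum_i \sum_j A i j ^+ 2).

Definition inner_product (k : nat) (ip : 'cV[R]_k -> 'cV[R]_k -> R) : Prop :=
  [/\ forall x y, ip x y = ip y x,
      forall a x y z, ip (a *: x + y) z = a * ip x z + ip y z &
      forall x, x != 0 -> 0 < ip x x].

Definition pos_semidef (k : nat) (Q : 'M[R]_k) : Prop :=
  Q^T = Q /\ forall x : 'cV[R]_k, 0 <= (x^T *m Q *m x) ord0 ord0.

End norms.

Section smoothness.
Context {R : realType}.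

Section frechet.
Context {V W : normedModType R}.

Definition is_fderiv_on (D : set V) (h : V -> W) (x : V) (L : V -> W) : Prop :=
  [/\ linear L, continuous L &
      forall e, 0 < e -> exists2 d, 0 < d & forall y, D y -> `|y - x| < d ->
        `|h y - h x - L (y - x)| <= e * `|y - x| ].

(* Fréchet derivative relative to D. It is only used where it is unique: D is
   convex with nonempty interior, so for D = setT it is the usual derivative,
   and on the boundary of D it is the continuous extension of the derivative
   from the interior. *)
Definition fderiv_on (D : set V) (h : V -> W) (x : V) : V -> W :=
  xget (fun=> 0) (is_fderiv_on D h x).

Fixpoint Ck_on (k : nat) (D : set V) (h : V -> W) : Prop :=
  match k with
  | 0%N => {within D, continuous h}
  | k'.+1 => (forall x, D x -> exists L, is_fderiv_on D h x L) /\
             forall v, Ck_on k' D (fun x => fderiv_on D h x v)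
  end.

End frechet.

Context {n : nat}.
Implicit Types (B K : set 'cV[R]_n) (h : 'cV[R]_n -> R) (y : 'cV[R]_n).

Definition unit_vec (i : 'I_n) : 'cV[R]_n := delta_mx i ord0.

Definition grad h y : 'cV[R]_n := \col_i 'D_(unit_vec i) h y.

Definition hess h y : 'M[R]_n :=
  \matrix_(i, j) 'D_(unit_vec i) (fun z => 'D_(unit_vec j) h z) y.

Definition grad_on B h y : 'cV[R]_n := \col_i fderiv_on B h y (unit_vec i).

Definition hess_on B h y : 'M[R]_n :=
  \matrix_(i, j) fderiv_on B (fun z => fderiv_on B h z (unit_vec j)) y
                   (unit_vec i).

Definition jac (k : nat) (h : 'cV[R]_n -> 'cV[R]_k) y : 'M[R]_(k, n) :=
  \matrix_(i, j) 'D_(unit_vec j) (fun z => h z i ord0) y.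

Definition lipschitz_y (T : R) K (p q : nat)
    (A : R -> 'cV[R]_n -> 'M[R]_(p, q)) : Prop :=
  exists L : R, forall t y z, 0 <= t <= T -> K y -> K z ->
    enorm (A t y - A t z) <= L * enorm (y - z).

End smoothness.

Section function_spaces.
Context {R : realType}.
Variables (a b : R).

Definition L2 (k : nat) (v : R -> 'cV[R]_k) : Prop :=
  forall i : 'I_k, measurable_fun `]a, b[ (fun t => v t i ord0) /\
    (@lebesgue_measure R).-integrable `]a, b[ (fun t => (v t i ord0 ^+ 2)%:E).

Definition L2norm (k : nat) (v : R -> 'cV[R]_k) : R :=
  Num.sqrt (\int[@lebesgue_measure R]_(t in `]a, b[) (enorm (v t) ^+ 2)).

(* Test functions of class C^1 with compact support in ]a,b[; this gives the
   same weak derivatives as smooth test functions. *)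
Definition test_fun (phi : R -> R) : Prop :=
  [/\ forall t, derivable phi t 1, continuous (derive1 phi) &
      exists c d, [/\ a < c, d < b & forall t, ~ (c <= t <= d) -> phi t = 0] ].

Definition weak_deriv (k : nat) (y v : R -> 'cV[R]_k) : Prop :=
  L2 v /\ forall phi, test_fun phi -> forall i : 'I_k,
    \int[@lebesgue_measure R]_(t in `]a, b[) (y t i ord0 * derive1 phi t) =
    - \int[@lebesgue_measure R]_(t in `]a, b[) (v t i ord0 * phi t).

(* Elements of H^1(a,b) are represented by their continuous representative on
   [a,b]; values outside [a,b] are irrelevant. *)
Definition H1 (k : nat) (y : R -> 'cV[R]_k) : Prop :=
  [/\ {within `[a, b], continuous y}, L2 y & exists v, weak_deriv y v].

Definition wderiv (k : nat) (y : R -> 'cV[R]_k) : R -> 'cV[R]_k :=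
  xget (fun=> 0) (weak_deriv y).

Definition H1norm (k : nat) (y : R -> 'cV[R]_k) : R :=
  Num.sqrt (L2norm (wderiv y) ^+ 2 + L2norm y ^+ 2).

Definition Cnorm (k : nat) (y : R -> 'cV[R]_k) : R :=
  sup [set enorm (y t) | t in `[a, b]].

(* Operator norm of the embedding of H^1(a,b;R^k) into C([a,b];R^k). *)
Definition embedding_norm (k : nat) : R :=
  sup [set Cnorm y | y in [set y : R -> 'cV[R]_k | H1 y /\ H1norm y <= 1]].

End function_spaces.

Section optimal_control.
Context {R : realType} {n m : nat}.

(* Data of the control problem on [0, horizon]; the values of dyn_f, dyn_g and
   yd outside [0, horizon] are irrelevant. *)
Record ocp := OCP {
  horizon : R;
  dyn_f : R -> 'cV[R]_n -> 'cV[R]_n;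
  dyn_g : R -> 'cV[R]_n -> 'M[R]_(n, m);
  Q1 : 'M[R]_n;
  Q2 : 'M[R]_n;
  beta : R;
  yd : R -> 'cV[R]_n;
  ydT : 'cV[R]_n }.

Variable P : ocp.
Local Notation T := (horizon P).
Local Notation f := (dyn_f P).
Local Notation g := (dyn_g P).

Definition ocp_setting : Prop :=
  [/\ 0 < T, pos_semidef (Q1 P), pos_semidef (Q2 P), 0 < beta P &
      L2 0 T (yd P)].

Definition terminal_cost (y : 'cV[R]_n) : R :=
  2^-1 * enorm (Q2 P *m (y - ydT P)) ^+ 2.

(* The integrals below are real-valued (fine of the extended-real integral);
   the integrands are integrable for every admissible or feasible argument. *)
Definition cost (t : R) (y : R -> 'cV[R]_n) (u : R -> 'cV[R]_m) : R :=
  2^-1 * \int[@lebesgue_measure R]_(s in `]t, T[)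
    (enorm (Q1 P *m (y s - yd P s)) ^+ 2 + beta P * enorm (u s) ^+ 2)
  + terminal_cost (y T).

Definition state_eq (t0 : R) (y0 : 'cV[R]_n) (u : R -> 'cV[R]_m)
    (y : R -> 'cV[R]_n) : Prop :=
  [/\ H1 t0 T y, weak_deriv t0 T y (fun t => f t (y t) + g t (y t) *m u t) &
      y t0 = y0].

Definition admissible (t0 : R) (y0 : 'cV[R]_n) (y : R -> 'cV[R]_n)
    (u : R -> 'cV[R]_m) : Prop := L2 t0 T u /\ state_eq t0 y0 u y.

Definition ocp_minimizer (y0 : 'cV[R]_n) (y : R -> 'cV[R]_n)
    (u : R -> 'cV[R]_m) : Prop :=
  admissible 0 y0 y u /\
  forall y' u', admissible 0 y0 y' u' -> cost 0 y u <= cost 0 y' u'.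

(* Infimum over H^1(t0,T) x L^2(t0,T), in the extended reals: it is +oo when no trajectory exists on [t0,T]. *)
Definition value (t0 : R) (y0 : 'cV[R]_n) : \bar R :=
  ereal_inf [set (cost t0 yu.1 yu.2)%:E |
    yu in [set yu : (R -> 'cV[R]_n) * (R -> 'cV[R]_m) |
           admissible t0 y0 yu.1 yu.2]].

Definition valueR (t0 : R) (y0 : 'cV[R]_n) : R := fine (value t0 y0).

Definition feedback (G : R -> 'cV[R]_n -> 'cV[R]_n) (t : R) (y : 'cV[R]_n) :
    'cV[R]_m := - (beta P)^-1 *: ((g t y)^T *m G t y).

Section regularity.
Variables (Y0 : set 'cV[R]_n) (M : R).

Definition Mhat : R := M * embedding_norm 0 T n.

Definition big_ball : set 'cV[R]_n := [set y | enorm y <= 2 * Mhat].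

Definition in_Yad (y : R -> 'cV[R]_n) : Prop :=
  H1 0 T y /\ H1norm 0 T y <= 2 * M.

Definition regular_dynamics : Prop :=
  [/\ Ck_on 2 (`[0, T]%classic `*` setT) (fun x : R * 'cV[R]_n => f x.1 x.2),
      Ck_on 2 (`[0, T]%classic `*` setT) (fun x : R * 'cV[R]_n => g x.1 x.2),
      forall (K : set 'cV[R]_n) i, compact K ->
        lipschitz_y T K (fun t => grad (fun z => f t z i ord0)) /\
        lipschitz_y T K (fun t => hess (fun z => f t z i ord0)) &
      forall (K : set 'cV[R]_n) i j, compact K ->
        lipschitz_y T K (fun t => grad (fun z => g t z i j)) /\
        lipschitz_y T K (fun t => hess (fun z => g t z i j))].

Definition regular_value : Prop :=
  [/\ forall t y, 0 <= t <= T -> big_ball y -> value t y \is a fin_num,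
      Ck_on 2 (`[0, T]%classic `*` big_ball)
        (fun x : R * 'cV[R]_n => valueR x.1 x.2),
      lipschitz_y T big_ball (fun t => grad_on big_ball (valueR t)) &
      lipschitz_y T big_ball (fun t => hess_on big_ball (valueR t))].

Definition feedback_star : R -> 'cV[R]_n -> 'cV[R]_m :=
  feedback (fun t => grad_on big_ball (valueR t)).

Definition optimal_closed_loop : Prop :=
  forall y0, Y0 y0 -> exists y : R -> 'cV[R]_n,
    let sol z :=
      state_eq 0 y0 (fun t => feedback_star t (z t)) z /\ H1norm 0 T z <= M in
    [/\ sol y,
        forall z, sol z -> forall t, 0 <= t <= T -> z t = y t &
        ocp_minimizer y0 y (fun t => feedback_star t (y t))].

End regularity.

Section learning.
Variables (Y0 : set 'cV[R]_n) (M : R) (omega : 'cV[R]_n -> R) (gamma1 gamma2 : R).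

(* k stands for N_eps: the parameter space is R^k with inner product ip and
   gammae is the regularisation weight gamma_eps. *)
Variables (k : nat) (ip : 'cV[R]_k -> 'cV[R]_k -> R)
  (V : 'cV[R]_k -> R -> 'cV[R]_n -> R) (gammae : R).

(* V is of class C^4 in (theta,t,y) jointly and has the exact terminal value. *)
Definition ansatz : Prop :=
  [/\ inner_product ip,
      Ck_on 4 setT (fun x : 'cV[R]_k * R * 'cV[R]_n => V x.1.1 x.1.2 x.2) &
      forall theta y, V theta T y = terminal_cost y].

Definition approximates (theta : 'cV[R]_k) (d : R) : Prop :=
  forall t y, 0 <= t <= T -> big_ball M y ->
    let diff z := V theta t z - valueR t z in
    `|diff y| + enorm (grad_on (big_ball M) diff y)
      + enorm (hess_on (big_ball M) diff y) <= d.

Definition feedback_net (theta : 'cV[R]_k) : R -> 'cV[R]_n -> 'cV[R]_m :=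
  feedback (fun t => grad (V theta t)).

Definition control_net (theta : 'cV[R]_k) (y : R -> 'cV[R]_n) :
    R -> 'cV[R]_m := fun t => feedback_net theta t (y t).

Definition cost_net (y p : R -> 'cV[R]_n) (theta : 'cV[R]_k) : R :=
  cost 0 y (control_net theta y) +
  \int[@lebesgue_measure R]_(t in `]0, T[)
    (gamma1 / 2 * `|V theta t (y t) - cost t y (control_net theta y)| ^+ 2 +
     gamma2 / 2 * enorm (grad (V theta t) (y t) - p t) ^+ 2).

Definition adjoint_coupling (t : R) (y : 'cV[R]_n) (u : 'cV[R]_m)
    (p : 'cV[R]_n) : 'cV[R]_n :=
  \col_k0 \sum_i \sum_j
    'D_(unit_vec k0) (fun z => dyn_g P t z i j) y * u j ord0 * p i ord0.

Definition adjoint_eq (u : R -> 'cV[R]_m) (y p : R -> 'cV[R]_n) : Prop :=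
  [/\ H1 0 T p,
      weak_deriv 0 T p (fun t =>
        - ((jac (f t) (y t))^T *m p t + adjoint_coupling t (y t) (u t) (p t)
           + (Q1 P)^T *m Q1 P *m (y t - yd P t))) &
      p T = (Q2 P)^T *m Q2 P *m (y T - ydT P)].

Definition in_CY0W (y : 'cV[R]_n -> R -> 'cV[R]_n) : Prop :=
  (forall y0, Y0 y0 -> H1 0 T (y y0)) /\
  forall y0, Y0 y0 -> forall e, 0 < e -> exists2 d, 0 < d &
    forall z0, Y0 z0 -> enorm (z0 - y0) < d ->
      H1norm 0 T (fun t => y z0 t - y y0 t) < e.

Definition simple_L2 (S : 'cV[R]_n -> R -> 'cV[R]_m) : Prop :=
  exists N (A : 'I_N -> set 'cV[R]_n) (c : 'I_N -> R -> 'cV[R]_m),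
    (forall i, measurable (A i) /\ L2 0 T (c i)) /\
    forall y0 t, S y0 t = \sum_(i < N) \1_(A i) y0 *: c i t.

(* Bochner space L^2(Y0; L^2(0,T;R^m)): a.e. limits of simple functions with
   square-integrable norm. *)
Definition in_Uad (U : 'cV[R]_n -> R -> 'cV[R]_m) : Prop :=
  [/\ {ae lebesgue_cV n, forall y0, Y0 y0 -> L2 0 T (U y0)},
      exists S : nat -> 'cV[R]_n -> R -> 'cV[R]_m,
        (forall j, simple_L2 (S j)) /\
        {ae lebesgue_cV n, forall y0, Y0 y0 ->
          (fun j => L2norm 0 T (fun t => S j y0 t - U y0 t)) @ \oo --> (0 : R)} &
      (\int[lebesgue_cV n]_(y0 in Y0) (L2norm 0 T (U y0) ^+ 2)%:E < +oo)%E].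

(* Integral with respect to the normalised Lebesgue measure on Y0. *)
Definition mean_Y0 (h : 'cV[R]_n -> R) : R :=
  (fine (lebesgue_cV n Y0))^-1 * \int[lebesgue_cV n]_(y0 in Y0) h y0.

Definition learning_cost (y p : 'cV[R]_n -> R -> 'cV[R]_n)
    (theta : 'cV[R]_k) : R :=
  mean_Y0 (fun y0 => omega y0 * cost_net (y y0) (p y0) theta)
  + gammae / 2 * ip theta theta.

Definition learning_feasible (y p : 'cV[R]_n -> R -> 'cV[R]_n)
    (theta : 'cV[R]_k) : Prop :=
  [/\ in_CY0W y, forall y0, Y0 y0 -> H1norm 0 T (y y0) <= 2 * M, in_CY0W p,
      in_Uad (fun y0 => control_net theta (y y0)) &
      {ae lebesgue_cV n, forall y0, Y0 y0 ->
        [/\ in_Yad M (y y0),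
            state_eq 0 y0 (control_net theta (y y0)) (y y0) &
            adjoint_eq (control_net theta (y y0)) (y y0) (p y0)]}].

Definition learning_minimizer (y p : 'cV[R]_n -> R -> 'cV[R]_n)
    (theta : 'cV[R]_k) : Prop :=
  learning_feasible y p theta /\
  forall y' p' theta', learning_feasible y' p' theta' ->
    learning_cost y p theta <= learning_cost y' p' theta'.

End learning.

Definition weight (Y0 : set 'cV[R]_n) (omega : 'cV[R]_n -> R) (c : R) : Prop :=
  [/\ measurable_fun Y0 omega,
      exists C : R, {ae lebesgue_cV n, forall y0, Y0 y0 -> `|omega y0| <= C} &
      {ae lebesgue_cV n, forall y0, Y0 y0 -> c <= omega y0}].

End optimal_control.

Arguments ocp : clear implicits.

(* Main.v *)
Require Import Defs.
From mathcomp Require Import all_boot all_order all_algebra.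
From mathcomp Require Import all_classical all_reals all_analysis.
From mathcomp Require Import measurable_realfun ring lra.
Set Implicit Arguments.
Unset Strict Implicit.
Unset Printing Implicit Defensive.
Import Order.TTheory GRing.Theory Num.Theory.
Import numFieldNormedType.Exports.
Local Open Scope classical_set_scope.
Local Open Scope ring_scope.

(** The learning problem minimises over pairs of trajectory families and over a
    parameter, but the equations leave no freedom besides the parameter.  For
    fixed [theta] the closed-loop field is locally Lipschitz, so a feasible
    state is determined by its initial value, and the adjoint equation, linear
    in the costate with prescribed terminal value, then determines the costate.
    The problem is therefore the minimisation of one real function, the reduced
    cost, over the set of feasible parameters, a subset of a finite-dimensional
    space.  The function is continuous, and the term [ip theta theta] makes it
    coercive because the remaining terms are nonnegative.  A closed nonempty set
    of feasible parameters thus contains a minimiser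
    ([learning_minimizer_exists]).

    For a general parameter, however, the closed loop may blow up before the
    horizon, and truncation removes this obstacle.  The Sobolev embedding
    confines every admissible state to the ball of radius [2 * Mhat], so
    precomposing the field with the radial retraction onto this ball
    ([trunc_field]) does not touch admissible trajectories, while the new field
    is globally Lipschitz.  Its solutions exist on the whole interval and depend continuously on parameter,
    initial value and time ([state_family], [adjoint_family]).  Both families
    come from one existence result for Volterra equations with parameters
    ([volterra_param]), applied forwards and backwards in time; the passage from
    weak derivatives to integral equations is [weak_derivP].

    A parameter is feasible exactly when the H^1 norm of the truncated
    trajectory is at most [2 * M] for almost every initial value.  The squared
    norm is continuous, so this means that the integral of its positive excess
    over [4 * M ^+ 2] vanishes, a closed condition
    ([feasible_parameters_closed]).  On the exceptional null set the norm bound,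
    which is imposed for all initial values, is restored by rescaling the
    trajectories continuously ([feasible_parameter_learning]).

    Nonemptiness is the only place where [e] has to be small.  At the
    approximating parameter the closed-loop field differs from the optimal one
    by O(e) on the ball ([net_field_close]).  The optimal trajectories have norm
    at most [M]; Gronwall's inequality moves them by O(e) in H^1, uniformly in
    the initial value, and so the norm stays below [2 * M]
    ([small_state_energy]). *)

(** * Elementary inequalities, matrices and the Euclidean norm *)

Lemma ltr_sqrD1 (R : realDomainType) (a : R) : 0 <= a -> a < (a + 1) ^+ 2.
Proof. by move=> a0; nra. Qed.

Section clamp.
Context {R : realType}.
Implicit Types (T t : R).

(** Precomposition with [clamp T] extends a function on [0, T] to the line and
    keeps it continuous, so that continuity on the interval can be expressed
    by continuity on R. *)
Definition clamp T t : R := Num.max 0 (Num.min T t).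

Lemma clamp_id T t : 0 <= t <= T -> clamp T t = t.
Proof.
by move=> /andP[t0 tT]; rewrite /clamp; have /min_idPr -> := tT; apply/max_idPr.
Qed.

Lemma clamp_itv T t : 0 <= T -> 0 <= clamp T t <= T.
Proof.
by move=> T0; rewrite /clamp le_max lexx /= ge_max T0 ge_min lexx.
Qed.

Lemma continuous_clamp T : continuous (clamp T).
Proof.
move=> t; apply: continuous_max; first exact: cvg_cst.
by apply: continuous_min; [exact: cvg_cst|exact: cvg_id].
Qed.

End clamp.

Section matrix_topology.
Context {R : realType}.

Lemma mx_continuous (X : topologicalType) p q (F : X -> 'M[R]_(p, q)) :
  (forall i j, continuous (fun x => F x i j)) -> continuous F.
Proof.
move=> cF x; apply/cvgrPdist_lt => e e0.
have : \forall y \near x, forall ij : 'I_p * 'I_q,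
    `|F x ij.1 ij.2 - F y ij.1 ij.2| < e.
  apply: filter_forall => -[i j] /=.
  by have /cvgrPdist_lt := cF i j x; apply.
apply: filterS => y yx; rewrite [ltLHS]mx_normrE.
by apply/bigmax_ltP; split => // -[i j] _; rewrite !mxE; exact: yx (i, j).
Qed.

Lemma continuous_sumr (X : topologicalType) I (r : seq I) (P : pred I)
    (F : I -> X -> R) :
  (forall i, P i -> continuous (F i)) ->
  continuous (fun x => \sum_(i <- r | P i) F i x).
Proof.
move=> cF; elim: r => [|i r IH].
  rewrite (_ : (fun x => _) = cst 0) => [x|]; first exact: cvg_cst.
  by apply/funext => x; rewrite big_nil.
have [Pi|Pi] := boolP (P i); last first.
  by rewrite (_ : (fun x => _) = fun x => \sum_(i <- r | P i) F i x)//;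
    apply/funext => x; rewrite big_cons (negbTE Pi).
rewrite (_ : (fun x => _) = fun x => F i x + \sum_(i <- r | P i) F i x).
  by move=> x; apply: cvgD; [exact: cF|exact: IH].
by apply/funext => x; rewrite big_cons Pi.
Qed.

Lemma entry_continuous (X : topologicalType) p q (F : X -> 'M[R]_(p, q)) i j :
  continuous F -> continuous (fun x => F x i j).
Proof.
move=> cF x.
exact: (@continuous_comp _ _ _ F (fun M : 'M[R]_(p, q) => M i j) x (cF x)
  (@coord_continuous _ _ _ i j _)).
Qed.

Lemma mx_continuousD (X : topologicalType) p q (F G : X -> 'M[R]_(p, q)) :
  continuous F -> continuous G -> continuous (fun x => F x + G x).
Proof. by move=> cF cG x; apply: cvgD; [exact: cF|exact: cG]. Qed.

Lemma mx_continuousB (X : topologicalType) p q (F G : X -> 'M[R]_(p, q)) :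
  continuous F -> continuous G -> continuous (fun x => F x - G x).
Proof. by move=> cF cG x; apply: cvgB; [exact: cF|exact: cG]. Qed.

Lemma mx_continuousZ (X : topologicalType) p q (a : R) (F : X -> 'M[R]_(p, q)) :
  continuous F -> continuous (fun x => a *: F x).
Proof. by move=> cF x; apply: cvgZr; exact: cF. Qed.

Lemma mulmx_continuous (X : topologicalType) p q r (F : X -> 'M[R]_(p, q))
    (G : X -> 'M[R]_(q, r)) :
  continuous F -> continuous G -> continuous (fun x => F x *m G x).
Proof.
move=> cF cG; apply: mx_continuous => i j.
under eq_fun do rewrite mxE.
apply: continuous_sumr => k _ x.
by apply: cvgM; exact: entry_continuous.
Qed.

Lemma trmx_continuous (X : topologicalType) p q (F : X -> 'M[R]_(p, q)) :
  continuous F -> continuous (fun x => (F x)^T).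
Proof.
move=> cF; apply: mx_continuous => i j; under eq_fun do rewrite mxE.
exact: entry_continuous.
Qed.

Lemma entry_le_norm p q (A : 'M[R]_(p, q)) i j : `|A i j| <= `|A|.
Proof. by rewrite [leRHS]mx_normrE; exact: (le_bigmax _ (fun ij => `|A ij.1 ij.2|) (i, j)). Qed.

Lemma norm_le_entry p q (A : 'M[R]_(p, q)) C :
  0 <= C -> (forall i j, `|A i j| <= C) -> `|A| <= C.
Proof.
by move=> C0 AC; rewrite [leLHS]mx_normrE; apply/bigmax_leP; split.
Qed.

Lemma norm_trmx p q (A : 'M[R]_(p, q)) : `|A^T| = `|A|.
Proof.
apply/eqP; rewrite eq_le; apply/andP; split; apply: norm_le_entry => // i j.
  by rewrite mxE entry_le_norm.
by rewrite (le_trans _ (entry_le_norm A^T j i))// mxE.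
Qed.

Lemma norm_mulmx p q r (A : 'M[R]_(p, q)) (B : 'M[R]_(q, r)) :
  `|A *m B| <= q%:R * `|A| * `|B|.
Proof.
apply: norm_le_entry => [|i j]; first by rewrite !mulr_ge0.
rewrite mxE (le_trans (ler_norm_sum _ _ _))//.
rewrite (@le_trans _ _ (\sum_(k < q) `|A| * `|B|))//.
  by apply: ler_sum => k _; rewrite normrM ler_pM// entry_le_norm.
by rewrite sumr_const card_ord -mulrA mulr_natl.
Qed.

Lemma compact_cV_ball n (r : R) : compact [set x : 'cV[R]_n | `|x| <= r].
Proof.
have -> : [set x : 'cV[R]_n | `|x| <= r] =
    (fun v : 'rV[R]_n => v^T) @` [set v : 'rV[R]_n | `|v| <= r].
  apply/seteqP; split => [x /= xr|x [v /= vr <-]]; last by rewrite norm_trmx.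
  by exists x^T; rewrite /= ?norm_trmx ?trmxK.
apply: continuous_compact.
  by apply: continuous_subspaceT; apply: trmx_continuous => x; exact: cvg_id.
apply: bounded_closed_compact.
  exists r; split; first exact: num_real.
  by move=> s rs v /= vr; rewrite (le_trans vr)// ltW.
apply: (@closed_comp _ _ (fun v : 'rV[R]_n => `|v|) [set s | s <= r]) => //.
  by move=> v _; exact: norm_continuous.
Qed.

Lemma closed_bounded_compact_cV n (A : set 'cV[R]_n) (r : R) :
  closed A -> (forall x, A x -> `|x| <= r) -> compact A.
Proof.
by move=> cA Ar; apply: subclosed_compact cA (@compact_cV_ball n r) _.
Qed.

End matrix_topology.

Lemma continuous_pair (X Y Z : topologicalType) (f : X -> Y) (g : X -> Z) :
  continuous f -> continuous g -> continuous (fun x => (f x, g x)).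
Proof.
move=> cf cg x.
exact: (@cvg_pair _ _ _ _ (nbhs (f x)) (nbhs (g x)) _ _ _ f g (cf x) (cg x)).
Qed.

Lemma continuous_fst (X Y : topologicalType) : continuous (@fst X Y).
Proof. by move=> [x y]; exact: cvg_fst. Qed.

Lemma continuous_snd (X Y : topologicalType) : continuous (@snd X Y).
Proof. by move=> [x y]; exact: cvg_snd. Qed.

Lemma continuous_compose (X Y Z : topologicalType) (f : X -> Y) (g : Y -> Z) :
  continuous f -> continuous g -> continuous (fun x => g (f x)).
Proof. by move=> cf cg x; apply: continuous_comp; [exact: cf|exact: cg]. Qed.

Lemma continuous_section (X Y Z : topologicalType) (h : X * Y -> Z) x :
  continuous h -> continuous (fun y => h (x, y)).
Proof.
move=> ch; apply: (@continuous_compose _ _ _ (fun y => (x, y))) => //.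
by apply: continuous_pair => y; [exact: cvg_cst|exact: cvg_id].
Qed.

Arguments continuous_pair [X Y Z f g] _ _.
Arguments continuous_compose [X Y Z f g] _ _.
Arguments continuous_section [X Y Z h] x _.

Lemma continuous_clamp_within (R : realType) (V : topologicalType) (T : R)
    (y : R -> V) : 0 <= T -> {within `[0, T], continuous y} ->
  continuous (fun t => y (clamp T t)).
Proof.
move=> T0 cy t; have ct : `[0, T]%classic (clamp T t).
  by rewrite /= in_itv/= clamp_itv.
have /subspace_continuousP/(_ _ ct) cyt := cy.
apply: (@cvg_comp _ _ _ (clamp T) y _ (within `[0, T] (nbhs (clamp T t)))) => //.
move=> A /= nA; have cc := @continuous_clamp R T t.
have {}nA : \forall s \near clamp T t, s \in `[0, T]%R -> A s by [].
near=> s; have : clamp T s \in `[0, T]%R -> A (clamp T s).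
  by near: s; exact: (cc _ nA).
by apply; rewrite in_itv/= clamp_itv.
Unshelve. all: by end_near. Qed.

Section tube.
Context {R : realType}.

(** Joint continuity becomes continuity in the parameter, uniformly in a
    compact variable; all continuity of parametric integrals rests on it. *)
Lemma tube_lemma (Z T : topologicalType) (K : set T) (V : normedModType R)
    (h : Z * T -> V) : compact K -> continuous h -> forall z e, 0 < e ->
  \forall z' \near z, forall t, K t -> `|h (z', t) - h (z, t)| <= e.
Proof.
move=> cK ch z e e0.
have /compact_near_coveringP nK := cK.
apply: (nK Z (nbhs z) (fun z' t => `|h (z', t) - h (z, t)| <= e)) => t Kt.
have e20 : 0 < e / 2 by rewrite divr_gt0.
have /cvgrPdist_le/(_ _ e20)[[A B] /= [Bt Az] AB] := ch (z, t).
exists (B, A); first by split => //; exact: Az.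
move=> [t' z'] [/= Bt' Az'].
rewrite -(subrKA (h (z, t))) (le_trans (ler_normD _ _))// [e]splitr lerD//.
  by rewrite distrC; apply: (AB (z', t')).
apply: (AB (z, t')); split => //=; exact: nbhs_singleton.
Qed.

Lemma compact_norm_bounded (T : topologicalType) (K : set T)
    (V : normedModType R) (h : T -> V) : compact K -> continuous h ->
  exists2 C : R, 0 <= C & forall t, K t -> `|h t| <= C.
Proof.
move=> cK ch; have [[t0 Kt0]|K0] := pselect (K !=set0); last first.
  by exists 0 => // t Kt; case: K0; exists t.
have cn : continuous (fun t => `|h t|).
  by move=> t; apply: cvg_norm; exact: ch.
have [] := @compact_EVT_max T R (fun t => `|h t|) K.
- by exists t0.
- exact: cK.
- exact: continuous_subspaceT.
by move=> c Kc hc; exists `|h c| => // t Kt; apply: hc; exact/mem_set.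
Qed.

End tube.

Section enorm.
Context {R : realType}.

Lemma enorm_ge0 p q (A : 'M[R]_(p, q)) : 0 <= enorm A.
Proof. exact: sqrtr_ge0. Qed.

Lemma sqr_enorm p q (A : 'M[R]_(p, q)) :
  enorm A ^+ 2 = \sum_i \sum_j A i j ^+ 2.
Proof.
by rewrite sqr_sqrtr//; apply: sumr_ge0 => i _; apply: sumr_ge0 => j _; exact: sqr_ge0.
Qed.

Lemma sqr_enorm_cV n (x : 'cV[R]_n) : enorm x ^+ 2 = \sum_i x i ord0 ^+ 2.
Proof. by rewrite sqr_enorm; apply: eq_bigr => i _; rewrite big_ord1. Qed.

Lemma entry_le_enorm p q (A : 'M[R]_(p, q)) i j : `|A i j| <= enorm A.
Proof.
rewrite -(@ler_pXn2r _ 2)// ?nnegrE ?enorm_ge0// sqr_enorm real_normK ?num_real//.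
rewrite (bigD1 i)//= (bigD1 j)//= -addrA lerDl addr_ge0//.
  by apply: sumr_ge0 => k _; exact: sqr_ge0.
by apply: sumr_ge0 => k _; apply: sumr_ge0 => l _; exact: sqr_ge0.
Qed.

Lemma norm_le_enorm p q (A : 'M[R]_(p, q)) : `|A| <= enorm A.
Proof. by apply: norm_le_entry; [exact: enorm_ge0|exact: entry_le_enorm]. Qed.

Lemma sqr_enorm_le_norm n (x : 'cV[R]_n) : enorm x ^+ 2 <= n%:R * `|x| ^+ 2.
Proof.
rewrite sqr_enorm_cV (@le_trans _ _ (\sum_(i < n) `|x| ^+ 2))//.
  apply: ler_sum => i _; rewrite -real_normK ?num_real//.
  by rewrite lerXn2r// ?nnegrE// entry_le_norm.
by rewrite sumr_const card_ord mulr_natl.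
Qed.

Lemma enorm_le_norm n (x : 'cV[R]_n) : enorm x <= n%:R * `|x|.
Proof.
rewrite -(@ler_pXn2r _ 2)// ?nnegrE ?enorm_ge0 ?mulr_ge0//.
rewrite (le_trans (sqr_enorm_le_norm x))// exprMn ler_wpM2r ?sqr_ge0//.
by rewrite -natrX ler_nat; case: n {x} => // n; rewrite expnS leq_pmulr// expn1.
Qed.

Lemma enormZ p q (a : R) (A : 'M[R]_(p, q)) : enorm (a *: A) = `|a| * enorm A.
Proof.
apply/eqP; rewrite -(@eqrXn2 _ 2)// ?enorm_ge0 ?mulr_ge0 ?enorm_ge0//.
rewrite exprMn !sqr_enorm real_normK ?num_real// mulr_sumr; apply/eqP.
apply: eq_bigr => i _; rewrite mulr_sumr; apply: eq_bigr => j _.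
by rewrite mxE exprMn.
Qed.

Lemma enorm0 p q : enorm (0 : 'M[R]_(p, q)) = 0.
Proof. by rewrite -(scale0r 0) enormZ normr0 mul0r. Qed.

Lemma enormN p q (A : 'M[R]_(p, q)) : enorm (- A) = enorm A.
Proof. by rewrite -scaleN1r enormZ normrN1 mul1r. Qed.

Lemma sum_cauchy_schwarz (I : finType) (a b : I -> R) :
  (\sum_i a i * b i) ^+ 2 <= (\sum_i a i ^+ 2) * (\sum_i b i ^+ 2).
Proof.
(* Lagrange's identity *)
have : 0 <= \sum_i \sum_j (a i * b j - a j * b i) ^+ 2.
  by apply: sumr_ge0 => i _; apply: sumr_ge0 => j _; exact: sqr_ge0.
suff -> : \sum_i \sum_j (a i * b j - a j * b i) ^+ 2 =
    ((\sum_i a i ^+ 2) * (\sum_i b i ^+ 2) - (\sum_i a i * b i) ^+ 2) *+ 2.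
  by rewrite pmulrn_lge0// subr_ge0.
have e1 : (\sum_i a i ^+ 2) * (\sum_i b i ^+ 2) =
    \sum_i \sum_j a i ^+ 2 * b j ^+ 2.
  by rewrite mulr_suml; apply: eq_bigr => i _; rewrite mulr_sumr.
have e2 : (\sum_i a i ^+ 2) * (\sum_i b i ^+ 2) =
    \sum_i \sum_j a j ^+ 2 * b i ^+ 2.
  by rewrite e1 exchange_big.
have e3 : (\sum_i a i * b i) ^+ 2 = \sum_i \sum_j (a i * b i) * (a j * b j).
  by rewrite expr2 mulr_suml; apply: eq_bigr => i _; rewrite mulr_sumr.
rewrite mulrnBl mulr2n {1}e1 e2 e3 -sumrMnl -big_split/= -sumrB.
apply: eq_bigr => i _; rewrite -sumrMnl -big_split/= -sumrB.
by apply: eq_bigr => j _; ring.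
Qed.

Lemma enormD n (x y : 'cV[R]_n) : enorm (x + y) <= enorm x + enorm y.
Proof.
rewrite -(@ler_pXn2r _ 2)// ?nnegrE ?addr_ge0 ?enorm_ge0//.
rewrite sqrrD !sqr_enorm_cV.
have -> : \sum_i (x + y) i ord0 ^+ 2 = \sum_i x i ord0 ^+ 2 +
    (\sum_i x i ord0 * y i ord0) *+ 2 + \sum_i y i ord0 ^+ 2.
  rewrite -sumrMnl -!big_split/=; apply: eq_bigr => i _.
  by rewrite mxE; ring.
rewrite lerD2r lerD2l lerMn2r/= (le_trans (ler_norm _))//.
rewrite -(@ler_pXn2r _ 2)// ?nnegrE ?mulr_ge0 ?enorm_ge0//.
by rewrite real_normK ?num_real// exprMn !sqr_enorm_cV sum_cauchy_schwarz.
Qed.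

Lemma enorm_continuous (X : topologicalType) p q (F : X -> 'M[R]_(p, q)) :
  continuous F -> continuous (fun x => enorm (F x)).
Proof.
move=> cF; have cs : continuous (fun x => \sum_i \sum_j F x i j ^+ 2).
  apply: continuous_sumr => i _; apply: continuous_sumr => j _ y.
  by apply: cvgM; exact: entry_continuous.
by move=> x; apply: (continuous_comp (cs x)); exact: sqrt_continuous.
Qed.

End enorm.

(** * Integrals with parameters *)

Section real_integrable.
Context d (T : measurableType d) (R : realType) (mu : {measure set T -> \bar R}).
Variables (D : set T) (mD : measurable D).
Implicit Types f g : T -> R.

Lemma integrable_EFinD f g : mu.-integrable D (EFin \o f) ->
  mu.-integrable D (EFin \o g) ->
  mu.-integrable D (EFin \o (fun x => f x + g x)).
Proof. by move=> If Ig; exact: (integrableD mD If Ig). Qed.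

Lemma integrable_EFinB f g : mu.-integrable D (EFin \o f) ->
  mu.-integrable D (EFin \o g) ->
  mu.-integrable D (EFin \o (fun x => f x - g x)).
Proof. by move=> If Ig; exact: (integrableB mD If Ig). Qed.

Lemma integrable_EFinZ k f : mu.-integrable D (EFin \o f) ->
  mu.-integrable D (EFin \o (fun x => k * f x)).
Proof. by move=> If; exact: (integrableZl mD k If). Qed.

Lemma integrable_EFin_sum I (r : seq I) (F : I -> T -> R) :
  (forall i, mu.-integrable D (EFin \o F i)) ->
  mu.-integrable D (EFin \o (fun x => \sum_(i <- r) F i x)).
Proof.
move=> IF; elim: r => [|i r IH].
  rewrite (_ : EFin \o _ = cst 0%E); first exact: integrable0.
  by apply/funext => x /=; rewrite big_nil.
rewrite (_ : EFin \o _ = EFin \o (fun x => F i x + \sum_(i <- r) F i x)).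
  exact: integrable_EFinD.
by apply/funext => x /=; rewrite big_cons.
Qed.

Lemma Rintegral_sum I (r : seq I) (F : I -> T -> R) :
  (forall i, mu.-integrable D (EFin \o F i)) ->
  \int[mu]_(x in D) (\sum_(i <- r) F i x) =
  \sum_(i <- r) \int[mu]_(x in D) F i x.
Proof.
move=> IF; elim: r => [|i r IH].
  rewrite big_nil -[RHS](mul0r (fine (mu D))) -(Rintegral_cst mu mD).
  by apply: eq_Rintegral => x _; rewrite big_nil.
rewrite big_cons -IH -RintegralD//; last exact: integrable_EFin_sum.
by apply: eq_Rintegral => x _; rewrite big_cons.
Qed.

Lemma integrable_EFinM f g C : mu.-integrable D (EFin \o f) ->
  measurable_fun D g -> (forall x, D x -> `|g x| <= C) ->
  mu.-integrable D (EFin \o (fun x => g x * f x)).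
Proof.
move=> If mg gC; apply: (@integrableMr _ _ _ _ _ mD g (EFin \o f)) => //.
exists C; split; first exact: num_real.
by move=> x Cx y Dy /=; rewrite (le_trans (gC _ Dy))// ltW.
Qed.

Lemma integrable_EFin_norm f : mu.-integrable D (EFin \o f) ->
  mu.-integrable D (EFin \o (fun x => `|f x|)).
Proof. by move=> If; exact: (integrable_abse If). Qed.

Lemma integrable_EFin_le f g : measurable_fun D f ->
  (forall x, D x -> `|f x| <= g x) -> mu.-integrable D (EFin \o g) ->
  mu.-integrable D (EFin \o f).
Proof.
move=> mf fg; apply: le_integrable => //; first exact/measurable_EFinP.
by move=> x Dx; rewrite /= lee_fin (le_trans (fg _ Dx))// ler_norm.
Qed.

Lemma integrable_measurable f : mu.-integrable D (EFin \o f) ->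
  measurable_fun D f.
Proof. by move=> /measurable_int /measurable_EFinP. Qed.

Lemma normr_Rintegral_le f g : mu.-integrable D (EFin \o f) ->
  mu.-integrable D (EFin \o g) -> (forall x, D x -> `|f x| <= g x) ->
  `|\int[mu]_(x in D) f x| <= \int[mu]_(x in D) g x.
Proof.
move=> If Ig fg; apply: (le_trans (le_normr_Rintegral mD If)).
by apply: le_Rintegral => //; exact: integrable_EFin_norm.
Qed.

Lemma Rintegral_le_subset (A : set T) f : measurable A -> A `<=` D ->
  mu.-integrable D (EFin \o f) -> (forall x, D x -> 0 <= f x) ->
  \int[mu]_(x in A) f x <= \int[mu]_(x in D) f x.
Proof.
move=> mA AD If f0; apply: fine_le.
- by apply: integrable_fin_num => //; exact: integrableS If.
- exact: integrable_fin_num.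
- by apply: ge0_subset_integral => //; exact: measurable_int If.
Qed.

(** Continuity of a parametric integral: on a bounded family the dependence on
    the parameter only has to be uniform in the integration variable. *)
Lemma continuous_param_Rintegral (Z : topologicalType) (h : Z -> T -> R)
    (w : T -> R) : mu.-integrable D (EFin \o w) ->
  (forall z, measurable_fun D (h z)) ->
  (forall z, exists C, forall t, D t -> `|h z t| <= C) ->
  (forall z e, 0 < e -> \forall z' \near z,
     forall t, D t -> `|h z' t - h z t| <= e) ->
  continuous (fun z => \int[mu]_(t in D) (h z t * w t)).
Proof.
move=> Iw mh bh uh z; have Ihw z' : mu.-integrable D (EFin \o (fun t => h z' t * w t)).
  by have [C hC] := bh z'; exact: integrable_EFinM hC.
apply/cvgrPdist_le => e e0.
have Iaw := integrable_EFin_norm Iw.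
set A := \int[mu]_(t in D) `|w t|.
have A0 : 0 <= A by apply: Rintegral_ge0.
have eA0 : 0 < e / (A + 1) by rewrite divr_gt0// ltr_wpDl.
apply: filterS (uh z _ eA0) => z' hz'.
rewrite distrC -RintegralB//.
have I1 : mu.-integrable D (EFin \o (fun t => e / (A + 1) * `|w t|)).
  exact: integrable_EFinZ.
apply: (le_trans (normr_Rintegral_le _ I1 _)).
- exact: integrable_EFinB.
- by move=> t Dt; rewrite -mulrBl normrM ler_wpM2r// hz'.
- rewrite RintegralZl// -/A mulrAC ler_pdivrMr ?ltr_wpDl//.
  by rewrite ler_pM2l// lerDl.
Qed.

End real_integrable.

Section time_integrals.
Context {R : realType}.
Local Notation mu := (@lebesgue_measure R).
Implicit Types (T t : R) (f h w : R -> R).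

Lemma continuous_integrable_oo T h : {within `[0, T], continuous h} ->
  mu.-integrable `]0, T[ (EFin \o h).
Proof.
move=> ch; have Ih : mu.-integrable `[0, T] (EFin \o h).
  by apply: continuous_compact_integrable => //; exact: segment_compact.
by apply: integrableS Ih => //; exact: subset_itv_oo_cc.
Qed.

Lemma continuous_measurable h (D : set R) : measurable D -> continuous h ->
  measurable_fun D h.
Proof.
move=> mD ch; apply: (@measurable_funS _ _ _ _ setT) => //.
exact: continuous_measurable_fun.
Qed.

Lemma Rintegral_oo_split T t f : 0 <= t <= T ->
  mu.-integrable `]0, T[ (EFin \o f) ->
  \int[mu]_(s in `]0, T[) f s =
  \int[mu]_(s in `]0, t[) f s + \int[mu]_(s in `]t, T[) f s.
Proof.
move=> /andP[t0 tT] If.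
have [->|tneT] := eqVneq t T.
  by rewrite (@set_itv_ge _ _ (BRight T) (BLeft T)) ?bnd_simp// Rintegral_set0 addr0.
have {tneT}tT' : t < T by rewrite lt_neqAle tneT.
rewrite (@itv_bndbnd_setU _ _ (BRight 0) (BRight t) (BLeft T)); last 2 first.
  by rewrite bnd_simp.
  by rewrite bnd_simp.
rewrite Rintegral_setU//.
- rewrite -Rintegral_itv_bndo_bndc//; apply: integrableS If => //.
  by apply: subset_itvl; rewrite bnd_simp.
- by rewrite -itv_bndbnd_setU// ?bnd_simp.
- apply/disj_set2P; rewrite -subset0 => z/=; rewrite !in_itv/= => -[/andP[_]].
  by rewrite leNgt => /negbTE ->.
Qed.

Lemma integrable_sub_oo T (a b : R) f : 0 <= a -> b <= T ->
  mu.-integrable `]0, T[ (EFin \o f) -> mu.-integrable `]a, b[ (EFin \o f).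
Proof.
move=> a0 bT; apply: integrableS => //.
by apply: subset_itv; rewrite bnd_simp.
Qed.

Lemma continuous_primitive_clamp T f : 0 < T ->
  mu.-integrable `]0, T[ (EFin \o f) ->
  continuous (fun t => \int[mu]_(s in `]0, clamp T t[) f s).
Proof.
move=> T0 If.
pose g := f \_ `]0, T[.
have Ig : mu.-integrable `[0, T] (EFin \o g).
  rewrite /g -restrict_EFin; apply/integrable_restrict => //=.
  by rewrite setIidr//; exact: subset_itv_oo_cc.
have Ec t : \int[mu]_(s in `]0, clamp T t[) f s =
    parameterized_integral mu 0 (clamp T t) g.
  have /andP[c0 cT] := clamp_itv t (ltW T0).
  rewrite /parameterized_integral.
  rewrite -Rintegral_itv_bndo_bndc; last first.
    apply: integrableS Ig => //.
    by apply: subset_itv; rewrite bnd_simp.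
  rewrite -Rintegral_itv_obnd_cbnd; last first.
    apply: integrableS Ig => //.
    by apply: subset_itv; rewrite bnd_simp.
  apply: eq_Rintegral => s; rewrite inE/= in_itv/= => /andP[s0 sc].
  by rewrite /g patchE mem_set//= in_itv/= s0 (lt_le_trans sc).
rewrite (funext Ec).
exact: (continuous_clamp_within (ltW T0)
  (parameterized_integral_continuous (ltW T0) Ig)).
Qed.

Lemma Rintegral_derive1 (phi : R -> R) (a b : R) : a <= b ->
  (forall t, derivable phi t 1) -> continuous (derive1 phi) ->
  \int[mu]_(t in `]a, b[) derive1 phi t = phi b - phi a.
Proof.
move=> + dphi cphi; rewrite le_eqVlt => /predU1P[->|ab].
  by rewrite set_itv_ge ?bnd_simp// Rintegral_set0 subrr.
have I1 : mu.-integrable `[a, b] (EFin \o derive1 phi).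
  apply: continuous_compact_integrable; first exact: segment_compact.
  exact: continuous_subspaceT.
have cF : continuous phi.
  by move=> t; apply/differentiable_continuous/derivable1_diffP.
rewrite Rintegral_itv_obnd_cbnd; last first.
  by apply: integrableS I1 => //; exact: subset_itv_oo_cc.
rewrite Rintegral_itv_bndo_bndc; last first.
  by apply: integrableS I1 => //; apply: subset_itvl; rewrite bnd_simp.
rewrite /Rintegral (@continuous_FTC2 _ (derive1 phi) phi _ _ ab).
- by [].
- exact: continuous_subspaceT.
- split=> [t _||]; first exact: dphi.
  + by apply: cvg_at_right_filter; exact: cF.
  + by apply: cvg_at_left_filter; exact: cF.
- by move=> t _.
Qed.

Lemma Rintegral_expR (L a b : R) : L != 0 -> a <= b ->
  \int[mu]_(s in `]a, b[) expR (L * s) = (expR (L * b) - expR (L * a)) / L.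
Proof.
move=> L0 ab; pose F (s : R) := expR (L * s) / L.
have dF (s : R) : is_derive s 1 F (expR (L * s)).
  by apply: is_derive_eq; rewrite /GRing.scale/=; field.
have dFE : derive1 F = fun s => expR (L * s).
  by apply/funext => s; rewrite derive1E derive_val.
have cF : continuous (derive1 F).
  rewrite dFE => s; apply: (@continuous_comp _ _ _ (fun s => L * s) expR).
    by apply: mulrl_continuous.
  exact: continuous_expR.
have dF1 s : derivable F s 1 by exact: ex_derive.
by rewrite mulrBl -(Rintegral_derive1 ab dF1 cF) dFE.
Qed.

(** The two ways of running the clock on ]0, T[: from 0 up to t, and from T
    down to t.  The last clause provides the exponential weights that turn
    Volterra integration into a contraction. *)
Definition time_family T (J : R -> set R) : Prop :=
  [/\ forall t, @measurable _ (measurableTypeR R) (J t), forall t, J t `<=` `]0, T[,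
      forall f, mu.-integrable `]0, T[ (EFin \o f) ->
        continuous (fun t => \int[mu]_(s in J t) f s) &
      forall L, 0 < L -> exists w : R -> R, [/\ continuous w,
        forall t, 1 <= w t <= expR (L * T) &
        forall t, L * \int[mu]_(s in J t) w s <= w t]].

Definition past T (t : R) : set R := `]0, clamp T t[%classic.
Definition future T (t : R) : set R := `]clamp T t, T[%classic.

Lemma continuous_expR_clamp T (a b : R) :
  continuous (fun s : R => expR (a * clamp T s + b)).
Proof.
move=> s; apply: (@continuous_comp _ _ _ (fun s => a * clamp T s + b) expR).
  apply: cvgD; last exact: cvg_cst.
  by apply: cvgM; [exact: cvg_cst|exact: continuous_clamp].
exact: continuous_expR.
Qed.

Lemma past_family T : 0 < T -> time_family T (past T).
Proof.
move=> T0; have T0' := ltW T0; split => //.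
- by move=> t; exact: measurable_itv.
- move=> t; rewrite /past; apply: subset_itvl; rewrite bnd_simp.
  by have /andP[] := clamp_itv t T0'.
- by move=> f If; exact: continuous_primitive_clamp.
- move=> L L0; exists (fun s => expR (L * clamp T s + 0)); split.
  + exact: continuous_expR_clamp.
  + move=> t; have /andP[c0 cT] := clamp_itv t T0'.
    rewrite addr0 -{1}expR0 !ler_expR mulr_ge0//= ?(ltW L0)//.
    by rewrite ler_pM2l.
  + move=> t; have /andP[c0 cT] := clamp_itv t T0'.
    rewrite (_ : Rintegral _ _ _ = \int[mu]_(s in `]0, clamp T t[) expR (L * s)).
      rewrite Rintegral_expR ?gt_eqF// mulrCA divff ?gt_eqF// mulr1 addr0.
      by rewrite gerBl expR_ge0.
    apply: eq_Rintegral => s; rewrite inE /past/= in_itv/= => /andP[s0 sc].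
    by rewrite addr0 clamp_id// (ltW s0) (le_trans (ltW sc)).
Qed.

Lemma future_family T : 0 < T -> time_family T (future T).
Proof.
move=> T0; have T0' := ltW T0; split => //.
- by move=> t; exact: measurable_itv.
- move=> t; rewrite /future; apply: subset_itvr; rewrite bnd_simp.
  by have /andP[] := clamp_itv t T0'.
- move=> f If; rewrite (_ : (fun t => _) = fun t => \int[mu]_(s in `]0, T[) f s -
      \int[mu]_(s in `]0, clamp T t[) f s); last first.
    apply/funext => t; rewrite (@Rintegral_oo_split _ (clamp T t) _ _ If) ?clamp_itv//.
    by rewrite addrC addKr.
  move=> t; apply: cvgB; first exact: cvg_cst.
  exact: continuous_primitive_clamp.
- move=> L L0; exists (fun s => expR (- L * clamp T s + L * T)); split.
  + exact: continuous_expR_clamp.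
  + move=> t; have /andP[c0 cT] := clamp_itv t T0'.
    rewrite -{1}expR0 !ler_expR; apply/andP; split.
      by rewrite mulNr addrC subr_ge0 ler_pM2l.
    by rewrite mulNr gerDr oppr_le0 mulr_ge0// ltW.
  + move=> t; have /andP[c0 cT] := clamp_itv t T0'.
    have nL0 : - L != 0 by rewrite oppr_eq0 gt_eqF.
    have IE : mu.-integrable `]clamp T t, T[ (EFin \o (fun s => expR (- L * s))).
      apply: (@integrable_sub_oo T) => //.
      apply: continuous_integrable_oo; apply: continuous_subspaceT => s.
      apply: (@continuous_comp _ _ _ (fun s => - L * s) expR).
        by apply: mulrl_continuous.
      exact: continuous_expR.
    rewrite (_ : Rintegral _ _ _ =
        \int[mu]_(s in `]clamp T t, T[) (expR (L * T) * expR (- L * s))).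
      rewrite RintegralZl// Rintegral_expR// expRD invrN !mulrA.
      have -> : L * expR (L * T) = expR (L * T) * L by rewrite mulrC.
      rewrite mulrN mulrAC mulfK ?gt_eqF// -mulrN opprB mulrBr.
      by rewrite [leRHS]mulrC gerBl mulr_ge0// expR_ge0.
    apply: eq_Rintegral => s; rewrite inE /future/= in_itv/= => /andP[s0 sc].
    by rewrite expRD mulrC clamp_id// (ltW sc) (le_trans c0 (ltW s0)).
Qed.

(** The factor [w] is where data that are merely integrable enter, such as the
    desired state; the dependence on the parameter sits in the continuous [h].
    The domain and the integrand move independently: the tube lemma controls
    the integrand on all of ]0, T[, the family [J] the domain. *)
Lemma continuous_time_Rintegral T J (Z : topologicalType) (h : Z * R -> R) w :
  time_family T J -> continuous h -> mu.-integrable `]0, T[ (EFin \o w) ->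
  continuous (fun x : Z * R => \int[mu]_(s in J x.2) (h (x.1, s) * w s)).
Proof.
move=> [mJ sJ cJ _] ch Iw [z t]; apply/cvgrPdist_le => e e0 /=.
have ch1 z' : continuous (fun s => h (z', s)).
  exact: continuous_section.
have bh z' : exists2 C, 0 <= C & forall s, `[0, T]%classic s -> `|h (z', s)| <= C.
  by apply: compact_norm_bounded; [exact: segment_compact|exact: ch1].
have oocc : `]0, T[ `<=` `[0, T] by exact: subset_itv_oo_cc.
have Ihw z' : mu.-integrable `]0, T[ (EFin \o (fun s => h (z', s) * w s)).
  have [C C0 hC] := bh z'; apply: (@integrable_EFinM _ _ _ _ _ _ _ _ C) => //.
    exact: continuous_measurable.
  by move=> s /oocc; exact: hC.
have Iaw : mu.-integrable `]0, T[ (EFin \o (fun s => `|w s|)).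
  exact: integrable_EFin_norm.
have IJ t' f : mu.-integrable `]0, T[ (EFin \o f) ->
    mu.-integrable (J t') (EFin \o f).
  by move=> If; apply: integrableS If => //; exact: sJ.
set A := \int[mu]_(s in `]0, T[) `|w s|.
have A0 : 0 <= A by apply: Rintegral_ge0.
have e20 : 0 < e / 2 by rewrite divr_gt0.
have eA0 : 0 < (e / 2) / (A + 1) by rewrite divr_gt0// ltr_wpDl.
have tub := tube_lemma (@segment_compact R 0 T) ch z eA0.
have := cJ _ (Ihw z) t => /cvgrPdist_le/(_ _ e20) cJt.
near=> x; have xz : forall s, `[0, T]%classic s ->
    `|h (x.1, s) - h (z, s)| <= (e / 2) / (A + 1).
  near: x; exact: (@continuous_fst Z R (z, t) _ tub).
have xt : `|\int[mu]_(s in J t) (h (z, s) * w s) -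
    \int[mu]_(s in J x.2) (h (z, s) * w s)| <= e / 2.
  near: x; exact: (@continuous_snd Z R (z, t) _ cJt).
rewrite -(subrKA (\int[mu]_(s in J x.2) (h (z, s) * w s))).
rewrite (le_trans (ler_normD _ _))// [leRHS]splitr lerD//.
rewrite -RintegralB//; [|exact: IJ..].
apply: (@le_trans _ _ (\int[mu]_(s in J x.2) ((e / 2) / (A + 1) * `|w s|))).
  apply: normr_Rintegral_le => //.
  - by apply: integrable_EFinB => //; exact: IJ.
  - by apply: integrable_EFinZ => //; exact: IJ.
  - move=> s /sJ/oocc Is; rewrite -mulrBl normrM ler_wpM2r// distrC.
    exact: xz.
rewrite RintegralZl//; last exact: IJ.
rewrite mulrAC ler_pdivrMr ?ltr_wpDl// ler_pM2l//.
rewrite (@le_trans _ _ A)// ?lerDl//.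
by apply: Rintegral_le_subset.
Unshelve. all: by end_near. Qed.

Lemma continuous_horizon_Rintegral T (Z : topologicalType) (h : Z * R -> R) :
  0 < T -> continuous h ->
  continuous (fun z => \int[mu]_(s in `]0, T[) h (z, s)).
Proof.
move=> T0 ch; have I1 : mu.-integrable `]0, T[ (EFin \o (fun=> 1 : R)).
  by apply: continuous_integrable_oo => t; exact: cvg_cst.
have cT : continuous (fun z : Z => (z, T)).
  by apply: continuous_pair => x; [exact: cvg_id|exact: cst_continuous].
have := continuous_compose cT (continuous_time_Rintegral (past_family T0) ch I1).
rewrite (_ : (fun x => _) = fun z => \int[mu]_(s in `]0, T[) h (z, s)); first exact.
apply/funext => z; rewrite /past clamp_id ?lexx ?ltW//=.
by apply: eq_Rintegral => s _; rewrite mulr1.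
Qed.

End time_integrals.

Arguments continuous_time_Rintegral {R} [T J Z h w] _ _ _.
Arguments continuous_horizon_Rintegral {R} [T Z h] _ _.

(** * Volterra integral equations *)

Lemma le_add_geometric (R : realType) (a b c : R) : 0 <= b ->
  (forall k : nat, c <= a + b / 2 ^+ k) -> c <= a.
Proof.
move=> b0 H; rewrite leNgt; apply/negP => ac.
have ca0 : 0 < c - a by rewrite subr_gt0.
have bc0 : 0 <= b / (c - a) by rewrite divr_ge0// ltW.
have := archi_boundP bc0; set k := Num.bound _ => bk.
have := H k; apply/negP; rewrite -ltNge -ltrBrDl ltr_pdivrMr ?exprn_gt0//.
rewrite mulrC -ltr_pdivrMr// (lt_trans bk)// -natrX ltr_nat.
exact: ltn_expl.
Qed.

Lemma half_weight (R : realType) (L i w : R) : 0 <= i ->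
  (2 * L + 1) * i <= w -> L * i <= w / 2.
Proof. by move=> i0; rewrite mulrDl mul1r => H; lra. Qed.

Section volterra.
Context {R : realType}.
Local Notation mu := (@lebesgue_measure R).
Variables (T : R) (J : R -> set R).
Hypotheses (T0 : 0 < T) (JT : time_family T J).

Let mJ t : @measurable _ (measurableTypeR R) (J t).
Proof. by case: JT. Qed.

Let sJ t : J t `<=` `]0, T[.
Proof. by case: JT => _ + _ _; exact. Qed.

Let sJc t s : J t s -> 0 <= s <= T.
Proof. by move/sJ; rewrite /= in_itv/= => /andP[/ltW -> /ltW ->]. Qed.

Let cJ (f : R -> R) : mu.-integrable `]0, T[ (EFin \o f) ->
  continuous (fun t => \int[mu]_(s in J t) f s).
Proof. by case: JT => _ _ + _; exact. Qed.

Let IJ t (f : R -> R) : mu.-integrable `]0, T[ (EFin \o f) ->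
  mu.-integrable (J t) (EFin \o f).
Proof. by move=> If; apply: integrableS If => //; exact: sJ. Qed.

Let Icont (f : R -> R) : continuous f -> mu.-integrable `]0, T[ (EFin \o f).
Proof.
by move=> cf; apply: continuous_integrable_oo; exact: continuous_subspaceT.
Qed.

(** Gronwall's inequality.  In the weighted sup norm of [time_family] the
    integral operator has norm at most 1/2, so iterating the hypothesis
    replaces the a priori bound [B] by [B / 2 ^+ k]. *)
Lemma volterra_gronwall (L delta B : R) (u : R -> R) : 0 <= L -> 0 <= delta ->
  0 <= B -> mu.-integrable `]0, T[ (EFin \o u) ->
  (forall t, 0 <= t <= T -> u t <= B) ->
  (forall t, 0 <= t <= T -> u t <= delta + L * \int[mu]_(s in J t) u s) ->
  forall t, 0 <= t <= T -> u t <= 2 * delta * expR ((2 * L + 1) * T).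
Proof.
move=> L0 d0 B0 Iu uB uJ t tT.
have L1 : 0 < 2 * L + 1 by rewrite ltr_wpDl// mulr_ge0.
case: JT => _ _ _ /(_ _ L1)[w [cw w1 wJ]].
have w0 s : 0 <= w s by have /andP[/(le_trans ler01)] := w1 s.
suff step (k : nat) : forall t, 0 <= t <= T -> u t <= (2 * delta + B / 2 ^+ k) * w t.
  apply: (@le_trans _ _ (2 * delta * w t)).
    apply: (@le_add_geometric _ _ (B * w t)) => [|k]; first by rewrite mulr_ge0.
    by rewrite (le_trans (step k t tT))// mulrDl (mulrAC B).
  by rewrite ler_wpM2l ?mulr_ge0//; have /andP[] := w1 t.
elim: k => [|k IH] {tT}t tT.
  rewrite expr0 divr1 (le_trans (uB _ tT))//.
  rewrite (@le_trans _ _ (B * w t))//.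
    by rewrite ler_peMr//; have /andP[] := w1 t.
  by rewrite ler_wpM2r// lerDr mulr_ge0.
rewrite (le_trans (uJ _ tT))//.
set D := 2 * delta + B / 2 ^+ k in IH.
have D0 : 0 <= D by rewrite addr_ge0 ?mulr_ge0 ?divr_ge0 ?exprn_ge0.
have Iw : mu.-integrable `]0, T[ (EFin \o w) by exact: Icont.
have uw : \int[mu]_(s in J t) u s <= D * \int[mu]_(s in J t) w s.
  rewrite -RintegralZl//; last exact: IJ.
  apply: le_Rintegral => //; [exact: IJ| |by move=> s /sJc; exact: IH].
  by apply: IJ; exact: integrable_EFinZ.
have Lw : L * \int[mu]_(s in J t) w s <= w t / 2.
  have i0 : 0 <= \int[mu]_(s in J t) w s by apply: Rintegral_ge0.
  by apply: half_weight => //; exact: wJ.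
have dw : delta <= delta * w t by rewrite ler_peMr//; have /andP[] := w1 t.
rewrite (@le_trans _ _ (delta + L * (D * \int[mu]_(s in J t) w s)))//.
  by rewrite lerD2l ler_wpM2l.
rewrite (@le_trans _ _ (delta * w t + D * (w t / 2)))//.
  by rewrite lerD// mulrCA ler_wpM2l.
rewrite le_eqVlt; apply/orP; left; apply/eqP.
by rewrite /D exprS invfM; field; rewrite expf_neq0.
Qed.

(** One estimate for three purposes: uniqueness ([delta = eta = 0]), continuous
    dependence on parameters, and the distance between the trajectories of two
    neighbouring vector fields ([delta = 0]). *)
Lemma volterra_stability n (y y' c c' phi phi' : R -> 'cV[R]_n)
    (L delta eta : R) : 0 <= L -> 0 <= delta -> 0 <= eta ->
  continuous y -> continuous y' ->
  (forall i, mu.-integrable `]0, T[ (EFin \o (fun s => phi s i ord0))) ->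
  (forall i, mu.-integrable `]0, T[ (EFin \o (fun s => phi' s i ord0))) ->
  (forall t i, 0 <= t <= T ->
     y t i ord0 = c t i ord0 + \int[mu]_(s in J t) phi s i ord0) ->
  (forall t i, 0 <= t <= T ->
     y' t i ord0 = c' t i ord0 + \int[mu]_(s in J t) phi' s i ord0) ->
  (forall t, 0 <= t <= T -> `|c t - c' t| <= delta) ->
  (forall s, 0 < s < T -> `|phi s - phi' s| <= eta + L * `|y s - y' s|) ->
  forall t, 0 <= t <= T ->
    `|y t - y' t| <= 2 * (delta + eta * T) * expR ((2 * L + 1) * T).
Proof.
move=> L0 d0 eta0 cy cy' Iphi Iphi' ey ey' cc' pp'.
have cu : continuous (fun t => `|y t - y' t|).
  by move=> t; apply: cvg_norm; apply: cvgB; [exact: cy|exact: cy'].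
have [B B0 uB] := compact_norm_bounded (@segment_compact R 0 T) cu.
apply: (@volterra_gronwall L (delta + eta * T) B) => //.
- by rewrite addr_ge0// mulr_ge0// ltW.
- exact: Icont.
- by move=> t tT; rewrite (le_trans _ (uB t _))// ?normr_id//= in_itv.
move=> t tT.
have i0 : 0 <= \int[mu]_(s in J t) `|y s - y' s| by apply: Rintegral_ge0.
apply: norm_le_entry => [|i j].
  by rewrite !addr_ge0// mulr_ge0// ltW.
rewrite ord1 !mxE ey// ey'//.
have -> (a b a' b' : R) : a + b - (a' + b') = (a - a') + (b - b') by ring.
rewrite -RintegralB//; [|exact: IJ..].
rewrite (le_trans (ler_normD _ _))// -addrA lerD//.
  by rewrite (le_trans _ (cc' t tT))// (le_trans _ (entry_le_norm _ i ord0))// !mxE.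
have Icst : mu.-integrable `]0, T[ (EFin \o (fun=> eta)).
  by apply: Icont => s; exact: cvg_cst.
have Iu : mu.-integrable `]0, T[ (EFin \o (fun s => L * `|y s - y' s|)).
  by apply: integrable_EFinZ => //; exact: Icont.
apply: (@le_trans _ _ (\int[mu]_(s in J t) (eta + L * `|y s - y' s|))).
  apply: normr_Rintegral_le => //.
  - by apply: IJ; apply: integrable_EFinB.
  - by apply: IJ; apply: integrable_EFinD.
  - move=> s /sJ; rewrite /= in_itv/= => sT; rewrite (le_trans _ (pp' s sT))//.
    by rewrite (le_trans _ (entry_le_norm _ i ord0))// !mxE.
rewrite RintegralD//; [|exact: IJ..].
rewrite RintegralZl//; last by apply: IJ; exact: Icont.
rewrite lerD2r (@le_trans _ _ (\int[mu]_(s in `]0, T[) eta))//.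
  by apply: Rintegral_le_subset.
by rewrite Rintegral_cst//= lebesgue_measure_itv/= lte_fin T0/= subr0.
Qed.

Section existence.
Variables (n : nat) (Phi : R -> 'cV[R]_n -> 'cV[R]_n) (c : R -> 'cV[R]_n).
Variable L : R.
Hypotheses (L0 : 0 <= L) (cc : continuous c).
Hypothesis cPhi : forall y : R -> 'cV[R]_n, continuous y ->
  continuous (fun s => Phi s (y s)).
Hypothesis PhiL : forall s x x', 0 <= s <= T ->
  `|Phi s x - Phi s x'| <= L * `|x - x'|.

Let Op (y : R -> 'cV[R]_n) (t : R) : 'cV[R]_n :=
  \col_i (c t i ord0 + \int[mu]_(s in J t) Phi s (y s) i ord0).

Let IPhi y i : continuous y ->
  mu.-integrable `]0, T[ (EFin \o (fun s => Phi s (y s) i ord0)).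
Proof. by move=> cy; apply: Icont; apply: entry_continuous; exact: cPhi. Qed.

Let Op_continuous y : continuous y -> continuous (Op y).
Proof.
move=> cy; apply: mx_continuous => i j.
rewrite (_ : (fun x => _) = fun t => c t i ord0 +
    \int[mu]_(s in J t) Phi s (y s) i ord0); last first.
  by apply/funext => t; rewrite mxE.
move=> t; apply: cvgD; first exact: entry_continuous.
by apply: cJ; exact: IPhi.
Qed.

Let Op_contract (w : R -> R) D y y' : continuous w -> (forall s, 0 <= w s) ->
  (forall t, (2 * L + 1) * \int[mu]_(s in J t) w s <= w t) ->
  0 <= D -> continuous y -> continuous y' ->
  (forall s, 0 <= s <= T -> `|y s - y' s| <= D * w s) ->
  forall t, `|Op y t - Op y' t| <= D / 2 * w t.
Proof.
move=> cw w0 wJ D0 cy cy' yy' t.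
have D20 : 0 <= D / 2 * w t by rewrite !mulr_ge0.
apply: norm_le_entry => // i j; rewrite !mxE opprD addrACA subrr add0r.
rewrite -RintegralB//; [|by apply: IJ; exact: IPhi..].
have Iw : mu.-integrable `]0, T[ (EFin \o (fun s => (L * D) * w s)).
  by apply: integrable_EFinZ => //; exact: Icont.
apply: (@le_trans _ _ (\int[mu]_(s in J t) ((L * D) * w s))).
  apply: normr_Rintegral_le => //.
  - by apply: IJ; apply: integrable_EFinB => //; exact: IPhi.
  - exact: IJ.
  - move=> s /sJc sT.
    rewrite (@le_trans _ _ `|Phi s (y s) - Phi s (y' s)|)//.
      by rewrite (le_trans _ (entry_le_norm _ i ord0))// !mxE.
    by rewrite (le_trans (PhiL _ _ sT))// -mulrA ler_wpM2l// yy'.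
rewrite RintegralZl//; last by apply: IJ; exact: Icont.
have i0 : 0 <= \int[mu]_(s in J t) w s by apply: Rintegral_ge0.
have Lw : L * \int[mu]_(s in J t) w s <= w t / 2.
  by apply: half_weight => //; exact: wJ.
by rewrite (mulrC L) -!mulrA ler_wpM2l// (le_trans Lw)// mulrC.
Qed.

Let iterates : exists x : nat -> R -> 'cV[R]_n,
  [/\ forall k, continuous (x k), x 0%N = Op c & forall k, x k.+1 = Op (x k)].
Proof.
exists (fun k => iter k.+1 Op c); split => //.
by elim=> [|k IH]; exact: Op_continuous.
Qed.

(** Picard iteration: measured against the weight of [time_family], the
    operator [Op] halves distances. *)
Lemma volterra_exists : exists2 y : R -> 'cV[R]_n, continuous y &
  forall t i, y t i ord0 = c t i ord0 + \int[mu]_(s in J t) Phi s (y s) i ord0.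
Proof.
have L1 : 0 < 2 * L + 1 by rewrite ltr_wpDl// mulr_ge0.
case: JT => _ _ _ /(_ _ L1)[w [cw w1 wJ]].
have w0 s : 0 <= w s by have /andP[/(le_trans ler01)] := w1 s.
have [x [x_continuous x0 xS]] := iterates.
have cxc : continuous (fun t => x 0%N t - c t).
  by move=> t; apply: cvgB; [exact: (x_continuous 0%N)|exact: cc].
have [C C0 xC] := compact_norm_bounded (@segment_compact R 0 T) cxc.
have step k t : `|x k.+1 t - x k t| <= C / 2 ^+ k * w t.
  elim: k t => [|k IH] t.
    rewrite (@le_trans _ _ (C / 2 * w t))//.
      rewrite xS [in X in _ - X]x0; apply: Op_contract => //.
      move=> s sT; apply: le_trans (xC s _) _; first by rewrite /= in_itv.
      by rewrite ler_peMr//; have /andP[] := w1 s.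
    by rewrite expr0 divr1 ler_wpM2r// ler_pdivrMr// ler_peMr// ler1n.
  have -> : C / 2 ^+ k.+1 = C / 2 ^+ k / 2 by rewrite exprS invfM; ring.
  rewrite xS [in X in _ - X]xS; apply: Op_contract => //.
  by rewrite divr_ge0 ?exprn_ge0.
have far j k t : `|x (k + j)%N t - x k t| <= 2 * C / 2 ^+ k * w t.
  elim: j k => [|j IH] k.
    by rewrite addn0 subrr normr0 !mulr_ge0// invr_ge0 exprn_ge0.
  rewrite addnS -addSn -(subrKA (x k.+1 t)) (le_trans (ler_normD _ _))//.
  rewrite (le_trans (lerD (IH _) (step _ _)))//.
  rewrite -mulrDl exprS invfM le_eqVlt; apply/orP; left; apply/eqP.
  by congr (_ * _); field; rewrite expf_neq0.
pose E := 2 * C * expR ((2 * L + 1) * T).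
have E0 : 0 <= E by rewrite !mulr_ge0 ?expR_ge0.
have farE j k t : `|x (k + j)%N t - x k t| <= E / 2 ^+ k.
  rewrite (le_trans (far _ _ _))// /E (mulrAC _ (expR _)) ler_wpM2l//.
    by rewrite !mulr_ge0// invr_ge0 exprn_ge0.
  by have /andP[] := w1 t.
have small (e : R) : 0 < e -> exists k : nat, E / 2 ^+ k < e.
  move=> e0; apply: contrapT => /forallNP H.
  have : e <= 0; last by rewrite leNgt e0.
  apply: (@le_add_geometric _ _ E) => // k; rewrite add0r leNgt; apply/negP.
  exact: H.
have cvgx t : cvgn (fun k => x k t).
  apply: cauchy_cvg; apply: cauchy_exP => e e0.
  have [k ke] := small _ e0; exists (x k t).
  exists k => // j /= kj.
  rewrite -ball_normE /ball_/= distrC -(subnKC kj).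
  exact: le_lt_trans (farE _ _ _) ke.
pose y t := limn (fun k => x k t).
have xy k t : `|x k t - y t| <= E / 2 ^+ k.
  apply/ler_addgt0Pr => e e0.
  have /cvgrPdist_lt/(_ _ e0)[N _ xN] := cvgx t.
  rewrite -(subrKA (x (k + N)%N t)) (le_trans (ler_normD _ _))// lerD//.
    by rewrite distrC.
  by rewrite distrC ltW// xN//= leq_addl.
have cy : continuous y.
  move=> t; apply/cvgrPdist_le => e e0.
  have e30 : 0 < e / 3 by rewrite divr_gt0.
  have [k ke] := small _ e30.
  have /cvgrPdist_le/(_ _ e30) := x_continuous k t.
  apply: filterS => s xs.
  have := xy k t; have := xy k s; rewrite distrC => ys yt.
  have -> : y t - y s = (y t - x k t) + (x k t - x k s) + (x k s - y s).
    by rewrite !addrA !subrK.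
  rewrite (le_trans (ler_normD _ _))//.
  rewrite (_ : e = e / 3 + e / 3 + e / 3); last by field.
  rewrite lerD//; last by rewrite (le_trans _ (ltW ke))// xy.
  rewrite (le_trans (ler_normD _ _))// lerD//.
  by rewrite distrC (le_trans _ (ltW ke))// xy.
exists y => // t i.
suff -> : y t = Op y t by rewrite mxE.
apply/eqP; rewrite -subr_eq0 -normr_le0.
apply: (@le_add_geometric _ _ (2 * E * w t)) => [|k]; first by rewrite !mulr_ge0.
rewrite add0r -(subrKA (x k.+1 t)) (le_trans (ler_normD _ _))//.
have h1 : `|y t - x k.+1 t| <= E / 2 ^+ k * w t.
  rewrite distrC (le_trans (xy _ _))// exprS invfM mulrCA.
  have e0 : 0 <= E / 2 ^+ k by rewrite divr_ge0 ?exprn_ge0.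
  have /andP[wt _] := w1 t.
  rewrite (@le_trans _ _ (E / 2 ^+ k))// ?ler_peMr//.
  by rewrite ler_piMl// invf_le1// ler1n.
have h2 : `|x k.+1 t - Op y t| <= E / 2 ^+ k / 2 * w t.
  rewrite xS; apply: Op_contract => //; first by rewrite divr_ge0 ?exprn_ge0.
  move=> s _; rewrite (le_trans (xy _ _))// ler_peMr ?divr_ge0 ?exprn_ge0//.
  by have /andP[] := w1 s.
rewrite (le_trans (lerD h1 h2))//.
have q0 : 0 <= E / 2 ^+ k * w t by rewrite mulr_ge0// divr_ge0 ?exprn_ge0.
have -> : 2 * E * w t / 2 ^+ k = 2 * (E / 2 ^+ k * w t) by ring.
rewrite [E / 2 ^+ k / 2 * w t]mulrAC mulrDl mul1r lerD2l.
by rewrite ler_piMr// invf_le1// ler1n.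
Qed.

End existence.

(** The equation is solved for each parameter separately. The data of two
    neighbouring parameters are uniformly close on [0, T] by the tube lemma, so
    [volterra_stability] makes the solutions uniformly close, which is joint
    continuity because each solution is continuous in time. *)
Lemma volterra_param n (Z : topologicalType) (Psi : Z * R * 'cV[R]_n -> 'cV[R]_n)
    (c : Z * R -> 'cV[R]_n) :
  continuous Psi -> continuous c ->
  (forall z : Z, exists2 L, 0 <= L & \forall z' \near z, forall s x x',
     0 <= s <= T -> `|Psi (z', s, x) - Psi (z', s, x')| <= L * `|x - x'|) ->
  exists2 Y : Z * R -> 'cV[R]_n, continuous Y &
    forall z t i, 0 <= t <= T -> Y (z, t) i ord0 = c (z, t) i ord0 +
      \int[mu]_(s in J t) Psi (z, s, Y (z, s)) i ord0.
Proof.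
move=> cPsi cc LPsi.
have cPsiy z (y : R -> 'cV[R]_n) : continuous y -> continuous (fun s => Psi (z, s, y s)).
  move=> cy; apply: (@continuous_compose _ _ _ (fun s => (z, s, y s))) => //.
  apply: continuous_pair => //; apply: continuous_pair => s.
    exact: cvg_cst.
  exact: cvg_id.
have ex z : {y : R -> 'cV[R]_n | continuous y /\ forall t i, y t i ord0 =
    c (z, t) i ord0 + \int[mu]_(s in J t) Psi (z, s, y s) i ord0}.
  apply: cid; have [L L0 /nbhs_singleton HL] := LPsi z.
  have [|||y cy ey] := @volterra_exists n (fun s x => Psi (z, s, x))
    (fun t => c (z, t)) L L0.
  - exact: continuous_section.
  - exact: cPsiy.
  - by move=> *; exact: HL.
  - by exists y.
pose y z := sval (ex z).
have cy z : continuous (y z) by case: (svalP (ex z)).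
have ey z t i : y z t i ord0 = c (z, t) i ord0 +
    \int[mu]_(s in J t) Psi (z, s, y z s) i ord0.
  by case: (svalP (ex z)) => _; exact.
pose Y (zt : Z * R) := y zt.1 (clamp T zt.2).
exists Y; last first.
  move=> z t i tT; rewrite /Y/= clamp_id// ey; congr (_ + _).
  by apply: eq_Rintegral => s; rewrite inE => /sJc sT; rewrite clamp_id.
move=> [z t]; apply/cvgrPdist_le => e e0; rewrite /Y/=.
have [L L0 HL] := LPsi z.
have e20 : 0 < e / 2 by rewrite divr_gt0.
pose K := 2 * (1 + T) * expR ((2 * L + 1) * T).
have K0 : 0 < K by rewrite !mulr_gt0 ?expR_gt0// ltr_wpDr// ltW.
have eK : 0 < e / 2 / K by rewrite divr_gt0.
have tubc := tube_lemma (@segment_compact R 0 T) cc z eK.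
have cPy : continuous (fun zs : Z * R => Psi (zs.1, zs.2, y z zs.2)).
  apply: (@continuous_compose _ _ _ (fun zs : Z * R => (zs.1, zs.2, y z zs.2))) => //.
  apply: continuous_pair; last first.
    by apply: continuous_compose => //; exact: continuous_snd.
  by apply: continuous_pair; [exact: continuous_fst|exact: continuous_snd].
have tubP := tube_lemma (@segment_compact R 0 T) cPy z eK.
have yt : \forall s \near t, `|y z (clamp T t) - y z (clamp T s)| <= e / 2.
  have cyc : continuous (fun s => y z (clamp T s)).
    by apply: continuous_compose => //; exact: continuous_clamp.
  by have /cvgrPdist_le/(_ _ e20) := cyc t.
near=> x.
rewrite -(subrKA (y z (clamp T x.2))) (le_trans (ler_normD _ _))//.
rewrite [e]splitr lerD//.
  near: x; exact: (@continuous_snd Z R (z, t) _ yt).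
have -> : e / 2 = 2 * (e / 2 / K + e / 2 / K * T) * expR ((2 * L + 1) * T).
  rewrite -[LHS](divfK (lt0r_neq0 K0)) {2}/K.
  by set q := e / 2 / _; ring.
apply: (@volterra_stability n (y z) (y x.1) (fun t => c (z, t))
  (fun t => c (x.1, t)) (fun s => Psi (z, s, y z s))
  (fun s => Psi (x.1, s, y x.1 s))) => //.
- exact: ltW.
- exact: ltW.
- by move=> i; apply: Icont; apply: entry_continuous; exact: cPsiy.
- by move=> i; apply: Icont; apply: entry_continuous; exact: cPsiy.
- move=> s sT; rewrite distrC; move: s sT.
  have : forall s, `[0, T]%classic s -> `|c (x.1, s) - c (z, s)| <= e / 2 / K.
    near: x; exact: (@continuous_fst Z R (z, t) _ tubc).
  by move=> H s sT; apply: H; rewrite /= in_itv.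
- move=> s /andP[/ltW s0 /ltW sT]; have sT' : 0 <= s <= T by rewrite s0.
  rewrite -(subrKA (Psi (x.1, s, y z s))) (le_trans (ler_normD _ _))// lerD//.
    rewrite distrC; move: s sT' {s0 sT}.
    have : forall s, `[0, T]%classic s ->
        `|Psi (x.1, s, y z s) - Psi (z, s, y z s)| <= e / 2 / K.
      near: x; exact: (@continuous_fst Z R (z, t) _ tubP).
    by move=> H s sT; apply: H; rewrite /= in_itv.
  move: s sT' {s0 sT} => s sT.
  have : forall s x0 x', 0 <= s <= T ->
     `|Psi (x.1, s, x0) - Psi (x.1, s, x')| <= L * `|x0 - x'|.
    near: x; exact: (@continuous_fst Z R (z, t) _ HL).
  by apply.
- exact: clamp_itv (ltW T0).
Unshelve. all: by end_near. Qed.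

End volterra.

(** * Square-integrable functions and test functions *)

Section square_integrable.
Context {R : realType}.
Local Notation mu := (@lebesgue_measure R).
Variable T : R.

Let mI : @measurable _ (measurableTypeR R) `]0, T[.
Proof. by []. Qed.

Lemma continuous_L2 n (v : R -> 'cV[R]_n) : {within `[0, T], continuous v} ->
  L2 0 T v.
Proof.
move=> cv i; have cvi : {within `[0, T], continuous (fun t => v t i ord0)}.
  by apply: (@entry_continuous R (subspace `[0, T]%classic) _ _ v i ord0).
split; first exact: integrable_measurable (continuous_integrable_oo cvi).
apply: (@continuous_integrable_oo _ _ (fun t => v t i ord0 ^+ 2)).
by move=> t; apply: cvgM; exact: cvi.
Qed.

Lemma L2_integrable n (v : R -> 'cV[R]_n) i : L2 0 T v ->
  mu.-integrable `]0, T[ (EFin \o (fun t => v t i ord0)).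
Proof.
move=> /(_ i)[mv Iv].
apply: (@integrable_EFin_le _ _ _ mu _ mI _ (fun t => 1 + v t i ord0 ^+ 2)) => //.
  move=> t _; rewrite -(real_normK (num_real (v t i ord0))).
  by have := normr_ge0 (v t i ord0); nra.
apply: integrable_EFinD => //.
by apply: continuous_integrable_oo => t; exact: cvg_cst.
Qed.

Lemma L2_mul n (v w : R -> 'cV[R]_n) i j : L2 0 T v -> L2 0 T w ->
  mu.-integrable `]0, T[ (EFin \o (fun t => v t i ord0 * w t j ord0)).
Proof.
move=> /(_ i)[mv Iv] /(_ j)[mw Iw].
apply: (@integrable_EFin_le _ _ _ mu _ mI _
  (fun t => v t i ord0 ^+ 2 + w t j ord0 ^+ 2)) => //.
- exact: measurable_funM.
- move=> t _; rewrite normrM -(real_normK (num_real (v t i ord0))).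
  rewrite -(real_normK (num_real (w t j ord0))).
  by have := normr_ge0 (v t i ord0); have := normr_ge0 (w t j ord0); nra.
- exact: integrable_EFinD.
Qed.

Lemma L2D n (v w : R -> 'cV[R]_n) : L2 0 T v -> L2 0 T w ->
  L2 0 T (fun t => v t + w t).
Proof.
move=> Lv Lw i; have [mv Iv] := Lv i; have [mw Iw] := Lw i; split.
  rewrite (_ : (fun t => _) = fun t => v t i ord0 + w t i ord0).
    exact: measurable_funD.
  by apply/funext => t; rewrite mxE.
rewrite (_ : (fun t => _) = EFin \o (fun t => (v t i ord0 ^+ 2 + w t i ord0 ^+ 2) +
    2 * (v t i ord0 * w t i ord0))); last first.
  by apply/funext => t /=; rewrite mxE; congr EFin; ring.
apply: integrable_EFinD => //; first exact: integrable_EFinD.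
by apply: integrable_EFinZ => //; exact: L2_mul.
Qed.

Lemma L2Z n (a : R) (v : R -> 'cV[R]_n) : L2 0 T v -> L2 0 T (fun t => a *: v t).
Proof.
move=> Lv i; have [mv Iv] := Lv i; split.
  rewrite (_ : (fun t => _) = fun t => a * v t i ord0).
    exact: measurable_funM.
  by apply/funext => t; rewrite mxE.
rewrite (_ : (fun t => _) = EFin \o (fun t => a ^+ 2 * v t i ord0 ^+ 2)).
  exact: integrable_EFinZ.
by apply/funext => t /=; rewrite mxE exprMn.
Qed.

Lemma L2B n (v w : R -> 'cV[R]_n) : L2 0 T v -> L2 0 T w ->
  L2 0 T (fun t => v t - w t).
Proof.
move=> Lv Lw; rewrite (_ : (fun t => _) = fun t => v t + (-1) *: w t).
  by apply: L2D => //; exact: L2Z.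
by apply/funext => t; rewrite scaleN1r.
Qed.

Lemma eq_L2 n (v w : R -> 'cV[R]_n) :
  (forall t, 0 < t < T -> v t = w t) -> L2 0 T v -> L2 0 T w.
Proof.
move=> vw Lv i; have [mv Iv] := Lv i; split.
  apply: eq_measurable_fun mv => t; rewrite inE/= in_itv/= => tT.
  by rewrite vw.
apply: eq_integrable Iv => // t; rewrite inE/= in_itv/= => tT.
by rewrite vw.
Qed.

Lemma L2_mulmx p n (A : 'M[R]_(p, n)) (v : R -> 'cV[R]_n) : L2 0 T v ->
  L2 0 T (fun t => A *m v t).
Proof.
move=> Lv i; split.
  rewrite (_ : (fun t => _) = fun t => \sum_j A i j * v t j ord0); last first.
    by apply/funext => t; rewrite mxE.
  apply: (@integrable_measurable _ _ _ mu); apply: integrable_EFin_sum => // j.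
  by apply: integrable_EFinZ => //; exact: L2_integrable.
rewrite (_ : (fun t => _) = EFin \o (fun t =>
    \sum_j \sum_k (A i j * A i k) * (v t j ord0 * v t k ord0))).
  apply: integrable_EFin_sum => // j; apply: integrable_EFin_sum => // k.
  by apply: integrable_EFinZ => //; exact: L2_mul.
apply/funext => t /=; rewrite mxE; congr EFin.
rewrite expr2 mulr_suml; apply: eq_bigr => j _; rewrite mulr_sumr.
by apply: eq_bigr => k _; ring.
Qed.

Lemma L2_integrable_enorm n (v : R -> 'cV[R]_n) : L2 0 T v ->
  mu.-integrable `]0, T[ (EFin \o (fun t => enorm (v t) ^+ 2)).
Proof.
move=> Lv; rewrite (_ : EFin \o _ = EFin \o (fun t => \sum_i v t i ord0 ^+ 2)).
  by apply: integrable_EFin_sum => // i; have [_] := Lv i.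
by apply/funext => t /=; rewrite sqr_enorm_cV.
Qed.

End square_integrable.

Section by_parts.
Context {R : realType}.
Local Notation mu := (@lebesgue_measure R).
Variable T : R.
Hypothesis T0 : 0 < T.

Lemma test_fun_out (phi : R -> R) : test_fun 0 T phi ->
  (forall t, t <= 0 -> phi t = 0) /\ (forall t, T <= t -> phi t = 0).
Proof.
move=> [_ _ [c [d [c0 dT phi0]]]]; split=> t tb; apply: phi0 => /andP[ct td].
  by have := lt_le_trans c0 (le_trans ct tb); rewrite ltxx.
by have := le_lt_trans (le_trans tb td) dT; rewrite ltxx.
Qed.

Lemma test_fun_integral (phi : R -> R) s : test_fun 0 T phi -> s <= T ->
  \int[mu]_(t in `]s, T[) derive1 phi t = - phi s.
Proof.
move=> tphi sT; have [_ phiT] := test_fun_out tphi.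
by case: tphi => dphi cphi _; rewrite (Rintegral_derive1 sT dphi cphi) phiT// sub0r.
Qed.

Let EFin_Rintegral (D : set R) (f : R -> R) : @measurable _ (measurableTypeR R) D ->
  mu.-integrable D (EFin \o f) ->
  (\int[mu]_(x in D) (f x)%:E)%E = (\int[mu]_(x in D) f x)%:E.
Proof. by move=> mD If; rewrite /Rintegral fineK//; exact: integrable_fin_num. Qed.

(** Fubini's theorem on the triangle [0 < s < t < T]. *)
Lemma primitive_by_parts (v g : R -> R) :
  mu.-integrable `]0, T[ (EFin \o v) -> continuous g ->
  \int[mu]_(t in `]0, T[) ((\int[mu]_(s in `]0, t[) v s) * g t) =
  \int[mu]_(s in `]0, T[) (v s * \int[mu]_(t in `]s, T[) g t).
Proof.
move=> Iv cg.
have Ig : mu.-integrable `]0, T[ (EFin \o g).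
  by apply: continuous_integrable_oo; exact: continuous_subspaceT.
have [C C0 gC] := compact_norm_bounded (@segment_compact R 0 T) cg.
pose a := v \_ `]0, T[; pose b := g \_ `]0, T[.
have Ia : mu.-integrable setT (EFin \o a).
  by rewrite /a -restrict_EFin; apply/integrable_restrict; rewrite ?setTI.
have Ib : mu.-integrable setT (EFin \o b).
  by rewrite /b -restrict_EFin; apply/integrable_restrict; rewrite ?setTI.
have bC t : `|b t| <= C * \1_(`]0, T[%classic : set R) t.
  rewrite /b patchE indicE; case: ifPn => tT; last by rewrite normr0 mulr0.
  rewrite mulr1; apply: gC; apply: subset_itv_oo_cc; exact: set_mem tT.
pose F (x : measurableTypeR R * measurableTypeR R) : R :=
  if x.1 < x.2 then a x.1 * b x.2 else 0.
have ma : measurable_fun setT a by exact: integrable_measurable Ia.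
have mb : measurable_fun setT b by exact: integrable_measurable Ib.
have mF : measurable_fun setT F.
  apply: measurable_fun_ifT.
  - by apply: measurable_fun_ltr; [exact: measurable_fst|exact: measurable_snd].
  - apply: measurable_funM.
      exact: (measurableT_comp ma measurable_fst).
    exact: (measurableT_comp mb measurable_snd).
  - exact: measurable_cst.
have mEF : measurable_fun setT (EFin \o F) by exact/measurable_EFinP.
have IF : (mu \x mu)%E.-integrable setT (EFin \o F).
  apply/(integrable12ltyP _ _ mEF).
  have IaC : mu.-integrable setT (EFin \o (fun s => (C * T) * `|a s|)).
    by apply: integrable_EFinZ => //; exact: integrable_EFin_norm.
  apply: (@le_lt_trans _ _ (\int[mu]_s ((C * T) * `|a s|)%:E)%E); last first.
    exact: (integrable_lty _ IaC).
  apply: ge0_le_integral => //.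
  - by move=> s _; apply: integral_ge0.
  - apply: (measurable_fun_fubini_tonelli_F (m2 := mu) (abse \o (EFin \o F))).
      exact: measurableT_comp.
    by move=> x; exact: abse_ge0.
  - exact: (measurable_int mu IaC).
  - move=> s _.
    apply: (@le_trans _ _ (\int[mu]_t ((`|a s| * C)%:E * (\1_(`]0, T[%classic : set R) t)%:E))%E).
      apply: ge0_le_integral => //.
      + by apply: measurableT_comp => //; exact: (measurableT_comp mEF (pair1_measurable s)).
      + by apply: measurable_funeM; apply/measurable_EFinP; exact: measurable_indic.
      + move=> t _; rewrite /= -EFinM lee_fin /F/=; case: ifPn => _; last first.
          by rewrite normr0 mulr_ge0// mulr_ge0.
        by rewrite normrM -mulrA ler_wpM2l.
    rewrite ge0_integralZl//; last 2 first.
      by apply/measurable_EFinP; exact: measurable_indic.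
      by rewrite lee_fin mulr_ge0.
    rewrite integral_indic// setIT /= lebesgue_measure_itv/= lte_fin T0 -EFinD -EFinM.
    rewrite lee_fin subr0 le_eqVlt; apply/orP; left; apply/eqP; ring.
pose K1 s := v s * \int[mu]_(t in `]s, T[) g t.
pose K2 t := (\int[mu]_(s in `]0, t[) v s) * g t.
have := Fubini IF; rewrite [X in X = _](_ : _ =
    (\int[mu]_(s in `]0%R, T[) (K1 s)%:E)%E); last first.
  rewrite [RHS]integral_mkcond; apply: eq_integral => s _.
  rewrite patchE; case: ifPn => sT; last first.
    apply: integral0_eq => t _; rewrite /F/= /a patchE (negbTE sT) mul0r.
    by case: ifP.
  move: (set_mem sT); rewrite /= in_itv/= => /andP[s0 sT'].
  rewrite /K1 -RintegralZl//; last by apply: integrable_sub_oo Ig => //; exact: ltW.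
  rewrite -EFin_Rintegral//; last first.
    by apply: integrable_EFinZ => //; apply: integrable_sub_oo Ig => //; exact: ltW.
  rewrite [RHS]integral_mkcond; apply: eq_integral => t _.
  rewrite /F/= /a /b !patchE sT; case: ifPn => st.
    case: ifPn => tT; case: ifPn => tT' //=.
    - by move: (set_mem tT) tT'; rewrite notin_setE/= !in_itv/= st => /andP[_ ->].
    - rewrite mulr0; move: (set_mem tT') tT; rewrite notin_setE/= !in_itv/=.
      by move=> /andP[_ ->]; rewrite (lt_trans s0 st).
    - by rewrite mulr0.
  by case: ifPn => // /set_mem; rewrite /= in_itv/= (negbTE st).
rewrite [X in _ = X](_ : _ =
    (\int[mu]_(t in `]0%R, T[) (K2 t)%:E)%E); last first.
  rewrite [RHS]integral_mkcond; apply: eq_integral => t _.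
  rewrite patchE; case: ifPn => tT; last first.
    apply: integral0_eq => s _; rewrite /F/= /b patchE (negbTE tT) mulr0.
    by case: ifP.
  move: (set_mem tT); rewrite /= in_itv/= => /andP[t0 tT'].
  rewrite /K2 -RintegralZr//; last by apply: integrable_sub_oo Iv => //; exact: ltW.
  rewrite -EFin_Rintegral//; last first.
    rewrite (_ : EFin \o _ = EFin \o (fun s => g t * v s)); last first.
      by apply/funext => s /=; rewrite mulrC.
    by apply: integrable_EFinZ => //; apply: integrable_sub_oo Iv => //; exact: ltW.
  rewrite [RHS]integral_mkcond; apply: eq_integral => s _.
  rewrite /F/= /a /b !patchE tT; case: ifPn => st.
    case: ifPn => sT; case: ifPn => sT' //=.
    - by move: (set_mem sT) sT'; rewrite notin_setE/= !in_itv/= st => /andP[->].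
    - rewrite mul0r; move: (set_mem sT') sT; rewrite notin_setE/= !in_itv/=.
      by move=> /andP[-> _]; rewrite (lt_trans st tT').
    - by rewrite mul0r.
  by case: ifPn => // /set_mem; rewrite /= in_itv/= (negbTE st) andbF.
by move=> E; rewrite /Rintegral; congr fine; exact: esym.
Qed.

End by_parts.

Section bump.
Context {R : realType}.
Local Notation mu := (@lebesgue_measure R).
Implicit Types (c h t : R).

Definition hinge t : R := Num.max 0 t.
Definition sqhinge t : R := hinge t ^+ 2.

(** Second difference of [sqhinge]: a C^1 step that climbs from 0 to
    [2 * h ^+ 2] on [c - h, c + h]; its derivative is a tent. *)
Definition step c h t : R :=
  sqhinge (t - c + h) - 2 * sqhinge (t - c) + sqhinge (t - c - h).
Definition tent c h t : R :=
  2 * (hinge (t - c + h) - 2 * hinge (t - c) + hinge (t - c - h)).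

Lemma hinge_continuous : continuous hinge.
Proof.
by move=> t; apply: continuous_max; [exact: cvg_cst|exact: cvg_id].
Qed.

Lemma sqhinge_taylor t s :
  `|sqhinge (s + t) - sqhinge t - 2 * hinge t * s| <= s ^+ 2.
Proof.
rewrite /sqhinge /hinge.
by case: (leP 0 (s + t)) => h1; case: (leP 0 t) => h2;
  rewrite ler_norml; apply/andP; split; nra.
Qed.

Lemma is_derive_sqhinge t : is_derive t 1 sqhinge (2 * hinge t).
Proof.
have H : (fun h => h^-1 *: ((sqhinge \o shift t) (h *: 1) - sqhinge t)) @ 0^' -->
    2 * hinge t.
  apply/cvgrPdist_le => e e0; near=> h.
  have h0 : h != 0 by near: h; exact: nbhs_dnbhs_neq.
  have he : `|h| <= e by near: h; exact: dnbhs0_le.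
  rewrite /= distrC; rewrite (le_trans _ he)// -[X in `|X - _|](mulr1).
  rewrite /GRing.scale/= !mulr1.
  have -> : h^-1 * (sqhinge (h + t) - sqhinge t) - 2 * hinge t =
      h^-1 * (sqhinge (h + t) - sqhinge t - 2 * hinge t * h) by field.
  rewrite normrM normfV mulrC ler_pdivrMr ?normr_gt0//.
  by rewrite (le_trans (sqhinge_taylor _ _))// -real_normK ?num_real// expr2.
apply: DeriveDef; first by apply/cvg_ex; exists (2 * hinge t).
by apply/cvg_lim.
Unshelve. all: by end_near. Qed.

Lemma is_derive_step c h t : is_derive t 1 (step c h) (tent c h t).
Proof.
have D a : is_derive t 1 (fun t => sqhinge (t + a)) (2 * hinge (t + a)).
  have D1 : is_derive t 1 (fun t => t + a) 1 by apply: is_derive_eq; rewrite addr0.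
  by have := @is_derive1_comp _ sqhinge (+%R^~ a) t _ _ (is_derive_sqhinge (t + a)) D1; rewrite mulr1.
rewrite (_ : step c h = fun t => sqhinge (t + (- c + h)) - 2 * sqhinge (t - c) +
    sqhinge (t + (- c - h))); last first.
  by apply/funext => s; rewrite /step !addrA.
have := D (- c + h); have := D (- c); have := D (- c - h) => D1 D2 D3.
apply: is_derive_eq; rewrite /tent /GRing.scale/= !addrA.
by ring.
Qed.

Lemma tent_continuous c h : continuous (tent c h).
Proof.
have D a : continuous (fun t => hinge (t + a)).
  apply: (@continuous_compose _ _ _ (fun t => t + a)); last exact: hinge_continuous.
  by move=> t; apply: cvgD; [exact: cvg_id|exact: cvg_cst].
rewrite (_ : tent c h = fun t => 2 * (hinge (t + (- c + h)) -
   2 * hinge (t + - c) + hinge (t + (- c - h)))); last first.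
  by apply/funext => s; rewrite /tent !addrA.
move=> t; apply: cvgM; first exact: cvg_cst.
apply: cvgD; last exact: D.
apply: cvgB; first exact: D.
by apply: cvgM; [exact: cvg_cst|exact: D].
Qed.

Lemma tent_ge0 c h t : 0 <= h -> 0 <= tent c h t.
Proof.
move=> h0; rewrite /tent /hinge mulr_ge0//.
by case: (leP 0 (t - c + h)) => h1; case: (leP 0 (t - c)) => h2;
  case: (leP 0 (t - c - h)) => h3; lra.
Qed.

Lemma tent_out c h t : 0 <= h -> h <= `|t - c| -> tent c h t = 0.
Proof.
move=> h0; rewrite /tent /hinge ler_normr => H.
have {H} H : t - c <= - h \/ h <= t - c.
  by case/orP : H => H; [right|left; lra].
case: (leP 0 (t - c + h)) => h1; case: (leP 0 (t - c)) => h2;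
  case: (leP 0 (t - c - h)) => h3; case: H => H; lra.
Qed.

Lemma step_left c h t : 0 <= h -> t <= c - h -> step c h t = 0.
Proof.
move=> h0 tc; rewrite /step /sqhinge /hinge.
have -> : Num.max 0 (t - c + h) = 0 by apply/max_idPl; lra.
have -> : Num.max 0 (t - c) = 0 by apply/max_idPl; lra.
have -> : Num.max 0 (t - c - h) = 0 by apply/max_idPl; lra.
by rewrite expr0n/= mulr0 subrr addr0.
Qed.

Lemma step_right c h t : 0 <= h -> c + h <= t -> step c h t = 2 * h ^+ 2.
Proof.
move=> h0 tc; rewrite /step /sqhinge /hinge.
have -> : Num.max 0 (t - c + h) = t - c + h by apply/max_idPr; lra.
have -> : Num.max 0 (t - c) = t - c by apply/max_idPr; lra.
have -> : Num.max 0 (t - c - h) = t - c - h by apply/max_idPr; lra.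
by ring.
Qed.

Lemma derivable_step c h t : derivable (step c h) t 1.
Proof. by have D := is_derive_step c h t; exact: ex_derive. Qed.

Lemma derive1_step c h : derive1 (step c h) = tent c h.
Proof.
by apply/funext => t; have D := is_derive_step c h t; rewrite derive1E derive_val.
Qed.

Variable T : R.

Lemma test_fun_step c d h : 0 < h -> h < c -> h < d -> c + h < T -> d + h < T ->
  test_fun 0 T (fun t => step c h t - step d h t) /\
  derive1 (fun t => step c h t - step d h t) = (fun t => tent c h t - tent d h t).
Proof.
move=> h0 hc hd cT dT.
have E : derive1 (fun t => step c h t - step d h t) = (fun t => tent c h t - tent d h t).
  apply/funext => t; rewrite derive1E.
  have D1 := is_derive_step c h t; have D2 := is_derive_step d h t.
  by rewrite deriveB// !derive_val.
split=> //; split.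
- by move=> t; apply: derivableB; exact: derivable_step.
- by rewrite E => t; apply: cvgB; exact: tent_continuous.
- exists (Num.min c d - h), (Num.max c d + h); split.
  + by rewrite subr_gt0 lt_min hc.
  + by rewrite -ltrBrDr gt_max !ltrBrDr cT.
  + move=> t /negP; rewrite negb_and -!ltNge => /orP[H|H].
      rewrite !step_left ?subrr ?(ltW h0)//.
        by rewrite (le_trans (ltW H))// lerD2r ge_min lexx orbT.
      by rewrite (le_trans (ltW H))// lerD2r ge_min lexx.
    rewrite !step_right ?subrr ?(ltW h0)//.
      by rewrite (le_trans _ (ltW H))// lerD2r le_max lexx orbT.
    by rewrite (le_trans _ (ltW H))// lerD2r le_max lexx.
Qed.

Lemma tent_average (w : R -> R) c h eta : 0 < h -> h < c -> c + h < T ->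
  continuous w -> (forall t, `|t - c| < h -> `|w t - w c| <= eta) ->
  `|\int[mu]_(t in `]0, T[) (w t * tent c h t) - w c * (2 * h ^+ 2)| <=
    eta * (2 * h ^+ 2).
Proof.
move=> h0 hc cT cw weta.
have T0 : 0 < T by lra.
have Et : \int[mu]_(t in `]0, T[) tent c h t = 2 * h ^+ 2.
  rewrite -derive1_step Rintegral_derive1 ?ltW//.
  - rewrite step_right ?(ltW h0) ?(ltW cT)// step_left ?subr0 ?(ltW h0)//.
    by rewrite subr_ge0 ltW.
  - by move=> t; exact: derivable_step.
  - by rewrite derive1_step; exact: tent_continuous.
have Ic (f : R -> R) : continuous f -> mu.-integrable `]0, T[ (EFin \o f).
  by move=> cf; apply: continuous_integrable_oo; exact: continuous_subspaceT.
have It : mu.-integrable `]0, T[ (EFin \o tent c h) by apply: Ic; exact: tent_continuous.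
have Iwt : mu.-integrable `]0, T[ (EFin \o (fun t => w t * tent c h t)).
  by apply: Ic => t; apply: cvgM; [exact: cw|exact: tent_continuous].
rewrite -Et -RintegralZl// -RintegralB//; last exact: integrable_EFinZ.
rewrite -RintegralZl//.
apply: normr_Rintegral_le => //.
- by apply: integrable_EFinB => //; exact: integrable_EFinZ.
- exact: integrable_EFinZ.
- move=> t _; rewrite -mulrBl normrM (ger0_norm (tent_ge0 _ _ (ltW h0))).
  have [tc|tc] := ltP `|t - c| h; last by rewrite tent_out ?mulr0 ?(ltW h0).
  by rewrite ler_wpM2r ?tent_ge0 ?(ltW h0)// weta.
Qed.

(** Two tents of equal mass centred at interior points [c] and [d] differ by
    the derivative of a test function, so [w] has the same average against
    both; as the tents shrink, the averages tend to [w c] and [w d]. *)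
Lemma du_bois_reymond (w : R -> R) : 0 < T -> continuous w ->
  (forall phi, test_fun 0 T phi ->
    \int[mu]_(t in `]0, T[) (w t * derive1 phi t) = 0) ->
  forall t, 0 <= t <= T -> w t = w 0.
Proof.
move=> T0 cw w0.
have Ic (f : R -> R) : continuous f -> mu.-integrable `]0, T[ (EFin \o f).
  by move=> cf; apply: continuous_integrable_oo; exact: continuous_subspaceT.
have inner c d : 0 < c < T -> 0 < d < T -> w c = w d.
  move=> /andP[c0 cT] /andP[d0 dT].
  apply/eqP; rewrite -subr_eq0 -normr_le0; apply/ler_addgt0Pr => e e0.
  rewrite add0r; have e20 : 0 < e / 2 by rewrite divr_gt0.
  have /cvgrPdist_le/(_ _ e20)/nbhs_ballP[h1 /= h10 H1] := cw c.
  have /cvgrPdist_le/(_ _ e20)/nbhs_ballP[h2 /= h20 H2] := cw d.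
  near (0 : R)^'+ => h.
  have h0 : 0 < h by near: h; exact: nbhs_right_gt.
  have hc : h < c by near: h; exact: nbhs_right_lt.
  have hd : h < d by near: h; exact: nbhs_right_lt.
  have hcT : c + h < T by rewrite -ltrBrDl; near: h; apply: nbhs_right_lt; rewrite subr_gt0.
  have hdT : d + h < T by rewrite -ltrBrDl; near: h; apply: nbhs_right_lt; rewrite subr_gt0.
  have hh1 : h < h1 by near: h; exact: nbhs_right_lt.
  have hh2 : h < h2 by near: h; exact: nbhs_right_lt.
  have A1 : `|\int[mu]_(t in `]0, T[) (w t * tent c h t) -
      w c * (2 * h ^+ 2)| <= e / 2 * (2 * h ^+ 2).
    apply: tent_average => // t ht; rewrite distrC; apply: H1.
    by rewrite /ball/= distrC (lt_trans ht).
  have A2 : `|\int[mu]_(t in `]0, T[) (w t * tent d h t) -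
      w d * (2 * h ^+ 2)| <= e / 2 * (2 * h ^+ 2).
    apply: tent_average => // t ht; rewrite distrC; apply: H2.
    by rewrite /ball/= distrC (lt_trans ht).
  have [tphi dphi] := test_fun_step h0 hc hd hcT hdT.
  have := w0 _ tphi; rewrite dphi.
  rewrite (_ : Rintegral _ _ _ = \int[mu]_(t in `]0, T[) (w t * tent c h t) -
     \int[mu]_(t in `]0, T[) (w t * tent d h t)); last first.
    rewrite -RintegralB//; last 2 first.
    - by apply: Ic => t; apply: cvgM; [exact: cw|exact: tent_continuous].
    - by apply: Ic => t; apply: cvgM; [exact: cw|exact: tent_continuous].
    by apply: eq_Rintegral => t _; rewrite mulrBr.
  move=> /subr0_eq E; rewrite E in A1.
  set B := Rintegral _ _ _ in A1 A2.
  have h20' : 0 < 2 * h ^+ 2 by rewrite mulr_gt0// exprn_gt0.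
  rewrite -(ler_pM2r h20') -{1}(gtr0_norm h20') -normrM mulrBl.
  have -> : w c * (2 * h ^+ 2) - w d * (2 * h ^+ 2) =
     (B - w d * (2 * h ^+ 2)) - (B - w c * (2 * h ^+ 2)) by ring.
  rewrite (le_trans (ler_normB _ _))// (_ : e * _ = e / 2 * (2 * h ^+ 2) + e / 2 * (2 * h ^+ 2)).
    by rewrite lerD.
  by rewrite -mulrDl -splitr.
have mid : 0 < T / 2 < T by apply/andP; split; lra.
suff H t : 0 <= t <= T -> w t = w (T / 2).
  by move=> t tT; rewrite H// -(H 0)// lexx ltW.
move=> tT; apply/eqP; rewrite -subr_eq0 -normr_le0; apply/ler_addgt0Pr => e e0.
rewrite add0r; have /cvgrPdist_le/(_ _ e0)/nbhs_ballP[d /= d0 H] := cw t.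
pose q := Num.min (1 / 2) (d / (2 * T)).
have q0 : 0 < q by rewrite lt_min !divr_gt0// mulr_gt0.
have q1 : q <= 1 / 2 by rewrite ge_min lexx.
have qd : q <= d / (2 * T) by rewrite ge_min lexx orbT.
have s0 : 0 < t + (T / 2 - t) * q < T.
  by case/andP : tT => t0 tT; apply/andP; split; nra.
rewrite -(inner _ _ s0 mid).
apply: H; rewrite /ball/= opprD addNKr normrN normrM (gtr0_norm q0).
have tl : `|T / 2 - t| <= T.
  by case/andP : tT => t0 tT; rewrite ler_norml; apply/andP; split; lra.
rewrite (@le_lt_trans _ _ (T * (d / (2 * T))))//.
  by rewrite ler_pM// ltW.
have -> : T * (d / (2 * T)) = d / 2 by field; rewrite gt_eqF.
by rewrite ltr_pdivrMr// ltr_pMr// ltr1n.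
Unshelve. all: by end_near. Qed.

End bump.

(** * The Sobolev space on an interval *)

Section sobolev.
Context {R : realType}.
Local Notation mu := (@lebesgue_measure R).
Variable T : R.
Hypothesis T0 : 0 < T.

Let mI : @measurable _ (measurableTypeR R) `]0, T[.
Proof. by []. Qed.

(** Integration by parts pairs the primitive of [v] with [phi'] as [v] is
    paired with [phi]. Hence primitives have weak derivatives, and conversely
    [y] minus the primitive of its weak derivative is orthogonal to all [phi'],
    so it is constant by [du_bois_reymond]. Through this lemma the state and
    adjoint equations become Volterra equations. *)
Lemma weak_derivP n (y v : R -> 'cV[R]_n) : {within `[0, T], continuous y} ->
  weak_deriv 0 T y v <-> (L2 0 T v /\ forall i t, 0 <= t <= T ->
    y t i ord0 = y 0 i ord0 + \int[mu]_(s in `]0, t[) v s i ord0).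
Proof.
move=> cy; have cyi i : continuous (fun t => y (clamp T t) i ord0).
  by apply: entry_continuous; apply: continuous_clamp_within => //; exact: ltW.
have T00 : 0 <= (0 : R) <= T by rewrite lexx ltW.
have Ic (f : R -> R) : continuous f -> mu.-integrable `]0, T[ (EFin \o f).
  by move=> cf; apply: continuous_integrable_oo; exact: continuous_subspaceT.
have byparts i phi : L2 0 T v -> test_fun 0 T phi ->
    \int[mu]_(t in `]0, T[) ((\int[mu]_(s in `]0, t[) v s i ord0) * derive1 phi t) =
    - \int[mu]_(s in `]0, T[) (v s i ord0 * phi s).
  move=> Lv tphi; have Iv := L2_integrable i Lv.
  have cphi' : continuous (derive1 phi) by case: tphi.
  rewrite primitive_by_parts// -mulN1r -RintegralZl//; last first.
    rewrite (_ : EFin \o _ = EFin \o (fun t => phi t * v t i ord0)); last first.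
      by apply/funext => t /=; rewrite mulrC.
    have cphi : continuous phi.
      by move=> t; apply/differentiable_continuous/derivable1_diffP; case: tphi.
    have [C C0 hC] := compact_norm_bounded (@segment_compact R 0 T) cphi.
    apply: (@integrable_EFinM _ _ _ _ _ _ _ _ C) => //.
      exact: continuous_measurable.
    by move=> t tT; apply: hC; exact: subset_itv_oo_cc tT.
  apply: eq_Rintegral => s; rewrite inE/= in_itv/= => /andP[_ sT].
  by rewrite (test_fun_integral tphi (ltW sT)) mulrN mulN1r.
split=> [[Lv wv]|[Lv yv]]; split => //; [move=> i t tT|move=> phi tphi i].
  have Iv := L2_integrable i Lv.
  pose w t := y (clamp T t) i ord0 - \int[mu]_(s in `]0, clamp T t[) v s i ord0.
  have cp := continuous_primitive_clamp T0 Iv.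
  have cw : continuous w.
    by move=> s; apply: cvgB; [exact: cyi|exact: cp].
  have := @du_bois_reymond R T w T0 cw _ t tT; rewrite /w !clamp_id//.
  rewrite (@set_itv_ge _ _ (BRight 0) (BLeft 0)) ?bnd_simp// Rintegral_set0 subr0.
  move=> <-; first by rewrite subrK.
  move=> phi tphi; have cphi' : continuous (derive1 phi) by case: tphi.
  rewrite -[RHS](subrr (\int[mu]_(t in `]0, T[) (y t i ord0 * derive1 phi t))).
  rewrite {2}(wv phi tphi i) -(byparts i phi Lv tphi).
  transitivity (\int[mu]_(t in `]0, T[) (y (clamp T t) i ord0 * derive1 phi t -
     (\int[mu]_(s in `]0, clamp T t[) v s i ord0) * derive1 phi t)).
    by apply: eq_Rintegral => s _; rewrite mulrBl.
  rewrite (RintegralB mI); last 2 first.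
  - by apply: Ic => s; apply: cvgM; [exact: cyi|exact: cphi'].
  - by apply: Ic => s; apply: cvgM; [exact: cp|exact: cphi'].
  apply: (congr2 (fun a b : R => a - b)); apply: eq_Rintegral => s;
    rewrite inE/= in_itv/=.
    by move=> /andP[/ltW s0 /ltW sT]; rewrite clamp_id ?s0.
  by move=> /andP[/ltW s0 /ltW sT]; rewrite clamp_id ?s0.
have Iv := L2_integrable i Lv.
have cphi' : continuous (derive1 phi) by case: tphi.
have cp := continuous_primitive_clamp T0 Iv.
rewrite -(byparts i phi Lv tphi).
transitivity (\int[mu]_(t in `]0, T[) (y 0 i ord0 * derive1 phi t +
   (\int[mu]_(s in `]0, clamp T t[) v s i ord0) * derive1 phi t)).
  apply: eq_Rintegral => s; rewrite inE/= in_itv/= => /andP[/ltW s0 /ltW sT].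
  by rewrite clamp_id ?s0// yv ?s0// mulrDl.
rewrite (RintegralD mI); last 2 first.
- by apply: integrable_EFinZ => //; exact: Ic.
- by apply: Ic => s; apply: cvgM; [exact: cp|exact: cphi'].
rewrite RintegralZl//; last exact: Ic.
rewrite (test_fun_integral tphi (ltW T0)).
have [-> // _] := test_fun_out tphi.
rewrite oppr0 mulr0 add0r; apply: eq_Rintegral => s; rewrite inE/= in_itv/=.
by move=> /andP[/ltW s0 /ltW sT]; rewrite clamp_id ?s0.
Qed.

(** Lebesgue's differentiation theorem for the primitive of [f - g]. *)
Lemma primitive_ae_unique (f g : R -> R) :
  mu.-integrable `]0, T[ (EFin \o f) -> mu.-integrable `]0, T[ (EFin \o g) ->
  (forall t, 0 <= t <= T ->
     \int[mu]_(s in `]0, t[) f s = \int[mu]_(s in `]0, t[) g s) ->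
  {ae mu, forall t, `]0, T[%classic t -> f t = g t}.
Proof.
move=> If Ig fg; pose h := (fun t => f t - g t) \_ `]0, T[.
have Ifg : mu.-integrable `]0, T[ (EFin \o (fun t => f t - g t)).
  exact: integrable_EFinB.
have Ih : mu.-integrable setT (EFin \o h).
  by rewrite /h -restrict_EFin; apply/integrable_restrict; rewrite ?setTI.
have lh : locally_integrable setT h by exact: integrable_locally_restrict.
have Ihy y : mu.-integrable [set` Interval (BRight (0 : R)) (BRight y)] (EFin \o h).
  by apply: integrableS Ih.
have := FTC1 Ihy lh.
have -> : (fun x => \int[mu]_(t in [set` Interval (BRight 0) (BRight x)]) h t) = cst 0.
  apply/funext => x /=; rewrite -Rintegral_itv_bndo_bndc; last first.
    by apply: integrableS Ih.
  rewrite /h -Rintegral_mkcondr.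
  have -> : [set` Interval (BRight 0) (BLeft x)] `&` `]0, T[ = `]0, clamp T x[%classic.
    apply/seteqP; split=> [s [/=]|s /=]; rewrite !in_itv/= /clamp.
      by move=> /andP[-> sx] /andP[_ sT]; rewrite lt_max lt_min sx sT orbT.
    move=> /andP[s0]; rewrite lt_max lt_min (ltNge s 0) (ltW s0)/=.
    by move=> /andP[-> ->]; rewrite s0.
  have /andP[c0 cT] := clamp_itv x (ltW T0).
  rewrite RintegralB//; last 2 first.
  - exact: integrable_sub_oo If.
  - exact: integrable_sub_oo Ig.
  by rewrite fg ?subrr// c0.
apply: (@filterS _ _ (ae_filter_ringOfSetsType mu)) => t /= H tT; have := tT; rewrite in_itv/= => /andP[t0 _].
have [|_] := H; first by [].
rewrite /h patchE mem_set// derive1E derive_cst => /esym/eqP.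
by rewrite subr_eq0 => /eqP.
Qed.

Lemma sqr_L2norm n (v : R -> 'cV[R]_n) :
  L2norm 0 T v ^+ 2 = \int[mu]_(t in `]0, T[) (enorm (v t) ^+ 2).
Proof.
by rewrite /L2norm sqr_sqrtr//; apply: Rintegral_ge0 => t _; exact: sqr_ge0.
Qed.

Lemma sqr_L2norm_sum n (v : R -> 'cV[R]_n) : L2 0 T v ->
  L2norm 0 T v ^+ 2 = \sum_i \int[mu]_(t in `]0, T[) (v t i ord0 ^+ 2).
Proof.
move=> Lv; rewrite sqr_L2norm -Rintegral_sum//; last first.
  by move=> i; have [_] := Lv i.
by apply: eq_Rintegral => t _; rewrite sqr_enorm_cV.
Qed.

Lemma weak_deriv_L2norm n (y v w : R -> 'cV[R]_n) :
  {within `[0, T], continuous y} -> weak_deriv 0 T y v -> weak_deriv 0 T y w ->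
  L2norm 0 T v ^+ 2 = L2norm 0 T w ^+ 2.
Proof.
move=> cy /(weak_derivP _ cy)[Lv yv] /(weak_derivP _ cy)[Lw yw].
rewrite !sqr_L2norm_sum//; apply: eq_bigr => i _; congr fine.
apply: ae_eq_integral => //.
- by apply/measurable_EFinP; apply: measurable_funX; have [] := Lv i.
- by apply/measurable_EFinP; apply: measurable_funX; have [] := Lw i.
have := @primitive_ae_unique (fun t => v t i ord0) (fun t => w t i ord0)
  (L2_integrable i Lv) (L2_integrable i Lw).
have H : forall t, 0 <= t <= T -> \int[mu]_(s in `]0, t[) v s i ord0 =
    \int[mu]_(s in `]0, t[) w s i ord0.
  move=> t tT; have := yv i t tT; rewrite (yw i t tT) => /addrI.
  by move=> ->.
move=> /(_ H); apply: (@filterS _ _ (ae_filter_ringOfSetsType mu)) => t H' tT.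
by rewrite H'.
Qed.

(** [wderiv] chooses a weak derivative; the choice is only unique almost
    everywhere, which the L^2 norm does not see. *)
Lemma sqr_H1norm n (y v : R -> 'cV[R]_n) : {within `[0, T], continuous y} ->
  weak_deriv 0 T y v ->
  H1norm 0 T y ^+ 2 = L2norm 0 T v ^+ 2 + L2norm 0 T y ^+ 2.
Proof.
move=> cy yv; rewrite /H1norm sqr_sqrtr; last by rewrite addr_ge0 ?sqr_ge0.
apply: (congr2 +%R _ erefl); apply: (weak_deriv_L2norm cy _ yv).
exact: (@xgetPex _ (fun=> 0) (weak_deriv 0 T y) (ex_intro _ v yv)).
Qed.

Lemma H1norm_ge0 n (y : R -> 'cV[R]_n) : 0 <= H1norm 0 T y.
Proof. exact: sqrtr_ge0. Qed.

Lemma eq_L2norm n (v w : R -> 'cV[R]_n) :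
  (forall t, 0 < t < T -> v t = w t) -> L2norm 0 T v = L2norm 0 T w.
Proof.
move=> vw; congr Num.sqrt; apply: eq_Rintegral => t.
by rewrite inE/= in_itv/= => tT; rewrite vw.
Qed.

Lemma weak_deriv_H1 n (y v : R -> 'cV[R]_n) : {within `[0, T], continuous y} ->
  weak_deriv 0 T y v -> H1 0 T y.
Proof. by move=> cy yv; split => //; [exact: continuous_L2|exists v]. Qed.

Lemma weak_derivB n (y z v w : R -> 'cV[R]_n) :
  {within `[0, T], continuous y} -> {within `[0, T], continuous z} ->
  weak_deriv 0 T y v -> weak_deriv 0 T z w ->
  weak_deriv 0 T (fun t => y t - z t) (fun t => v t - w t).
Proof.
move=> cy cz /(weak_derivP _ cy)[Lv yv] /(weak_derivP _ cz)[Lw zw].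
apply/weak_derivP; first by move=> t; apply: cvgB; [exact: cy|exact: cz].
split; first exact: L2B.
move=> i t /andP[t0 tT]; rewrite !mxE yv ?t0// zw ?t0//.
rewrite [X in _ = _ + X](_ : _ = \int[mu]_(s in `]0, t[) (v s i ord0 - w s i ord0)).
  rewrite RintegralB//; first by ring.
  - by apply: integrable_sub_oo tT _ => //; exact: L2_integrable.
  - by apply: integrable_sub_oo tT _ => //; exact: L2_integrable.
by apply: eq_Rintegral => s _; rewrite !mxE.
Qed.

Lemma weak_derivZ n (a : R) (y v : R -> 'cV[R]_n) :
  {within `[0, T], continuous y} -> weak_deriv 0 T y v ->
  weak_deriv 0 T (fun t => a *: y t) (fun t => a *: v t).
Proof.
move=> cy /(weak_derivP _ cy)[Lv yv].
apply/weak_derivP; first by move=> t; apply: cvgZr; exact: cy.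
split; first exact: L2Z.
move=> i t /andP[t0 tT]; rewrite !mxE yv ?t0// mulrDr.
rewrite [X in _ = _ + X](_ : _ = \int[mu]_(s in `]0, t[) (a * v s i ord0)).
  rewrite RintegralZl//.
  by apply: integrable_sub_oo tT _ => //; exact: L2_integrable.
by apply: eq_Rintegral => s _; rewrite !mxE.
Qed.

Lemma sqr_L2normZ n a (v : R -> 'cV[R]_n) : L2 0 T v ->
  L2norm 0 T (fun t => a *: v t) ^+ 2 = a ^+ 2 * L2norm 0 T v ^+ 2.
Proof.
move=> Lv; rewrite !sqr_L2norm -RintegralZl//; last exact: L2_integrable_enorm.
by apply: eq_Rintegral => t _; rewrite enormZ exprMn real_normK ?num_real.
Qed.

Lemma H1normZ n a (y : R -> 'cV[R]_n) : H1 0 T y ->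
  H1norm 0 T (fun t => a *: y t) = `|a| * H1norm 0 T y.
Proof.
move=> [cy Ly [v yv]]; have [Lv _] := yv.
have cay : {within `[0, T], continuous (fun t => a *: y t)}.
  by move=> t; apply: cvgZr; exact: cy.
have scale (h1 h2 v1 v2 y1 y2 : R) : 0 <= h1 -> 0 <= h2 ->
    h1 ^+ 2 = v1 + y1 -> h2 ^+ 2 = v2 + y2 -> v1 = a ^+ 2 * v2 ->
    y1 = a ^+ 2 * y2 -> h1 = `|a| * h2.
  move=> h10 h20 E1 E2 E3 E4; apply/eqP; rewrite -(@eqrXn2 _ 2)// ?mulr_ge0//.
  by rewrite exprMn real_normK ?num_real// E1 E2 E3 E4 mulrDr.
exact: (scale _ _ _ _ _ _ (H1norm_ge0 _) (H1norm_ge0 _)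
  (sqr_H1norm cay (weak_derivZ a cy yv)) (sqr_H1norm cy yv)
  (sqr_L2normZ a Lv) (sqr_L2normZ a Ly)).
Qed.

Lemma sqr_L2normB_le n (v w : R -> 'cV[R]_n) : L2 0 T v -> L2 0 T w ->
  L2norm 0 T v ^+ 2 <= 2 * L2norm 0 T w ^+ 2 +
                       2 * L2norm 0 T (fun t => v t - w t) ^+ 2.
Proof.
move=> Lv Lw; rewrite !sqr_L2norm_sum//; last exact: L2B.
rewrite !mulr_sumr -big_split/=; apply: ler_sum => i _.
have Lvw := L2B Lv Lw; have [_ Iv] := Lv i; have [_ Iw] := Lw i.
have [_ Ivw] := Lvw i.
rewrite -!RintegralZl// -RintegralD//; [|exact: integrable_EFinZ..].
apply: le_Rintegral => //.
  by apply: integrable_EFinD => //; exact: integrable_EFinZ.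
move=> t _; rewrite !mxE; move: (v t i ord0) (w t i ord0) => a b.
by have := sqr_ge0 (a - 2 * b); nra.
Qed.

(** A substitute for the triangle inequality, obtained from
    [a ^+ 2 <= 2 * b ^+ 2 + 2 * (a - b) ^+ 2] in both L^2 terms. *)
Lemma sqr_H1normB_le n (y z : R -> 'cV[R]_n) : H1 0 T y -> H1 0 T z ->
  H1norm 0 T y ^+ 2 <= 2 * H1norm 0 T z ^+ 2 +
                       2 * H1norm 0 T (fun t => y t - z t) ^+ 2.
Proof.
move=> [cy Ly [v yv]] [cz Lz [w zw]].
have [Lv _] := yv; have [Lw _] := zw.
have cyz : {within `[0, T], continuous (fun t => y t - z t)}.
  by move=> t; apply: cvgB; [exact: cy|exact: cz].
have add (h1 h2 h3 a1 a2 a3 b1 b2 b3 : R) : h1 = a1 + b1 -> h2 = a2 + b2 ->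
    h3 = a3 + b3 -> a1 <= 2 * a2 + 2 * a3 -> b1 <= 2 * b2 + 2 * b3 ->
    h1 <= 2 * h2 + 2 * h3.
  by move=> -> -> -> *; rewrite !mulrDr addrACA lerD.
exact: (add _ _ _ _ _ _ _ _ _ (sqr_H1norm cy yv) (sqr_H1norm cz zw)
  (sqr_H1norm cyz (weak_derivB cy cz yv zw))
  (sqr_L2normB_le Lv Lw) (sqr_L2normB_le Ly Lz)).
Qed.

Lemma L2norm_le_sup n (v : R -> 'cV[R]_n) C : L2 0 T v -> 0 <= C ->
  (forall t, 0 < t < T -> `|v t| <= C) ->
  L2norm 0 T v ^+ 2 <= n%:R * C ^+ 2 * T.
Proof.
move=> Lv C0 vC; rewrite sqr_L2norm.
have -> : n%:R * C ^+ 2 * T = \int[mu]_(t in `]0, T[) (n%:R * C ^+ 2).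
  by rewrite Rintegral_cst//= lebesgue_measure_itv/= lte_fin T0/= subr0.
apply: le_Rintegral => //.
- exact: L2_integrable_enorm.
- by apply: continuous_integrable_oo => t; exact: cvg_cst.
- move=> t; rewrite /= in_itv/= => tT.
  rewrite (le_trans (sqr_enorm_le_norm _))// ler_wpM2l// lerXn2r// ?nnegrE//.
  exact: vC.
Qed.

Let sobolev_const : R := (T + 1) / T + (T + 1).

(** [y t] differs from each [y s] by at most the integral of |y'|; averaging
    over [s] bounds it by the H^1 norm. Consequently the suprema defining
    [Cnorm] and [embedding_norm] are suprema of bounded sets. *)
Lemma H1_sup_bound n (y : R -> 'cV[R]_n) : H1 0 T y -> H1norm 0 T y <= 1 ->
  forall t, 0 <= t <= T -> enorm (y t) <= n%:R * sobolev_const.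
Proof.
move=> [cy Ly [v yv]] y1 t /andP[t0 tT].
have : H1norm 0 T y ^+ 2 <= 1 by rewrite expr_le1 ?H1norm_ge0.
rewrite (sqr_H1norm cy yv) => H.
have [Lv pv] := (weak_derivP _ cy).1 yv.
have small (w : R -> 'cV[R]_n) i : L2 0 T w -> L2norm 0 T w ^+ 2 <= 1 ->
    \int[mu]_(s in `]0, T[) `|w s i ord0| <= T + 1.
  move=> Lw w1; rewrite addrC.
  have Icst : mu.-integrable `]0, T[ (EFin \o (fun=> 1)).
    by apply: continuous_integrable_oo => s; exact: cvg_cst.
  apply: (@le_trans _ _ (\int[mu]_(s in `]0, T[) (enorm (w s) ^+ 2 + 1))).
    apply: le_Rintegral => //.
    - by apply: integrable_EFin_norm; exact: L2_integrable.
    - by apply: integrable_EFinD => //; exact: L2_integrable_enorm.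
    - move=> s _; have := entry_le_enorm (w s) i ord0.
      have := normr_ge0 (w s i ord0); have := enorm_ge0 (w s).
      by move: (enorm _) `|_| => a b; nra.
  rewrite RintegralD//; last exact: L2_integrable_enorm.
  rewrite -sqr_L2norm Rintegral_cst//= lebesgue_measure_itv/= lte_fin T0/=.
  by rewrite subr0 mul1r lerD2r.
have v1 : L2norm 0 T v ^+ 2 <= 1 by have := sqr_ge0 (L2norm 0 T y); lra.
have y1' : L2norm 0 T y ^+ 2 <= 1 by have := sqr_ge0 (L2norm 0 T v); lra.
have T1 : 0 <= T + 1 by rewrite addr_ge0// ltW.
have K0 : 0 <= sobolev_const by rewrite /sobolev_const addr_ge0// divr_ge0// ltW.
rewrite (le_trans (enorm_le_norm _))// ler_wpM2l//.
apply: norm_le_entry => // i j; rewrite ord1 {j}.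
have Iv := integrable_EFin_norm (L2_integrable i Lv).
have diff s : 0 < s < T -> `|y t i ord0| <= `|y s i ord0| + (T + 1).
  move=> /andP[/ltW s0 /ltW sT].
  rewrite -{1}(subrK (y s i ord0) (y t i ord0)) addrC.
  rewrite (le_trans (ler_normD _ _))// lerD2l.
  rewrite (le_trans _ (small v i Lv v1))//.
  rewrite (pv i t) ?t0// (pv i s) ?s0//.
  rewrite opprD addrACA subrr add0r.
  wlog st : s t {tT} t0 tT s0 sT / s <= t => [hw|].
    have [st|/ltW ts] := leP s t; first exact: hw.
    by rewrite distrC hw.
  rewrite (@Rintegral_oo_split _ t s); last 2 first.
  - by rewrite s0.
  - by apply: integrable_sub_oo (L2_integrable i Lv).
  rewrite addrC addKr (le_trans (le_normr_Rintegral _ _))//.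
    by apply: integrable_sub_oo (L2_integrable i Lv).
  apply: Rintegral_le_subset => //.
  by apply: subset_itv; rewrite bnd_simp.
have : \int[mu]_(s in `]0, T[) `|y t i ord0| <=
    \int[mu]_(s in `]0, T[) (`|y s i ord0| + (T + 1)).
  apply: le_Rintegral => //.
  - by apply: continuous_integrable_oo => s; exact: cvg_cst.
  - apply: integrable_EFinD => //.
      by apply: integrable_EFin_norm; exact: L2_integrable.
    by apply: continuous_integrable_oo => s; exact: cvg_cst.
rewrite RintegralD//; last 2 first.
- by apply: integrable_EFin_norm; exact: L2_integrable.
- by apply: continuous_integrable_oo => s; exact: cvg_cst.
rewrite !Rintegral_cst//= lebesgue_measure_itv/= lte_fin T0/= subr0 => H'.
rewrite /sobolev_const -(ler_pM2r T0) (le_trans H')// [leRHS]mulrDl divfK ?gt_eqF//.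
by rewrite lerD2r small.
Qed.

Lemma H1_sup_le n (y : R -> 'cV[R]_n) r : H1 0 T y -> 0 < r ->
  H1norm 0 T y <= r ->
  forall t, 0 <= t <= T -> enorm (y t) <= r * embedding_norm 0 T n.
Proof.
move=> hy r0 yr t tT; pose z s := r^-1 *: y s.
have hz : H1 0 T z.
  case: hy => cy Ly [v yv]; apply: (@weak_deriv_H1 _ _ (fun s => r^-1 *: v s)).
    by move=> s; apply: cvgZr; exact: cy.
  exact: weak_derivZ.
have z1 : H1norm 0 T z <= 1.
  rewrite /z H1normZ// gtr0_norm ?invr_gt0// mulrC ler_pdivrMr// mul1r.
  exact: yr.
have bnd (x : R -> 'cV[R]_n) : H1 0 T x -> H1norm 0 T x <= 1 ->
    ubound [set enorm (x s) | s in `[0, T]] (n%:R * sobolev_const).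
  move=> hx x1 _ [s + <-]; rewrite /= in_itv/= => sT.
  exact: H1_sup_bound.
have zC : enorm (z t) <= Cnorm 0 T z.
  apply: ub_le_sup; first by exists (n%:R * sobolev_const); exact: bnd.
  by exists t => //; rewrite /= in_itv.
have CE : Cnorm 0 T z <= embedding_norm 0 T n.
  apply: ub_le_sup; last by exists z.
  exists (n%:R * sobolev_const) => _ [x [hx x1] <-].
  apply: sup_le_ub; last exact: bnd.
  by exists (enorm (x 0)), 0 => //; rewrite /= in_itv/= lexx ltW.
have -> : y t = r *: z t by rewrite /z scalerA divff ?scale1r// gt_eqF.
by rewrite enormZ gtr0_norm// ler_wpM2l ?(ltW r0)// (le_trans zC).
Qed.

Lemma embedding_norm_ge0 n : 0 <= embedding_norm 0 T n.
Proof.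
have c0 : {within `[0, T], continuous (fun=> 0 : 'cV[R]_n)}.
  by move=> t; exact: cvg_cst.
have w0 : weak_deriv 0 T (fun=> 0 : 'cV[R]_n) (fun=> 0).
  apply/(weak_derivP _ c0); split; first exact: continuous_L2.
  move=> i t _; rewrite mxE add0r -[LHS](mul0r (fine (mu `]0, t[%classic))).
  by rewrite -Rintegral_cst.
have z2 : L2norm 0 T (fun=> 0 : 'cV[R]_n) ^+ 2 <= 0.
  have := @L2norm_le_sup n (fun=> 0) 0 (continuous_L2 c0) (lexx 0).
  by rewrite expr0n/= mulr0 mul0r; apply => t _; rewrite normr0.
have h1 : H1norm 0 T (fun=> 0 : 'cV[R]_n) <= 1.
  have le1 (h a : R) : 0 <= h -> h ^+ 2 = a + a -> a <= 0 -> h <= 1.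
    by move=> h0 ha a0; nra.
  exact: (le1 _ _ (H1norm_ge0 _) (sqr_H1norm c0 w0) z2).
have t0 : 0 <= (0 : R) <= T by rewrite lexx ltW.
have := @H1_sup_le n (fun=> 0) 1 (weak_deriv_H1 c0 w0) ltr01 h1 0 t0.
by rewrite enorm0 mul1r.
Qed.

Lemma eq_weak_deriv n (y z v w : R -> 'cV[R]_n) :
  (forall t, 0 < t < T -> y t = z t) -> (forall t, 0 < t < T -> v t = w t) ->
  weak_deriv 0 T y v -> weak_deriv 0 T z w.
Proof.
move=> yz vw [Lv yv]; split; first exact: eq_L2 vw Lv.
move=> phi tphi i; transitivity (\int[mu]_(t in `]0, T[) (y t i ord0 * derive1 phi t)).
  by apply: eq_Rintegral => t; rewrite inE/= in_itv/= => tT; rewrite yz.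
rewrite (yv phi tphi i); congr (- _).
by apply: eq_Rintegral => t; rewrite inE/= in_itv/= => tT; rewrite vw.
Qed.

Lemma eq_H1norm n (y z : R -> 'cV[R]_n) :
  (forall t, 0 < t < T -> y t = z t) -> H1norm 0 T y = H1norm 0 T z.
Proof.
move=> yz; have E : weak_deriv 0 T y = weak_deriv 0 T z.
  apply/funext => v; apply/propext; split; apply: eq_weak_deriv => // t tT.
  by rewrite yz.
by rewrite /H1norm /wderiv E (eq_L2norm yz).
Qed.

End sobolev.

(** * Smooth functions of parameter and state *)

Section linear_maps.
Context {R : realType} {V W : normedModType R}.
Variable L : V -> W.
Hypothesis linL : linear L.

Lemma linear_fun0 : L 0 = 0.
Proof.
have := linL 1 0 0; rewrite !scale1r addr0 => H.
by apply: (@addrI _ (L 0)); rewrite addr0 -H.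
Qed.

Lemma linear_funZ a u : L (a *: u) = a *: L u.
Proof. by have := linL a u 0; rewrite linear_fun0 !addr0. Qed.

Lemma linear_funD u v : L (u + v) = L u + L v.
Proof. by have := linL 1 u v; rewrite !scale1r. Qed.

Lemma linear_funB u v : L (u - v) = L u - L v.
Proof. by rewrite -[- v]scaleN1r linear_funD linear_funZ scaleN1r. Qed.

Lemma linear_fun_sum I (r : seq I) (F : I -> V) :
  L (\sum_(i <- r) F i) = \sum_(i <- r) L (F i).
Proof.
elim: r => [|i r IH]; first by rewrite !big_nil linear_fun0.
by rewrite !big_cons linear_funD IH.
Qed.

End linear_maps.

Section frechet_basics.
Context {R : realType} {V W : normedModType R}.
Implicit Types (D : set V) (h : V -> W).

Lemma is_fderiv_on_continuous D h x L : is_fderiv_on D h x L -> D x ->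
  h y @[y --> within D (nbhs x)] --> h x.
Proof.
move=> [linL cL dL] Dx; apply/cvgrPdist_le => e e0.
have e20 : 0 < e / 2 by rewrite divr_gt0.
have [d d0 Hd] := dL 1 ltr01.
have /cvgrPdist_le/(_ _ e20) := cL 0.
rewrite (linear_fun0 linL) => /nbhs_ballP[d' /= d'0 HL].
apply/nbhs_ballP; exists (Num.min (e / 2) (Num.min d d')).
  by rewrite /= !lt_min e20 d0 d'0.
move=> y /=; rewrite -ball_normE /ball_/= distrC !lt_min => /and3P[y1 y2 y3] Dy.
have := Hd y Dy y2; rewrite mul1r => H.
rewrite distrC -(subrK (L (y - x)) (h y - h x)).
rewrite (le_trans (ler_normD _ _))// [e]splitr lerD//.
  by rewrite (le_trans H)// ltW.
have := HL (y - x); rewrite -ball_normE /ball_/= !sub0r !normrN; exact.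
Qed.

Lemma Ck_on_continuous k D h : Ck_on k D h -> {within D, continuous h}.
Proof.
case: k => [//|k] [H _]; apply/subspace_continuousP => x Dx.
by have [L HL] := H x Dx; exact: is_fderiv_on_continuous HL Dx.
Qed.

Lemma Ck_on_fderiv k D h x : Ck_on k.+1 D h -> D x ->
  is_fderiv_on D h x (fderiv_on D h x).
Proof. by move=> [H _] Dx; apply: xgetPex; exact: H. Qed.

Lemma continuous_within_comp (X : topologicalType) D h (k : X -> V) :
  {within D, continuous h} -> continuous k -> (forall x, D (k x)) ->
  continuous (fun x => h (k x)).
Proof.
move=> /subspace_continuousP ch ck Dk x.
apply: (@cvg_comp _ _ _ k h _ (within D (nbhs (k x))) _ _ (ch _ (Dk x))).
move=> A nA; have {}nA : \forall s \near k x, D s -> A s by [].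
suff : \forall y \near x, A (k y) by [].
near=> s; have : D (k s) -> A (k s) by near: s; exact: (ck x _ nA).
by apply; exact: Dk.
Unshelve. all: by end_near. Qed.

End frechet_basics.

(** Smoothness in the state only: the parameter, later a pair of a network
    parameter and a time, ranges over a mere topological space. *)
Definition C1_state (R : realType) (X : topologicalType) n
    (h : X -> 'cV[R]_n -> R) (g : X * 'cV[R]_n -> 'cV[R]_n) : Prop :=
  [/\ continuous (fun p : X * 'cV[R]_n => h p.1 p.2), continuous g &
      forall x y v, is_derive y v (h x) (\sum_j v j ord0 * g (x, y) j ord0)].

Definition loc_lipschitz (R : realType) (X : topologicalType) n p q (K : set X)
    (F : X -> 'cV[R]_n -> 'M[R]_(p, q)) : Prop :=
  forall r, exists2 L, 0 <= L & forall x y z, K x -> `|y| <= r -> `|z| <= r ->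
    `|F x y - F x z| <= L * `|y - z|.

Section slices.
Context {R : realType} {X' W : normedModType R} {n : nat}.
Variables (ell : W -> R) (D1 : set X') (H : X' * 'cV[R]_n -> W).
Hypotheses (linell : linear ell) (ell1 : forall w, `|ell w| <= `|w|).
Let D := D1 `*` (setT : set 'cV[R]_n).

Lemma cV_basis (v : 'cV[R]_n) : v = \sum_j v j ord0 *: unit_vec j.
Proof.
rewrite [LHS]matrix_sum_delta; apply: eq_bigr => i _.
by rewrite big_ord1.
Qed.

Let cell : continuous ell.
Proof.
move=> w; apply/cvgrPdist_le => e e0.
apply/nbhs_ballP; exists e => //= w'; rewrite -ball_normE /ball_/= => ww'.
by rewrite -(linear_funB linell) (le_trans (ell1 _))// ltW.
Qed.

(** The functional [ell] is an entry of a matrix when [H] is one of the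
    coefficients of the dynamics, and the identity when [H] is a value
    function. *)
Lemma is_fderiv_on_slice (a : X') (B : set 'cV[R]_n) (h : 'cV[R]_n -> R) y L :
  (forall z, B z -> D1 a) -> (forall z, h z = ell (H (a, z))) ->
  is_fderiv_on (D1 `*` B) H (a, y) L ->
  is_fderiv_on B h y (fun v => ell (L (0, v))).
Proof.
move=> aB hE [linL cL dL].
split.
- move=> c u v; rewrite -[(0, c *: u + v)]/(((0 : X'), c *: u + v)).
  have -> : ((0 : X'), c *: u + v) = c *: (0, u) + (0, v).
    by apply: injective_projections; rewrite //= scaler0 addr0.
  by rewrite linL linell.
- apply: (@continuous_compose _ _ _ (fun v => L (0, v))) => //.
  exact: (@continuous_section _ _ _ L).
- move=> e e0; have [d d0 Hd] := dL e e0; exists d => // z Bz zy.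
  have Enorm : `|(a, z) - (a, y)| = `|z - y|.
    rewrite [LHS]prod_normE/= subrr normr0; exact/max_idPr.
  have := Hd (a, z); rewrite Enorm => /(_ (conj (aB _ Bz) Bz) zy); apply: le_trans.
  rewrite !hE -!(linear_funB linell) (le_trans (ell1 _))//.
  by rewrite -[in X in _ <= `|_ - L X|](_ : (0, z - y) = (a, z) - (a, y))//;
    apply: injective_projections; rewrite //= subrr.
Qed.

Lemma is_derive_fderiv (h : 'cV[R]_n -> R) y v L :
  is_fderiv_on setT h y L -> is_derive y v h (L v).
Proof.
move=> [linL cL dL].
have Hc : (fun s => s^-1 *: ((h \o shift y) (s *: v) - h y)) @ 0^' --> L v.
  apply/cvgrPdist_le => e e0.
  have v1 : 0 < `|v| + 1 by rewrite ltr_wpDl.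
  have e10 : 0 < e / (`|v| + 1) by rewrite divr_gt0.
  have [d d0 Hd] := dL _ e10.
  near=> s.
  have s0 : s != 0 by near: s; exact: nbhs_dnbhs_neq.
  have sd : `|s| <= d / (`|v| + 1) / 2.
    by near: s; apply: dnbhs0_le; rewrite !divr_gt0.
  have svd : `|s *: v| < d.
    rewrite normrZ (@le_lt_trans _ _ (d / (`|v| + 1) / 2 * (`|v| + 1)))//.
      by rewrite ler_pM// lerDl.
    rewrite mulrAC divfK ?gt_eqF// ltr_pdivrMr// ltr_pMr// ltr1n.
    by [].
  have := Hd (s *: v + y) I; rewrite addrK => /(_ svd).
  rewrite (linear_funZ linL) => B.
  rewrite distrC /GRing.scale/=.
  have -> : s^-1 * (h (s *: v + y) - h y) - L v =
      s^-1 * (h (s *: v + y) - h y - s * L v) by field.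
  rewrite normrM normfV mulrC ler_pdivrMr ?normr_gt0//.
  rewrite (le_trans B)// normrZ mulrCA mulrC ler_wpM2r//.
  by rewrite mulrAC ler_pdivrMr// ler_pM2l// lerDl.
apply: DeriveDef; first by apply/cvg_ex; exists (L v).
by apply/cvg_lim.
Unshelve. all: by end_near. Qed.

Variables (X : topologicalType) (kappa : X -> X').
Hypotheses (ckappa : continuous kappa) (Dkappa : forall x, D1 (kappa x)).

Definition slice_grad (p : X * 'cV[R]_n) : 'cV[R]_n :=
  \col_j ell (fderiv_on D H (kappa p.1, p.2) (0, unit_vec j)).

(** The map [kappa] sends the parameter into the domain of [H]; for the dynamics,
    defined for times in [0, T] only, it clamps the time. *)
Lemma Ck_on_C1_state k : Ck_on k.+1 D H ->
  C1_state (fun x y => ell (H (kappa x, y))) slice_grad.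
Proof.
move=> CH; have ck2 : continuous (fun p : X * 'cV[R]_n => (kappa p.1, p.2)).
  apply: continuous_pair; last exact: continuous_snd.
  by apply: continuous_compose => //; exact: continuous_fst.
have Dk (p : X * 'cV[R]_n) : D (kappa p.1, p.2) by split => //=.
split.
- apply: (@continuous_compose _ _ _ (fun p : X * 'cV[R]_n => H (kappa p.1, p.2))) => //.
  exact: continuous_within_comp (Ck_on_continuous CH) ck2 Dk.
- apply: mx_continuous => j j'.
  rewrite (_ : (fun x => _) = fun p : X * 'cV[R]_n =>
    ell (fderiv_on D H (kappa p.1, p.2) (0, unit_vec j))); last first.
    by apply/funext => p; rewrite mxE.
  apply: (@continuous_compose _ _ _ (fun p : X * 'cV[R]_n =>
    fderiv_on D H (kappa p.1, p.2) (0, unit_vec j))) => //.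
  have [_ /(_ (0, unit_vec j))/Ck_on_continuous CH'] := CH.
  exact: continuous_within_comp CH' ck2 Dk.
- move=> x y v.
  have Dx : D (kappa x, y) by split => //=.
  have dH := Ck_on_fderiv CH Dx.
  have dh : is_fderiv_on setT (fun y => ell (H (kappa x, y))) y
      (fun v => ell (fderiv_on D H (kappa x, y) (0, v))).
    exact: (@is_fderiv_on_slice (kappa x) setT (fun y => ell (H (kappa x, y))) y _
      (fun _ _ => Dkappa x) (fun=> erefl) dH).
  have -> : \sum_j v j ord0 * slice_grad (x, y) j ord0 =
      ell (fderiv_on D H (kappa x, y) (0, v)).
    have [lin _ _] := dh.
    rewrite [in RHS](cV_basis v) (linear_fun_sum lin).
    by apply: eq_bigr => j _; rewrite (linear_funZ lin) mxE.
  exact: is_derive_fderiv dh.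
Qed.

End slices.

Section local_lipschitz.
Context {R : realType} {X : topologicalType} {n : nat}.
Variable K : set X.
Hypothesis cK : compact K.

Lemma C1_state_grad (h : X -> 'cV[R]_n -> R) g x y : C1_state h g ->
  grad (h x) y = g (x, y).
Proof.
move=> [_ _ H]; apply/colP => i; rewrite mxE.
have D := H x y (unit_vec i); rewrite derive_val.
rewrite (bigD1 i)//= big1 ?addr0 => [|j ji]; rewrite mxE ?eqxx ?mul1r//.
by rewrite (negbTE ji) mul0r.
Qed.

Lemma compact_param_bounded (W : normedModType R) (F : X * 'cV[R]_n -> W) r :
  continuous F ->
  exists2 C, 0 <= C & forall x y, K x -> `|y| <= r -> `|F (x, y)| <= C.
Proof.
move=> cF; have [C C0 HC] := compact_norm_bounded (compact_setX cK (@compact_cV_ball R n r)) cF.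
by exists C => // x y Kx yr; apply: HC.
Qed.

(** The mean value theorem on segments. *)
Lemma C1_state_lipschitz (h : X -> 'cV[R]_n -> R) g : C1_state h g ->
  forall r, exists2 L, 0 <= L & forall x y z, K x -> `|y| <= r -> `|z| <= r ->
    `|h x y - h x z| <= L * `|y - z|.
Proof.
move=> [ch cg dh] r; have [C C0 gC] := @compact_param_bounded _ g r cg.
exists (n%:R * C) => [|x y z Kx yr zr]; first by rewrite mulr_ge0.
pose seg (s : R) := z + s *: (y - z); pose phi s := h x (seg s).
pose dphi s := \sum_j (y - z) j ord0 * g (x, seg s) j ord0.
have dphiE (s : R) : is_derive s 1 phi (dphi s).
  have D := dh x (seg s) (y - z).
  have E : (fun t => t^-1 *: ((phi \o shift s) (t *: 1) - phi s)) =
      (fun t => t^-1 *: ((h x \o shift (seg s)) (t *: (y - z)) - h x (seg s))).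
    apply/funext => t; congr (_ *: (_ - _)); rewrite /phi/= /seg; congr (h x _).
    rewrite (_ : t *: 1 = t); last exact: mulr1.
    by rewrite scalerDl addrCA.
  apply: DeriveDef; first by rewrite /derivable E; exact: ex_derive.
  by rewrite /derive E; exact: derive_val.
have cphi : {within `[0, 1], continuous phi}.
  apply: continuous_subspaceT => s.
  by apply/differentiable_continuous/derivable1_diffP; exact: ex_derive.
have [s + ] := MVT ltr01 (fun s _ => dphiE s) cphi.
rewrite in_itv/= => /andP[s0 s1].
rewrite /phi /seg scale1r scale0r addr0 subr0 mulr1 (addrC z) subrK => ->.
have segr : `|seg s| <= r.
  have -> : seg s = s *: y + (1 - s) *: z.
    by rewrite /seg scalerBr scalerBl scale1r addrCA.
  rewrite (le_trans (ler_normD _ _))// !normrZ (gtr0_norm s0).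
  have s1' : 0 <= 1 - s by rewrite subr_ge0 ltW.
  rewrite (ger0_norm s1') (@le_trans _ _ (s * r + (1 - s) * r))//.
    by rewrite lerD// ler_wpM2l// ltW.
  by rewrite -mulrDl addrC subrK mul1r.
rewrite /dphi (le_trans (ler_norm_sum _ _ _))//.
rewrite (@le_trans _ _ (\sum_(j < n) `|y - z| * C))//.
  apply: ler_sum => j _; rewrite normrM ler_pM// ?entry_le_norm//.
  by rewrite (le_trans (entry_le_norm _ j ord0))// gC.
by rewrite sumr_const card_ord -[leLHS]mulr_natl [leRHS]mulrAC mulrA.
Qed.

Lemma loc_lipschitz_entries p q (F : X -> 'cV[R]_n -> 'M[R]_(p, q)) :
  (forall i j r, exists2 L, 0 <= L & forall x y z, K x -> `|y| <= r ->
     `|z| <= r -> `|F x y i j - F x z i j| <= L * `|y - z|) ->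
  loc_lipschitz K F.
Proof.
move=> H r.
have H' (ij : 'I_p * 'I_q) : {L | 0 <= L /\ forall x y z, K x -> `|y| <= r ->
    `|z| <= r -> `|F x y ij.1 ij.2 - F x z ij.1 ij.2| <= L * `|y - z|}.
  by apply: cid; have [L L0 HL] := H ij.1 ij.2 r; exists L.
exists (\sum_ij sval (H' ij)).
  by apply: sumr_ge0 => ij _; case: (svalP (H' ij)).
move=> x y z Kx yr zr; apply: norm_le_entry => [|i j].
  by rewrite mulr_ge0// sumr_ge0// => ij _; case: (svalP (H' ij)).
rewrite !mxE; have [L0 HL] := svalP (H' (i, j)).
rewrite (le_trans (HL x y z Kx yr zr))// ler_wpM2r// (bigD1 (i, j))//= lerDl.
by apply: sumr_ge0 => ij _; case: (svalP (H' ij)).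
Qed.

Lemma loc_lipschitzD p q (F G : X -> 'cV[R]_n -> 'M[R]_(p, q)) :
  loc_lipschitz K F -> loc_lipschitz K G ->
  loc_lipschitz K (fun x y => F x y + G x y).
Proof.
move=> HF HG r; have [L L0 {}HF] := HF r; have [M M0 {}HG] := HG r.
exists (L + M) => [|x y z Kx yr zr]; first exact: addr_ge0.
by rewrite opprD addrACA (le_trans (ler_normD _ _))// mulrDl lerD// ?HF// HG.
Qed.

Lemma loc_lipschitzZ p q (a : R) (F : X -> 'cV[R]_n -> 'M[R]_(p, q)) :
  loc_lipschitz K F -> loc_lipschitz K (fun x y => a *: F x y).
Proof.
move=> HF r; have [L L0 {}HF] := HF r.
exists (`|a| * L) => [|x y z Kx yr zr]; first exact: mulr_ge0.
by rewrite -scalerBr normrZ -mulrA ler_wpM2l// HF.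
Qed.

Lemma loc_lipschitz_trmx p q (F : X -> 'cV[R]_n -> 'M[R]_(p, q)) :
  loc_lipschitz K F -> loc_lipschitz K (fun x y => (F x y)^T).
Proof.
move=> HF r; have [L L0 {}HF] := HF r.
by exists L => // x y z Kx yr zr; rewrite -linearB/= norm_trmx HF.
Qed.

Lemma loc_lipschitz_mulmx p q s (F : X -> 'cV[R]_n -> 'M[R]_(p, q))
    (G : X -> 'cV[R]_n -> 'M[R]_(q, s)) :
  continuous (fun a : X * 'cV[R]_n => F a.1 a.2) ->
  continuous (fun a : X * 'cV[R]_n => G a.1 a.2) ->
  loc_lipschitz K F -> loc_lipschitz K G ->
  loc_lipschitz K (fun x y => F x y *m G x y).
Proof.
move=> cF cG HF HG r; have [L L0 {}HF] := HF r; have [M M0 {}HG] := HG r.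
have [A A0 FA] := @compact_param_bounded _ _ r cF.
have [B B0 GB] := @compact_param_bounded _ _ r cG.
exists (q%:R * (A * M + L * B)) => [|x y z Kx yr zr].
  by rewrite mulr_ge0// addr_ge0// mulr_ge0.
have -> : F x y *m G x y - F x z *m G x z =
    F x y *m (G x y - G x z) + (F x y - F x z) *m G x z.
  by rewrite mulmxBr mulmxBl addrA subrK.
rewrite (le_trans (ler_normD _ _))// mulrDr mulrDl lerD//.
  rewrite (le_trans (norm_mulmx _ _))// -!mulrA ler_wpM2l//.
  by rewrite ler_pM//; [exact: (FA x y)|exact: HG].
rewrite (le_trans (norm_mulmx _ _))// -!mulrA ler_wpM2l// (mulrCA L) mulrC.
by rewrite ler_pM//; [exact: (GB x z)|exact: HF].
Qed.

End local_lipschitz.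

Section ball_derivative.
Context {R : realType} {n : nat}.
Variables (r : R) (r0 : 0 < r).
Let B : set 'cV[R]_n := [set y | enorm y <= r].

(** Moving from [x] along the segment to a point [z] of the convex set [B]
    determines the derivative at [z - x]; these differences span the space. *)
Lemma is_fderiv_on_ball_unique (h : 'cV[R]_n -> R) x L L' : B x ->
  is_fderiv_on B h x L -> is_fderiv_on B h x L' -> L = L'.
Proof.
move=> Bx [linL _ dL] [linL' _ dL'].
have inB z : B z -> L (z - x) = L' (z - x).
  move=> Bz; apply/eqP; rewrite -subr_eq0 -normr_le0; apply/ler_addgt0Pr => e e0.
  rewrite add0r; set D := L _ - L' _.
  have w0 : 0 < `|z - x| + 1 by rewrite ltr_wpDl.
  have e'0 : 0 < e / 2 / (`|z - x| + 1) by rewrite !divr_gt0.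
  have [d d0 Hd] := dL _ e'0; have [d' d'0 Hd'] := dL' _ e'0.
  pose s := Num.min 1 (Num.min d d' / 2 / (`|z - x| + 1)).
  have s0 : 0 < s by rewrite lt_min ltr01/= !divr_gt0// lt_min d0.
  have s1 : s <= 1 by rewrite ge_min lexx.
  pose y := x + s *: (z - x).
  have yx : y - x = s *: (z - x) by rewrite /y addrC addKr.
  have By : B y.
    rewrite /B/= /y; have -> : x + s *: (z - x) = (1 - s) *: x + s *: z.
      by rewrite scalerBr scalerBl scale1r addrA addrAC.
    rewrite (le_trans (enormD _ _))// !enormZ (gtr0_norm s0).
    have s1' : 0 <= 1 - s by rewrite subr_ge0.
    rewrite (ger0_norm s1') (@le_trans _ _ ((1 - s) * r + s * r))//.
      by rewrite lerD// ler_wpM2l// ltW.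
    by rewrite -mulrDl subrK mul1r.
  have ys : `|y - x| < Num.min d d'.
    rewrite yx normrZ (gtr0_norm s0).
    have m0 : 0 < Num.min d d' by rewrite lt_min d0.
    rewrite (@le_lt_trans _ _ (Num.min d d' / 2 / (`|z - x| + 1) * (`|z - x| + 1)))//.
      rewrite ler_pM ?(ltW s0)//; first by rewrite /s ge_min lexx orbT.
      by rewrite lerDl.
    by rewrite divfK ?gt_eqF// ltr_pdivrMr// ltr_pMr// ltr1n.
  move: ys; rewrite lt_min => /andP[yd yd'].
  have := Hd _ By yd; have := Hd' _ By yd'.
  rewrite yx (linear_funZ linL) (linear_funZ linL') normrZ (gtr0_norm s0).
  move: (h y - h x) => a b1 b2.
  rewrite -(ler_pM2l s0) -[s in X in X <= _](gtr0_norm s0) -normrM /D mulrBr.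
  have -> : s * L (z - x) - s * L' (z - x) =
     (a - s *: L' (z - x)) - (a - s *: L (z - x)).
    by rewrite /GRing.scale/=; ring.
  rewrite (le_trans (ler_normB _ _))// (le_trans (lerD b1 b2))//.
  rewrite -mulrDl -mulrDl -splitr mulrCA ler_pM2l//.
  by rewrite mulrAC ler_pdivrMr// ler_pM2l// lerDl.
have B0 : B 0 by rewrite /B/= enorm0 ltW.
have Lx : L x = L' x.
  have := inB _ B0; rewrite sub0r -scaleN1r (linear_funZ linL) (linear_funZ linL').
  by rewrite !scaleN1r => /oppr_inj.
have inB' z : B z -> L z = L' z.
  move=> /inB; rewrite (linear_funB linL) (linear_funB linL') Lx => /addIr; exact.
apply/funext => v; have v0 : 0 < enorm v + 1 by rewrite ltr_wpDl ?enorm_ge0.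
have : B ((r / (enorm v + 1)) *: v).
  rewrite /B/= enormZ gtr0_norm ?divr_gt0// mulrAC ler_pdivrMr//.
  by rewrite ler_pM2l// lerDl.
move/inB'; rewrite (linear_funZ linL) (linear_funZ linL').
by apply: scalerI; rewrite mulf_neq0 ?invr_neq0 ?lt0r_neq0.
Qed.

Lemma is_fderiv_on_sub (D D' : set 'cV[R]_n) (h : 'cV[R]_n -> R) x L :
  D `<=` D' -> is_fderiv_on D' h x L -> is_fderiv_on D h x L.
Proof.
move=> DD [linL cL dL]; split => // e e0; have [d d0 Hd] := dL e e0.
by exists d => // y /DD; exact: Hd.
Qed.

Lemma is_fderiv_onB (D : set 'cV[R]_n) (h k : 'cV[R]_n -> R) x L M :
  is_fderiv_on D h x L -> is_fderiv_on D k x M ->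
  is_fderiv_on D (fun z => h z - k z) x (fun v => L v - M v).
Proof.
move=> [linL cL dL] [linM cM dM]; split.
- by move=> a u v; rewrite linL linM scalerBr opprD addrACA.
- by move=> v; exact: (continuousB (cL v) (cM v)).
- move=> e e0; have e20 : 0 < e / 2 by rewrite divr_gt0.
  have [d d0 Hd] := dL _ e20; have [d' d'0 Hd'] := dM _ e20.
  exists (Num.min d d') => [|y Dy]; first by rewrite lt_min d0.
  rewrite lt_min => /andP[yd yd'].
  have -> : h y - k y - (h x - k x) - (L (y - x) - M (y - x)) =
     (h y - h x - L (y - x)) - (k y - k x - M (y - x)) by ring.
  rewrite (le_trans (ler_normB _ _))// [e]splitr mulrDl lerD//.
    exact: Hd.
  exact: Hd'.
Qed.

Lemma grad_on_ballE (h : 'cV[R]_n -> R) x L : B x -> is_fderiv_on B h x L ->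
  grad_on B h x = \col_i L (unit_vec i).
Proof.
move=> Bx dh; have E : fderiv_on B h x = L.
  apply: (is_fderiv_on_ball_unique Bx _ dh).
  by apply: xgetPex; exists L.
by apply/colP => i; rewrite !mxE E.
Qed.

End ball_derivative.

Section radial_projection.
Context {R : realType} {n : nat}.
Implicit Types y z : 'cV[R]_n.
Variable (r : R).
Hypothesis r0 : 0 <= r.

(** Radial retraction onto the Euclidean ball of radius [r]; for [r = 0] the
    convention [0 / 0 = 0] makes it the zero map. *)
Definition radial y : 'cV[R]_n := (r / Num.max r (enorm y)) *: y.

Lemma radial_ball y : enorm (radial y) <= r.
Proof.
rewrite /radial enormZ normrM normfV (ger0_norm r0).
have m0 : 0 <= Num.max r (enorm y) by rewrite le_max r0.
rewrite (ger0_norm m0).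
have [-> |m1] := eqVneq (Num.max r (enorm y)) 0.
  by rewrite invr0 mulr0 mul0r.
have {}m0 : 0 < Num.max r (enorm y) by rewrite lt_neqAle eq_sym m1.
by rewrite mulrAC ler_pdivrMr// ler_wpM2l// le_max lexx orbT.
Qed.

Lemma radial_id y : enorm y <= r -> radial y = y.
Proof.
move=> yr; rewrite /radial; have /max_idPl -> := yr.
have [rE|rn0] := eqVneq r 0; last by rewrite divff// scale1r.
have : enorm y <= 0 by rewrite -rE.
move/(le_trans (norm_le_enorm y)); rewrite normr_le0 => /eqP ->.
by rewrite scaler0.
Qed.

Lemma radial_lipschitz y z :
  enorm (radial y - radial z) <= 2 * enorm (y - z).
Proof.
have [rE|rn0] := eqVneq r 0.
  by rewrite /radial rE !mul0r !scale0r subrr enorm0 mulr_ge0// enorm_ge0.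
have rp : 0 < r by rewrite lt_neqAle eq_sym rn0.
rewrite /radial; set a := Num.max r (enorm y); set b := Num.max r (enorm z).
have ra : r <= a by rewrite le_max lexx.
have rb : r <= b by rewrite le_max lexx.
have a0 : 0 < a by exact: lt_le_trans ra.
have b0 : 0 < b by exact: lt_le_trans rb.
have zb : enorm z <= b by rewrite le_max lexx orbT.
have tri (u v : 'cV[R]_n) : enorm u <= enorm v + enorm (u - v).
  by have := enormD v (u - v); rewrite [v + _]addrC subrK.
have ab : `|b - a| <= enorm (y - z).
  have := tri y z; have := tri z y; rewrite -(enormN (z - y)) opprB.
  have := enorm_ge0 (y - z).
  rewrite /a /b; case: (leP r (enorm y)) => ?; case: (leP r (enorm z)) => ? ? ? ?;
    rewrite ler_norml; apply/andP; split; lra.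
have -> : (r / a) *: y - (r / b) *: z = (r / a) *: (y - z) + (r / a - r / b) *: z.
  by rewrite scalerBr scalerBl addrA subrK.
rewrite (le_trans (enormD _ _))// !enormZ mulr2n mulrDl mul1r lerD//.
  rewrite ger0_norm ?divr_ge0 ?(ltW a0)// ler_piMl ?enorm_ge0//.
  by rewrite ler_pdivrMr// mul1r.
have -> : r / a - r / b = (r / a) * ((b - a) / b) by field; rewrite !gt_eqF.
rewrite normrM ger0_norm ?divr_ge0 ?(ltW a0)// normrM normfV (gtr0_norm b0).
rewrite -mulrA (@le_trans _ _ `|b - a|)//.
rewrite (@le_trans _ _ (1 * (`|b - a| / b * b)))//; last by rewrite mul1r divfK ?gt_eqF.
rewrite ler_pM ?divr_ge0 ?mulr_ge0 ?invr_ge0 ?enorm_ge0 ?(ltW a0) ?(ltW b0)//.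
  by rewrite ler_pdivrMr// mul1r.
by rewrite ler_wpM2l// mulr_ge0// invr_ge0 ltW.
Qed.

Lemma radial_norm_lipschitz y z : `|radial y - radial z| <= 2 * n%:R * `|y - z|.
Proof.
rewrite (le_trans (norm_le_enorm _))// (le_trans (radial_lipschitz _ _))//.
by rewrite -mulrA ler_wpM2l// enorm_le_norm.
Qed.

Lemma radial_continuous : continuous radial.
Proof.
move=> y; apply/(@cvgrPdist_le _ _ _ _ (nbhs_filter y)) => e e0.
have c0 : 0 < 2 * n%:R + 1 :> R by rewrite ltr_wpDl// mulr_ge0.
apply/nbhs_ballP; exists (e / (2 * n%:R + 1)); first by rewrite /= divr_gt0.
move=> z; rewrite -ball_normE /ball_/= ltr_pdivlMr// => yz.
rewrite (le_trans (radial_norm_lipschitz _ _))// (le_trans _ (ltW yz))//.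
by rewrite mulrC ler_wpM2l// lerDl.
Qed.

End radial_projection.

(** * Lebesgue measure on R^n and Bochner spaces *)

Section measurable_cV.
Context {R : realType} {n : nat}.
Implicit Types (A U K : set 'cV[R]_n).

Lemma measurable_cV_coordinatewise (F : 'I_n -> set R) :
  (forall i, measurable (F i)) ->
  measurable [set x : 'cV[R]_n | forall i, F i (x i ord0)].
Proof.
move=> mF; rewrite (_ : [set x | _] =
    \bigcap_(i in setT) ((fun x : 'cV[R]_n => x i ord0) @^-1` F i)); last first.
  by apply/seteqP; split => [x /= H i _|x H i]; [exact: H|exact: (H i)].
apply: fin_bigcap_measurable; first exact: finite_finset.
by move=> i _; rewrite -[X in measurable X]setTI; exact: measurable_cV_coor.
Qed.

(** R^n is second countable: rational boxes generate its topology. *)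
Lemma open_measurable_cV U : open U -> measurable U.
Proof.
move=> oU; pose B (a : 'cV[rat]_n * nat) := [set x : 'cV[R]_n |
  forall i, `]ratr (a.1 i ord0) - a.2.+1%:R^-1, ratr (a.1 i ord0) + a.2.+1%:R^-1[%classic (x i ord0)].
pose F a := if `[< B a `<=` U >] then B a else set0.
suff -> : U = \bigcup_a F a.
  apply: (@countable_bigcupT_measurable _ _ _ F).
    exact: (@countableP ('cV[rat]_n * nat)%type).
  move=> a; rewrite /F; case: ifPn => _ //.
  apply: (@measurable_cV_coordinatewise (fun i => `]ratr (a.1 i ord0) - a.2.+1%:R^-1,
    ratr (a.1 i ord0) + a.2.+1%:R^-1[%classic)) => i.
  exact: measurable_itv.
apply/seteqP; split => [x Ux|x [a _]]; last first.
  by rewrite /F; case: asboolP => // BU; exact: BU.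
have /nbhs_ballP[e /= e0 eU] := open_nbhs_nbhs (conj oU Ux).
have [k ke] : exists k : nat, k.+1%:R^-1 < e / 2.
  have e20 : 0 < e / 2 by rewrite divr_gt0.
  have e2i : 0 <= (e / 2)^-1 by rewrite invr_ge0 ltW.
  exists (Num.bound (e / 2)^-1).
  rewrite invf_plt ?posrE ?ltr0n// (lt_trans (archi_boundP e2i))//.
  by rewrite ltr_nat.
have k0 : 0 < k.+1%:R^-1 :> R by rewrite invr_gt0.
have qex i : exists q : rat, (ratr q : R) \in `]x i ord0 - k.+1%:R^-1, x i ord0 + k.+1%:R^-1[.
  by move: k0; move: (k.+1%:R^-1 : R) => d d0; apply: rat_in_itvoo; lra.
pose q : 'cV[rat]_n := \col_i xchoose (qex i).
have qP i : (ratr (q i ord0) : R) \in `]x i ord0 - k.+1%:R^-1, x i ord0 + k.+1%:R^-1[.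
  by rewrite mxE; exact: xchooseP (qex i).
exists (q, k) => //; rewrite /F; case: asboolP => [_|].
  move=> i /=; have := qP i; rewrite !in_itv/=.
  move: (k.+1%:R^-1 : R) (ratr (q i ord0) : R) (x i ord0) => d u v /andP[? ?].
  by apply/andP; split; lra.
case=> y By; apply: eU; rewrite -ball_normE /ball_/=.
rewrite (@le_lt_trans _ _ (2 * k.+1%:R^-1))//; last first.
  by rewrite mulrC -ltr_pdivlMr.
apply: norm_le_entry => [|i j]; first by rewrite mulr_ge0// ltW.
have -> : (x - y) i j = x i ord0 - y i ord0 by rewrite !mxE ord1.
have := By i; have := qP i; rewrite /= !in_itv/=.
move: (k.+1%:R^-1 : R) (ratr (q i ord0) : R) (x i ord0) (y i ord0) => d u v w.
by move=> /andP[? ?] /andP[? ?]; rewrite ler_norml; apply/andP; split; lra.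
Qed.

Lemma compact_measurable_cV K : compact K -> measurable K.
Proof.
move=> cK; rewrite -(setCK K); apply: measurableC; apply: open_measurable_cV.
apply: closed_openC; apply: compact_closed => //; exact: norm_hausdorff.
Qed.

Lemma continuous_measurable_cV (h : 'cV[R]_n -> R) : continuous h ->
  measurable_fun setT h.
Proof.
move=> /continuousP ch; apply: (measurability _ (RGenOpens.measurableE R)).
move=> _ [_ [a [b ->] <-]]; rewrite setTI; apply: open_measurable_cV.
exact/ch/interval_open.
Qed.

Lemma lebesgue_cV_bounded_lty A r : measurable A ->
  (forall x, A x -> `|x| <= r) -> (lebesgue_cV n A < +oo)%E.
Proof.
move=> mA Ar; pose r' := Num.max 0 r.
have r'0 : 0 <= r' by rewrite le_max lexx.
pose Bx := [set x : 'cV[R]_n | forall i, x i ord0 \in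
  `[(const_mx (- r') : 'cV[R]_n) i ord0, (const_mx r' : 'cV[R]_n) i ord0]].
have ABx : A `<=` Bx.
  move=> x Ax i; rewrite !mxE in_itv/= -ler_norml.
  rewrite (le_trans (entry_le_norm x i ord0))// (le_trans (Ar x Ax))//.
  by rewrite le_max lexx orbT.
have mBx : measurable Bx.
  apply: (@measurable_cV_coordinatewise (fun i => `[(const_mx (- r') : 'cV[R]_n) i ord0,
    (const_mx r' : 'cV[R]_n) i ord0]%classic)) => i.
  exact: measurable_itv.
apply: (@le_lt_trans _ _ (lebesgue_cV n Bx)).
  by apply: le_measure; rewrite ?inE.
rewrite lebesgue_cV_box ?ltry// => i.
by rewrite !mxE (le_trans _ r'0)// oppr_le0.
Qed.

Lemma compact_bounded_cV K : compact K -> exists r, forall x, K x -> `|x| <= r.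
Proof.
move=> cK; have cid' : continuous (fun x : 'cV[R]_n => x) by move=> x; exact: cvg_id.
by have [r _ Hr] := compact_norm_bounded cK cid'; exists r.
Qed.

Lemma continuous_integrable_cV K (h : 'cV[R]_n -> R) : compact K ->
  continuous h -> (lebesgue_cV n).-integrable K (EFin \o h).
Proof.
move=> cK ch; have mK := compact_measurable_cV cK.
have [C C0 hC] := compact_norm_bounded cK ch.
have [r Kr] := compact_bounded_cV cK.
apply: measurable_bounded_integrable => //.
- exact: lebesgue_cV_bounded_lty Kr.
- by apply: measurable_funS (continuous_measurable_cV ch).
- exists C; split; first exact: num_real.
  by move=> s Cs x Kx /=; rewrite (le_trans (hC _ Kx))// ltW.
Qed.

End measurable_cV.

Section ae_equal_integrals.
Import HBNNSimple.
Context d (T : measurableType d) (R : realType) (mu : {measure set T -> \bar R}).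

(** The integral is a supremum over simple functions, which can be cut off on
    a null set; so null sets are negligible even for functions that are not
    measurable. *)
Lemma ge0_integral_off_null_le (f g : T -> \bar R) (N : set T) :
  measurable N -> mu N = 0%E -> (forall x, (0 <= f x)%E) ->
  (forall x, (0 <= g x)%E) -> (forall x, ~ N x -> (f x <= g x)%E) ->
  (\int[mu]_x f x <= \int[mu]_x g x)%E.
Proof.
move=> mN muN f0 g0 fg; rewrite !ge0_integralTE//.
apply: ge_ereal_sup => _ [h /= hf <-].
have mNC := measurableC mN.
pose h' := mul_nnsfun h (indic_nnsfun R mNC).
apply: (@le_trans _ _ (sintegral mu h')); last first.
  apply: ereal_sup_ubound; exists h' => // x.
  change ((h x * \1_(~` N) x)%:E <= g x)%E; rewrite indicE.
  have [Nx|Nx] := pselect (N x).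
    by rewrite memNset ?mulr0//= => /(_ Nx).
  by rewrite mem_set// mulr1 (le_trans (hf x))// fg.
rewrite -!integralT_nnsfun le_eqVlt; apply/orP; left; apply/eqP.
apply: ge0_ae_eq_integral => //.
- by apply/measurable_EFinP; exact: measurable_funP.
- by apply/measurable_EFinP; exact: measurable_funP.
- by move=> x _; rewrite lee_fin.
- by move=> x _; rewrite lee_fin.
exists N; split => // x /= /not_implyP[_ H]; apply: contrapT => Nx; apply: H.
change ((h x)%:E = (h x * \1_(~` N) x)%:E).
by rewrite indicE mem_set ?mulr1.
Qed.

Lemma ge0_integral_off_null (f g : T -> \bar R) (N : set T) :
  measurable N -> mu N = 0%E -> (forall x, (0 <= f x)%E) ->
  (forall x, (0 <= g x)%E) -> (forall x, ~ N x -> f x = g x) ->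
  (\int[mu]_x f x = \int[mu]_x g x)%E.
Proof.
move=> mN muN f0 g0 fg; apply/eqP; rewrite eq_le; apply/andP; split.
  by apply: (@ge0_integral_off_null_le _ _ N) => // x Nx; rewrite fg.
by apply: (@ge0_integral_off_null_le _ _ N) => // x Nx; rewrite fg.
Qed.

Lemma eq_Rintegral_ae (D : set T) (f g : T -> R) :
  {ae mu, forall x, D x -> f x = g x} ->
  \int[mu]_(x in D) f x = \int[mu]_(x in D) g x.
Proof.
move=> [N [mN muN fgN]]; congr fine.
rewrite integral_mkcond [RHS]integral_mkcond integralE [RHS]integralE.
have E x : ~ N x -> ((EFin \o f) \_ D) x = ((EFin \o g) \_ D) x.
  move=> Nx; rewrite !patchE; case: ifPn => // /set_mem Dx; congr EFin.
  by apply: contrapT => fgx; apply: Nx; apply: fgN => /=; exact/not_implyP.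
by congr (_ - _)%E; apply: (ge0_integral_off_null mN muN) => // x Nx;
  rewrite ?funeposE ?funenegE E.
Qed.

End ae_equal_integrals.

Section bochner.
Context {R : realType} {n m : nat} (P : ocp R n m).
Local Notation T := (horizon P).
Hypothesis T0 : 0 < T.

(** Finitely many sets on which [Uc] varies by at most [e], uniformly in time,
    cover [Y0]; removing from each the union of its predecessors makes them
    disjoint. *)
Lemma continuous_simple_approx (Y0 : set 'cV[R]_n) (Uc : 'cV[R]_n * R -> 'cV[R]_m) e :
  compact Y0 -> continuous Uc -> 0 < e ->
  exists2 S, simple_L2 P S & forall y0, Y0 y0 -> forall t, 0 <= t <= T ->
    `|S y0 t - Uc (y0, t)| <= e.
Proof.
move=> cY0 cU e0.
pose O (y : 'cV[R]_n) := interior [set y' | forall t, `[0, T]%classic t ->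
   `|Uc (y', t) - Uc (y, t)| <= e].
have oO y : open (O y) by exact: open_interior.
have Oy y : O y y by exact: tube_lemma (@segment_compact R 0 T) cU y e e0.
have : Y0 `<=` cover Y0 O by move=> y Yy; exists y.
move: cY0; rewrite compact_cover => /(_ _ Y0 O (fun y _ => oO y)) /[apply].
move=> [D DY0 YD]; pose s : seq 'cV[R]_n := finmap.enum_fset D.
pose N := size s; pose A (i : 'I_N) := O (nth 0 s i) `\`
  \bigcup_(l in [set l : 'I_N | (l < i)%N]) O (nth 0 s l).
exists (fun y0 t => \sum_(i < N) \1_(A i) y0 *: Uc (nth 0 s i, t)).
  exists N, A, (fun i t => Uc (nth 0 s i, t)); split => // i; split.
    apply: measurableD; first by apply: open_measurable_cV; exact: oO.
    by apply: open_measurable_cV; apply: bigcup_open => l _; exact: oO.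
  apply: continuous_L2; apply: continuous_subspaceT.
  exact: continuous_section.
move=> y0 Yy0 t tT.
have [y ys Oyy0] : exists2 y, y \in s & O y y0.
  by have [y Dy Oyy0] := YD _ Yy0; exists y.
have hasO : has (fun y => `[< O y y0 >]) s.
  by apply/hasP; exists y => //; exact/asboolP.
have Nlt : (find (fun y => `[< O y y0 >]) s < N)%N by rewrite -has_find.
pose i0 := Ordinal Nlt.
have Oi0 : O (nth 0 s i0) y0 by have := nth_find 0 hasO; exact: asboolW.
have before (l : 'I_N) : (l < i0)%N -> ~ O (nth 0 s l) y0.
  move=> li Ol; have /negP := negbT (before_find 0 li); apply.
  exact/asboolP.
rewrite (bigD1 i0)//= big1 ?addr0 => [|i ii0].
  rewrite indicE mem_set ?scale1r; last first.
    by split => // -[l /= li]; exact: before.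
  rewrite distrC; have := interior_subset Oi0 => /(_ t); apply.
  by rewrite /= in_itv.
rewrite indicE memNset ?scale0r// => -[Oi nOi].
have [ii|ii|/val_inj ii] := ltngtP i i0.
- exact: before ii Oi.
- by apply: nOi; exists i0.
- by rewrite ii eqxx in ii0.
Qed.

(** A control depending continuously on initial value and time is a uniform
    limit of simple functions. *)
Lemma continuous_in_Uad (Y0 : set 'cV[R]_n) (U : 'cV[R]_n -> R -> 'cV[R]_m)
    (Uc : 'cV[R]_n * R -> 'cV[R]_m) :
  compact Y0 -> continuous Uc ->
  (forall y0 t, 0 < t < T -> U y0 t = Uc (y0, t)) ->
  in_Uad P Y0 U.
Proof.
move=> cY0 cU UE; have mY0 := compact_measurable_cV cY0.
have LUc y0 : L2 0 T (fun t => Uc (y0, t)).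
  by apply: continuous_L2; apply: continuous_subspaceT; exact: continuous_section.
have LU y0 : L2 0 T (U y0).
  by apply: eq_L2 (LUc y0) => t tT; rewrite UE.
split.
- by apply: aeW => y0 _; exact: LU.
- have ex (j : nat) : {S | simple_L2 P S /\ forall y0, Y0 y0 ->
      forall t, 0 <= t <= T -> `|S y0 t - Uc (y0, t)| <= harmonic j}.
    apply: cid; have [|S S1 S2] := @continuous_simple_approx Y0 Uc (harmonic j) cY0 cU.
      by rewrite /harmonic/= invr_gt0.
    by exists S.
  exists (fun j => sval (ex j)); split; first by move=> j; case: (svalP (ex j)).
  apply: aeW => y0 Yy0.
  have LS j : L2 0 T (sval (ex j) y0).
    have [[N [A [c [Ac SE]]]] _] := svalP (ex j).
    rewrite (_ : sval (ex j) y0 = fun t => \sum_(i < N) \1_(A i) y0 *: c i t); last first.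
      by apply/funext => t; exact: SE.
    elim: (index_enum _) => [|i r IH].
      rewrite (_ : (fun t => _) = cst 0); last by apply/funext => t; rewrite big_nil.
      by apply: continuous_L2 => t; exact: cvg_cst.
    rewrite (_ : (fun t => _) = fun t => \1_(A i) y0 *: c i t +
        \sum_(i <- r) \1_(A i) y0 *: c i t); last first.
      by apply/funext => t; rewrite big_cons.
    by apply: L2D => //; apply: L2Z; case: (Ac i).
  pose q := m%:R * T + 1.
  have q0 : 0 <= m%:R * T by rewrite mulr_ge0// ltW.
  apply: (@squeeze_cvgr _ _ _ _ (cst 0) (fun j => q * harmonic j)); last 2 first.
  - exact: cvg_cst.
  - rewrite -[X in _ --> X](mulr0 q); apply: cvgMr; exact: cvg_harmonic.
  apply: nearW => j; rewrite sqrtr_ge0/=.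
  have h0 : 0 <= harmonic j :> R by rewrite /harmonic/= invr_ge0.
  rewrite -(@ler_pXn2r _ 2)// ?nnegrE ?sqrtr_ge0 ?mulr_ge0 ?addr_ge0//.
  have [_ HS] := svalP (ex j).
  apply: le_trans (@L2norm_le_sup _ _ T0 _ _ (harmonic j) _ h0 _) _.
  - by apply: L2B => //; exact: LS.
  - move=> t /[dup] tT /andP[/ltW t0 /ltW tT'].
    by rewrite UE// HS// t0.
  - rewrite exprMn mulrAC ler_wpM2r ?sqr_ge0//.
    by rewrite /q; nra.
- pose h y0 := L2norm 0 T (fun t => Uc (y0, t)) ^+ 2.
  have ch : continuous h.
    pose hh (a : 'cV[R]_n * R) := enorm (Uc a) ^+ 2.
    have chh : continuous hh.
      by move=> a; apply: cvgM; exact: enorm_continuous.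
    have := continuous_horizon_Rintegral T0 chh.
    rewrite (_ : (fun x => _) = h); first exact.
    by apply/funext => y0; rewrite /h sqr_L2norm.
  rewrite (eq_integral (EFin \o h)).
    exact: (integrable_lty _ (continuous_integrable_cV cY0 ch)).
  move=> y0 _; congr EFin; rewrite /h; congr (_ ^+ 2).
  exact: (eq_L2norm (UE y0)).
Qed.

End bochner.

(** * The closed-loop vector field and its linearisation *)

Section entry_functional.
Context {R : realType} {p q : nat}.

Lemma entry_linear i j : linear (fun A : 'M[R]_(p, q) => A i j : R^o).
Proof. by move=> a A B; rewrite !mxE. Qed.

End entry_functional.

Section network_fields.
Context {R : realType} {n m k : nat}.
Variables (P : ocp R n m) (V : 'cV[R]_k -> R -> 'cV[R]_n -> R).
Local Notation T := (horizon P).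
Local Notation X := ('cV[R]_k * R)%type.
Hypothesis T0 : 0 < T.
Hypothesis hA1 : regular_dynamics P.
Hypothesis hVC : Ck_on 4 setT (fun x : 'cV[R]_k * R * 'cV[R]_n => V x.1.1 x.1.2 x.2).

(** The fields are functions of a parameter-time pair and a state, defined for
    all times thanks to [clamp]; [drift] and [gain] do not vary with the network
    parameter. *)
Definition drift (x : X) (y : 'cV[R]_n) : 'cV[R]_n := dyn_f P (clamp T x.2) y.
Definition gain (x : X) (y : 'cV[R]_n) : 'M[R]_(n, m) := dyn_g P (clamp T x.2) y.
Definition net_grad (x : X) (y : 'cV[R]_n) : 'cV[R]_n := grad (V x.1 x.2) y.
Definition net_control (x : X) (y : 'cV[R]_n) : 'cV[R]_m :=
  - (beta P)^-1 *: ((gain x y)^T *m net_grad x y).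
Definition net_field (x : X) (y : 'cV[R]_n) : 'cV[R]_n :=
  drift x y + gain x y *m net_control x y.

Let kappa (x : X) : R := clamp T x.2.

Let ckappa : continuous kappa.
Proof.
by apply: continuous_compose; [exact: continuous_snd|exact: continuous_clamp].
Qed.

Let Dkappa x : `[0, T]%classic (kappa x).
Proof. by rewrite /= in_itv/= clamp_itv// ltW. Qed.

Lemma drift_C1 i : exists g, C1_state (fun x y => drift x y i ord0) g.
Proof.
have [Cf _ _ _] := hA1.
exact: (ex_intro _ _ (Ck_on_C1_state (entry_linear i ord0)
  (fun A => entry_le_norm A i ord0) ckappa Dkappa Cf)).
Qed.

Lemma gain_C1 i j : exists g, C1_state (fun x y => gain x y i j) g.
Proof.
have [_ Cg _ _] := hA1.
exact: (ex_intro _ _ (Ck_on_C1_state (entry_linear i j)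
  (fun A => entry_le_norm A i j) ckappa Dkappa Cg)).
Qed.

Let idlin : linear (fun a : R^o => a : R^o).
Proof. by []. Qed.

Let VC : Ck_on 4 ((setT : set X) `*` (setT : set 'cV[R]_n))
  (fun x : X * 'cV[R]_n => V x.1.1 x.1.2 x.2 : R^o).
Proof. by rewrite setXTT; exact: hVC. Qed.

Let cidX : continuous (fun x : X => x).
Proof. by move=> x; exact: cvg_id. Qed.

Lemma net_value_C1 : exists g, C1_state (fun (x : X) y => V x.1 x.2 y) g.
Proof.
exact: (ex_intro _ _ (Ck_on_C1_state idlin (fun a => lexx `|a|) cidX
  (fun=> I) VC)).
Qed.

Lemma net_grad_C1 i : exists g, C1_state (fun x y => net_grad x y i ord0) g.
Proof.
have CV := Ck_on_C1_state idlin (fun a => lexx `|a|) cidX (fun=> I) VC.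
have VC' : Ck_on 3 ((setT : set X) `*` (setT : set 'cV[R]_n))
    (fun x => fderiv_on ((setT : set X) `*` (setT : set 'cV[R]_n))
      (fun x : X * 'cV[R]_n => V x.1.1 x.1.2 x.2 : R^o) x (0, unit_vec i)).
  by case: VC => _; exact.
have H := Ck_on_C1_state idlin (fun a => lexx `|a|) cidX (fun=> I) VC'.
eexists; rewrite (_ : (fun x y => _) = (fun (x : X) y => fderiv_on
    ((setT : set X) `*` (setT : set 'cV[R]_n))
    (fun x : X * 'cV[R]_n => V x.1.1 x.1.2 x.2 : R^o) (x, y) (0, unit_vec i))).
  exact: H.
apply/funext => x; apply/funext => y; rewrite /net_grad.
by rewrite (C1_state_grad x y CV) mxE.
Qed.

Let C1_mx_continuous p q (F : X -> 'cV[R]_n -> 'M[R]_(p, q)) :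
  (forall i j, exists g, C1_state (fun x y => F x y i j) g) ->
  continuous (fun a : X * 'cV[R]_n => F a.1 a.2).
Proof. by move=> H; apply: mx_continuous => i j; have [g []] := H i j. Qed.

Lemma drift_continuous : continuous (fun a : X * 'cV[R]_n => drift a.1 a.2).
Proof. by apply: C1_mx_continuous => i j; rewrite ord1; exact: drift_C1. Qed.

Lemma gain_continuous : continuous (fun a : X * 'cV[R]_n => gain a.1 a.2).
Proof. by apply: C1_mx_continuous => i j; exact: gain_C1. Qed.

Lemma net_grad_continuous :
  continuous (fun a : X * 'cV[R]_n => net_grad a.1 a.2).
Proof. by apply: C1_mx_continuous => i j; rewrite ord1; exact: net_grad_C1. Qed.

Lemma net_value_continuous :
  continuous (fun a : X * 'cV[R]_n => V a.1.1 a.1.2 a.2).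
Proof. by have [g []] := net_value_C1. Qed.

Lemma net_control_continuous :
  continuous (fun a : X * 'cV[R]_n => net_control a.1 a.2).
Proof.
apply: mx_continuousZ; apply: mulmx_continuous.
  by apply: trmx_continuous; exact: gain_continuous.
exact: net_grad_continuous.
Qed.

Lemma net_field_continuous :
  continuous (fun a : X * 'cV[R]_n => net_field a.1 a.2).
Proof.
apply: mx_continuousD; first exact: drift_continuous.
apply: mulmx_continuous; first exact: gain_continuous.
exact: net_control_continuous.
Qed.

Let C1_mx_lipschitz (K : set X) p q (F : X -> 'cV[R]_n -> 'M[R]_(p, q)) :
  compact K ->
  (forall i j, exists g, C1_state (fun x y => F x y i j) g) ->
  loc_lipschitz K F.
Proof.
move=> cK H; apply: loc_lipschitz_entries => i j r; have [g Hg] := H i j.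
exact: (C1_state_lipschitz cK Hg).
Qed.

Section compact_parameters.
Variable K : set X.
Hypothesis cK : compact K.

Lemma drift_lipschitz : loc_lipschitz K drift.
Proof. by apply: C1_mx_lipschitz => // i j; rewrite ord1; exact: drift_C1. Qed.

Lemma gain_lipschitz : loc_lipschitz K gain.
Proof. by apply: C1_mx_lipschitz => // i j; exact: gain_C1. Qed.

Lemma net_control_lipschitz : loc_lipschitz K net_control.
Proof.
apply: loc_lipschitzZ; apply: (loc_lipschitz_mulmx cK).
- by apply: trmx_continuous; exact: gain_continuous.
- exact: net_grad_continuous.
- exact: loc_lipschitz_trmx gain_lipschitz.
- by apply: C1_mx_lipschitz => // i j; rewrite ord1; exact: net_grad_C1.
Qed.

Lemma net_field_lipschitz : loc_lipschitz K net_field.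
Proof.
apply: loc_lipschitzD; first exact: drift_lipschitz.
apply: (loc_lipschitz_mulmx cK).
- exact: gain_continuous.
- exact: net_control_continuous.
- exact: gain_lipschitz.
- exact: net_control_lipschitz.
Qed.

End compact_parameters.

(** The adjoint equation is linear in [p]; this is its matrix along a state. *)
Definition adjoint_mx (x : X) (y : 'cV[R]_n) : 'M[R]_n :=
  (jac (dyn_f P (clamp T x.2)) y)^T + \matrix_(k0, i) \sum_j
    'D_(unit_vec k0) (fun z => dyn_g P (clamp T x.2) z i j) y *
      net_control x y j ord0.

Lemma adjoint_mxE x y p : adjoint_mx x y *m p =
  (jac (dyn_f P (clamp T x.2)) y)^T *m p +
  adjoint_coupling P (clamp T x.2) y (net_control x y) p.
Proof.
rewrite /adjoint_mx mulmxDl; congr (_ + _); apply/colP => k0; rewrite !mxE.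
by apply: eq_bigr => i _; rewrite mxE mulr_suml.
Qed.

Lemma adjoint_mx_continuous :
  continuous (fun a : X * 'cV[R]_n => adjoint_mx a.1 a.2).
Proof.
have C1_derive h (i : 'I_n) : (exists g, C1_state h g) ->
    continuous (fun a : X * 'cV[R]_n => 'D_(unit_vec i) (h a.1) a.2).
  move=> [g Hg]; rewrite (_ : (fun a => _) = fun a => g a i ord0).
    by case: Hg => _ cg _; exact: entry_continuous.
  by apply/funext => -[x y]/=; rewrite -(C1_state_grad x y Hg) mxE.
apply: mx_continuousD.
  apply: trmx_continuous; apply: mx_continuous => i j.
  rewrite (_ : (fun x => _) = fun b : X * 'cV[R]_n =>
      'D_(unit_vec j) ((fun x y => drift x y i ord0) b.1) b.2).
    by apply: (C1_derive (fun x y => drift x y i ord0) j); exact: drift_C1.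
  by apply/funext => b; rewrite mxE.
apply: mx_continuous => k0 i.
rewrite (_ : (fun x => _) = fun b : X * 'cV[R]_n =>
    \sum_j 'D_(unit_vec k0) ((fun x y => gain x y i j) b.1) b.2 *
      net_control b.1 b.2 j ord0).
  apply: continuous_sumr => j _ b; apply: cvgM.
    by apply: (C1_derive (fun x y => gain x y i j) k0); exact: gain_C1.
  apply: (@entry_continuous _ _ _ _
    (fun a : X * 'cV[R]_n => net_control a.1 a.2)).
  exact: net_control_continuous.
by apply/funext => b; rewrite mxE.
Qed.

End network_fields.

(** * State and adjoint trajectories *)

Section trajectories.
Context {R : realType} {n m k : nat}.
Local Notation mu := (@lebesgue_measure R).
Variables (P : ocp R n m) (M : R) (V : 'cV[R]_k -> R -> 'cV[R]_n -> R).
Local Notation T := (horizon P).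
Local Notation X := ('cV[R]_k * R)%type.
Local Notation Z := ('cV[R]_k * 'cV[R]_n)%type.
Hypothesis T0 : 0 < T.
Hypothesis hyd : L2 0 T (yd P).
Hypothesis M0 : 0 < M.
Hypothesis hA1 : regular_dynamics P.
Hypothesis hVC : Ck_on 4 setT (fun x : 'cV[R]_k * R * 'cV[R]_n => V x.1.1 x.1.2 x.2).

Let rad : R := 2 * Mhat P M.

Let rad0 : 0 <= rad.
Proof. by rewrite !mulr_ge0 ?embedding_norm_ge0// ltW. Qed.

(** The closed-loop field is only locally Lipschitz in the state, so solutions
    may blow up for some parameters. Evaluating it at the retraction onto the
    ball that contains all values of admissible trajectories makes it globally
    Lipschitz and does not affect these trajectories. *)
Definition trunc_field (x : X) (y : 'cV[R]_n) : 'cV[R]_n :=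
  net_field P V x (radial (2 * Mhat P M) y).

Lemma trunc_field_lipschitz (K : set X) : compact K ->
  exists2 L, 0 <= L & forall x y y', K x ->
    `|trunc_field x y - trunc_field x y'| <= L * `|y - y'|.
Proof.
move=> cK; have [L L0 HL] := net_field_lipschitz T0 hA1 hVC cK rad.
have rb (y : 'cV[R]_n) : `|radial rad y| <= rad.
  by rewrite (le_trans (norm_le_enorm _))// radial_ball.
exists (L * (2 * n%:R)) => [|x y y' Kx]; first by rewrite !mulr_ge0.
rewrite (le_trans (HL x _ _ Kx (rb y) (rb y')))// -mulrA ler_wpM2l//.
exact: radial_norm_lipschitz.
Qed.

Lemma trunc_field_continuous (W : topologicalType) (a : W -> X)
    (b : W -> 'cV[R]_n) : continuous a -> continuous b ->
  continuous (fun w => trunc_field (a w) (b w)).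
Proof.
move=> ca cb; apply: (@continuous_compose _ _ _
  (fun w => (a w, radial rad (b w))) (fun x => net_field P V x.1 x.2)).
  apply: continuous_pair => //; apply: continuous_compose => //.
  exact: radial_continuous.
exact: (net_field_continuous T0 hA1 hVC).
Qed.

Lemma state_family : exists2 Y : Z * R -> 'cV[R]_n, continuous Y &
  forall z t i, 0 <= t <= T -> Y (z, t) i ord0 = z.2 i ord0 +
    \int[mu]_(s in `]0, t[) trunc_field (z.1, s) (Y (z, s)) i ord0.
Proof.
have c12 : continuous (fun w : Z * R * 'cV[R]_n => (w.1.1.1, w.1.2)).
  apply: continuous_pair.
    apply: continuous_compose; last exact: continuous_fst.
    by apply: continuous_compose; exact: continuous_fst.
  by apply: continuous_compose; [exact: continuous_fst|exact: continuous_snd].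
have [||z|Y cY eY] := @volterra_param R T (past T) T0 (past_family T0) n Z
   (fun w => trunc_field (w.1.1.1, w.1.2) w.2) (fun w => w.1.2).
- by apply: trunc_field_continuous => //; exact: continuous_snd.
- by apply: continuous_compose; [exact: continuous_fst|exact: continuous_snd].
- pose K := [set th : 'cV[R]_k | `|th| <= `|z.1| + 1] `*` `[0, T]%classic.
  have cK : compact K.
    by apply: compact_setX; [exact: compact_cV_ball|exact: segment_compact].
  have [L L0 HL] := trunc_field_lipschitz cK.
  exists L => //; have e1 : \forall z' \near z, `|z'.1| <= `|z.1| + 1.
    have c1 : continuous (fun z' : Z => `|z'.1|).
      by move=> z'; apply: cvg_norm; exact: continuous_fst.
    have /cvgrPdist_le/(_ _ ltr01) := c1 z; apply: filterS => z' H.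
    rewrite -lerBlDl (le_trans _ H)// distrC; exact: ler_norm.
  apply: filterS e1 => z' z'1 s y y' sT; apply: HL; split; first exact: z'1.
  by rewrite /= in_itv.
exists Y => // z t i tT; rewrite eY// /past clamp_id//.
Qed.

Variable Y : Z * R -> 'cV[R]_n.
Hypothesis cY : continuous Y.
Hypothesis eY : forall z t i, 0 <= t <= T -> Y (z, t) i ord0 = z.2 i ord0 +
    \int[mu]_(s in `]0, t[) trunc_field (z.1, s) (Y (z, s)) i ord0.

Local Notation state z := (fun t => Y (z, t)).

Let cYz z : continuous (state z).
Proof. exact: continuous_section. Qed.

Let wYz z : {within `[0, T], continuous (state z)}.
Proof. by apply: continuous_subspaceT; exact: cYz. Qed.

Let cxs : continuous (fun w : Z * R => (w.1.1, w.2)).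
Proof.
apply: continuous_pair; last exact: continuous_snd.
by apply: continuous_compose; [exact: continuous_fst|exact: continuous_fst].
Qed.

Let cvf : continuous (fun w : Z * R => trunc_field (w.1.1, w.2) (Y w)).
Proof. exact: (trunc_field_continuous (@cxs) cY). Qed.

Let T00 : 0 <= (0 : R) <= T. Proof. by rewrite lexx ltW. Qed.

Lemma state_initial z : Y (z, 0) = z.2.
Proof.
apply/colP => i; rewrite eY//.
by rewrite (@set_itv_ge _ _ (BRight 0) (BLeft 0)) ?bnd_simp// Rintegral_set0 addr0.
Qed.

Lemma state_weak_deriv z :
  weak_deriv 0 T (state z) (fun s => trunc_field (z.1, s) (Y (z, s))).
Proof.
apply/(weak_derivP T0 _ (@wYz z)); split.
  apply: continuous_L2; apply: continuous_subspaceT.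
  exact: (continuous_section z (@cvf)).
by move=> i t tT; rewrite eY// state_initial.
Qed.

Lemma state_H1 z : H1 0 T (state z).
Proof. exact: (weak_deriv_H1 (@wYz z) (state_weak_deriv z)). Qed.

(** The squared norm, because this is an integral of a jointly continuous
    function. *)
Definition state_energy (z : Z) : R := H1norm 0 T (state z) ^+ 2.

Lemma state_energy_continuous : continuous state_energy.
Proof.
have E z : state_energy z =
    \int[mu]_(t in `]0, T[) (enorm (trunc_field (z.1, t) (Y (z, t))) ^+ 2) +
    \int[mu]_(t in `]0, T[) (enorm (Y (z, t)) ^+ 2).
  rewrite -!sqr_L2norm; exact: (sqr_H1norm T0 (@wYz z) (state_weak_deriv z)).
rewrite (funext E) => z.
have csq (h : Z * R -> 'cV[R]_n) : continuous h ->
    continuous (fun w => enorm (h w) ^+ 2).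
  by move=> ch w; apply: cvgM; exact: enorm_continuous.
have c1 := continuous_horizon_Rintegral T0 (csq _ (@cvf)).
have c2 := continuous_horizon_Rintegral T0 (csq _ cY).
by apply: cvgD; [exact: (c1 z)|exact: (c2 z)].
Qed.

Lemma in_Yad_ball (y : R -> 'cV[R]_n) : in_Yad P M y ->
  forall t, 0 <= t <= T -> enorm (y t) <= rad.
Proof.
move=> [hy yM] t tT; have M20 : 0 < 2 * M by rewrite mulr_gt0.
by have := H1_sup_le T0 hy M20 yM tT; rewrite /rad /Mhat mulrA.
Qed.

Lemma control_netE th (y : R -> 'cV[R]_n) t : 0 <= t <= T ->
  control_net P V th y t = net_control P V (th, t) (y t).
Proof.
by move=> tT; rewrite /control_net /feedback_net /feedback /net_control /gain
  /net_grad/= clamp_id.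
Qed.

Lemma closed_loopE th (y : R -> 'cV[R]_n) t : 0 <= t <= T ->
  dyn_f P t (y t) + dyn_g P t (y t) *m control_net P V th y t =
  net_field P V (th, t) (y t).
Proof. by move=> tT; rewrite control_netE// /net_field /drift /gain/= clamp_id. Qed.

Let oo_cc t : 0 < t < T -> 0 <= t <= T.
Proof. by move=> /andP[/ltW -> /ltW ->]. Qed.

Lemma state_feasible z : (forall t, 0 <= t <= T -> enorm (Y (z, t)) <= rad) ->
  state_eq P 0 z.2 (control_net P V z.1 (state z)) (state z).
Proof.
move=> Yr; split; [exact: state_H1| |exact: state_initial].
apply: (eq_weak_deriv (fun _ _ => erefl) _ (state_weak_deriv z)) => t /oo_cc tT.
rewrite (closed_loopE _ _ tT) /trunc_field radial_id; first by [].
exact: Yr.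
Qed.

(** In [in_Yad] the truncation is inactive, so an admissible closed-loop
    trajectory is the one of the truncated equation. *)
Lemma state_unique th y0 (y : R -> 'cV[R]_n) : in_Yad P M y ->
  state_eq P 0 y0 (control_net P V th y) y ->
  forall t, 0 <= t <= T -> y t = Y ((th, y0), t).
Proof.
move=> yad [[wy _ _] yw yi] t tT.
have [L2v pv] := (weak_derivP T0 _ wy).1 yw.
have cK : compact ([set th] `*` `[0, T]%classic).
  by apply: compact_setX; [exact: compact_set1|exact: segment_compact].
have [L L0 HL] := trunc_field_lipschitz cK.
have cyc := continuous_clamp_within (ltW T0) wy.
have := @volterra_stability R T (past T) T0 (past_family T0) n
  (fun t => y (clamp T t)) (fun t => Y ((th, y0), t)) (fun=> y0) (fun=> y0)
  (fun t => dyn_f P t (y t) + dyn_g P t (y t) *m control_net P V th y t)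
  (fun s => trunc_field (th, s) (Y ((th, y0), s))) L 0 0 L0 (lexx 0) (lexx 0)
  cyc (@cYz _).
rewrite mul0r addr0 mulr0 mul0r => stab.
have : `|y (clamp T t) - Y ((th, y0), t)| <= 0.
  apply: stab => //.
  - by move=> i; exact: L2_integrable.
  - move=> i; apply: continuous_integrable_oo; apply: continuous_subspaceT.
    apply: entry_continuous; exact: (continuous_section (th, y0) (@cvf)).
  - by move=> s i sT; rewrite /past clamp_id// pv// yi.
  - by move=> s i sT; rewrite /past clamp_id// eY.
  - by move=> s _; rewrite subrr normr0.
  - move=> s /oo_cc sT; rewrite add0r closed_loopE// clamp_id//.
    rewrite -(radial_id (in_Yad_ball yad sT)).
    rewrite {2}(radial_id (in_Yad_ball yad sT)).
    by apply: HL; split => //=; rewrite in_itv.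
by rewrite clamp_id// normr_le0 subr_eq0 => /eqP.
Qed.

Local Notation B1 := ((Q1 P)^T *m Q1 P).
Local Notation B2 := ((Q2 P)^T *m Q2 P).

Definition state_adjoint_mx (w : Z * R) : 'M[R]_n :=
  adjoint_mx P V (w.1.1, w.2) (Y w).

Lemma state_adjoint_mx_continuous : continuous state_adjoint_mx.
Proof.
apply: (@continuous_compose _ _ _ (fun w : Z * R => ((w.1.1, w.2), Y w))
  (fun a : X * 'cV[R]_n => adjoint_mx P V a.1 a.2)).
  exact: continuous_pair.
exact: adjoint_mx_continuous.
Qed.

Let res_integrable z i :
  mu.-integrable `]0, T[ (EFin \o (fun s => (B1 *m (Y (z, s) - yd P s)) i ord0)).
Proof.
apply: L2_integrable; apply: L2_mulmx; apply: L2B => //.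
exact: continuous_L2 (@wYz z).
Qed.

Lemma continuous_mulmxl (W : topologicalType) p q s (A : 'M[R]_(p, q))
    (F : W -> 'M[R]_(q, s)) : continuous F -> continuous (fun w => A *m F w).
Proof.
by move=> cF; apply: mulmx_continuous => // w; exact: cst_continuous.
Qed.

(** The adjoint equation is linear in the costate, hence globally Lipschitz as it
    stands. Its source contains the desired state, which is only integrable:
    the source is integrated first and enters the Volterra equation through its
    continuous inhomogeneity. *)
Lemma adjoint_family : exists2 Q : Z * R -> 'cV[R]_n, continuous Q &
  forall z t i, 0 <= t <= T -> Q (z, t) i ord0 =
    (B2 *m (Y (z, T) - ydT P)) i ord0 +
    \int[mu]_(s in `]t, T[) (state_adjoint_mx (z, s) *m Q (z, s) +
                             B1 *m (Y (z, s) - yd P s)) i ord0.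
Proof.
have fam := future_family T0.
pose c (w : Z * R) : 'cV[R]_n := \col_i ((B2 *m (Y (w.1, T) - ydT P)) i ord0 +
  \int[mu]_(s in future T w.2) (B1 *m (Y (w.1, s) - yd P s)) i ord0).
have cc : continuous c.
  apply: mx_continuous => i j.
  pose c1 (w : Z * R) := \int[mu]_(s in future T w.2)
    ((B1 *m Y (w.1, s)) i ord0 * 1).
  pose c2 (w : Z * R) := \int[mu]_(s in future T w.2)
    (1 * (B1 *m yd P s) i ord0).
  have I1 : mu.-integrable `]0, T[ (EFin \o (fun=> 1 : R)).
    by apply: continuous_integrable_oo => t; exact: cvg_cst.
  have Id : mu.-integrable `]0, T[ (EFin \o (fun s => (B1 *m yd P s) i ord0)).
    by apply: L2_integrable; exact: L2_mulmx.
  have cBY : continuous (fun w => (B1 *m Y w) i ord0).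
    by apply: entry_continuous; exact: continuous_mulmxl.
  rewrite (_ : (fun w => _) = fun w : Z * R =>
      (B2 *m (Y (w.1, T) - ydT P)) i ord0 + (c1 w - c2 w)); last first.
    apply/funext => w; rewrite mxE; congr (_ + _).
    case: fam => mJ sJ _ _.
    have IJ (f : R -> R) : mu.-integrable `]0, T[ (EFin \o f) ->
        mu.-integrable (future T w.2) (EFin \o f).
      by move=> If; apply: integrableS If => //; exact: sJ.
    rewrite /c1 /c2 -RintegralB//; last 2 first.
    - apply: IJ; rewrite (_ : EFin \o _ = EFin \o (fun s => (B1 *m Y (w.1, s)) i ord0)).
        apply: continuous_integrable_oo; apply: continuous_subspaceT.
        exact: (continuous_section w.1 cBY).
      by apply/funext => s /=; rewrite mulr1.
    - apply: IJ; rewrite (_ : EFin \o _ = EFin \o (fun s => (B1 *m yd P s) i ord0)) //.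
      by apply/funext => s /=; rewrite mul1r.
    apply: eq_Rintegral => s _.
    by rewrite mulr1 mul1r mulmxBr mxE [X in _ + X]mxE.
  move=> w; apply: cvgD.
    have cYT : continuous (fun w : Z * R => B2 *m (Y (w.1, T) - ydT P)).
      apply: continuous_mulmxl; apply: mx_continuousB; last first.
        by move=> x; exact: cst_continuous.
      apply: (@continuous_compose _ _ _ (fun w : Z * R => (w.1, T)) Y) => //.
      apply: continuous_pair; first exact: continuous_fst.
      by move=> x; exact: cst_continuous.
    exact: (@entry_continuous _ _ _ _ _ i ord0 cYT w).
  apply: cvgB; first exact: (continuous_time_Rintegral fam cBY I1 w).
  apply: (@continuous_time_Rintegral _ _ _ _ (fun=> 1) _ fam) => //.
  by move=> x; exact: cst_continuous.
have [||z|Q cQ eQ] := @volterra_param R T (future T) T0 fam n Z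
   (fun w => state_adjoint_mx w.1 *m w.2) c.
- apply: mulmx_continuous; last exact: continuous_snd.
  apply: continuous_compose; first exact: continuous_fst.
  exact: state_adjoint_mx_continuous.
- exact: cc.
- have cA := @state_adjoint_mx_continuous.
  have [C C0 HC] := compact_norm_bounded (@segment_compact R 0 T)
    (continuous_section z cA).
  exists (n%:R * (1 + C)) => [|]; first by rewrite mulr_ge0// addr_ge0.
  have := tube_lemma (@segment_compact R 0 T) cA z (@ltr01 R).
  apply: filterS => z' H s x x' sT; rewrite /= -mulmxBr.
  rewrite (le_trans (norm_mulmx _ _))// ler_wpM2r// ler_wpM2l//.
  have sT' : `[0, T]%classic s by rewrite /= in_itv.
  rewrite -(subrK (state_adjoint_mx (z, s)) (state_adjoint_mx (z', s))).
  by rewrite (le_trans (ler_normD _ _))// lerD ?H ?HC.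
exists Q => // z t i tT; rewrite eQ//= /c mxE -addrA; congr (_ + _).
rewrite /future clamp_id//; have /andP[t0 tT'] := tT.
rewrite -RintegralD//; last 2 first.
- by apply: (@integrable_sub_oo _ T) => //; exact: res_integrable.
- apply: (@integrable_sub_oo _ T) => //; apply: continuous_integrable_oo.
  apply: continuous_subspaceT; apply: entry_continuous.
  apply: mulmx_continuous; last exact: continuous_section.
  exact: (continuous_section z (@state_adjoint_mx_continuous)).
by apply: eq_Rintegral => s _; rewrite addrC [RHS]mxE.
Qed.

Variable Q : Z * R -> 'cV[R]_n.
Hypothesis cQ : continuous Q.
Hypothesis eQ : forall z t i, 0 <= t <= T -> Q (z, t) i ord0 =
    (B2 *m (Y (z, T) - ydT P)) i ord0 +
    \int[mu]_(s in `]t, T[) (state_adjoint_mx (z, s) *m Q (z, s) +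
                             B1 *m (Y (z, s) - yd P s)) i ord0.

Local Notation costate z := (fun t => Q (z, t)).

Definition adjoint_rhs (z : Z) (s : R) : 'cV[R]_n :=
  state_adjoint_mx (z, s) *m Q (z, s) + B1 *m (Y (z, s) - yd P s).

Let cQz z : continuous (costate z).
Proof. exact: continuous_section. Qed.

Let wQz z : {within `[0, T], continuous (costate z)}.
Proof. by apply: continuous_subspaceT; exact: cQz. Qed.

Let cAQ : continuous (fun w => state_adjoint_mx w *m Q w).
Proof. by apply: mulmx_continuous => //; exact: state_adjoint_mx_continuous. Qed.

Let adjoint_rhs_L2 z : L2 0 T (adjoint_rhs z).
Proof.
apply: L2D.
  apply: continuous_L2; apply: continuous_subspaceT.
  exact: (continuous_section z (@cAQ)).
by apply: L2_mulmx; apply: L2B => //; exact: continuous_L2 (@wYz z).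
Qed.

Lemma costate_terminal z : Q (z, T) = B2 *m (Y (z, T) - ydT P).
Proof.
have TT : 0 <= T <= T by rewrite lexx ltW.
apply/colP => i; rewrite eQ//.
by rewrite (@set_itv_ge _ _ (BRight T) (BLeft T)) ?bnd_simp// Rintegral_set0 addr0.
Qed.

Lemma costate_weak_deriv z :
  weak_deriv 0 T (costate z) (fun s => - adjoint_rhs z s).
Proof.
have Lr := adjoint_rhs_L2 z.
apply/(weak_derivP T0 _ (@wQz z)); split.
  rewrite (_ : (fun s => _) = fun s => (-1) *: adjoint_rhs z s); first exact: L2Z.
  by apply/funext => s; rewrite scaleN1r.
move=> i t /[dup] tT /andP[t0 tT']; rewrite (eQ z i tT) (eQ z i T00).
have Ir := L2_integrable i Lr.
rewrite -/(adjoint_rhs z) (Rintegral_oo_split tT Ir) -addrA; congr (_ + _).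
rewrite [X in _ = _ + X](_ : _ = - \int[mu]_(s in `]0, t[) adjoint_rhs z s i ord0).
  by rewrite addrAC subrr add0r.
rewrite -mulN1r -RintegralZl//; last exact: (@integrable_sub_oo _ T).
by apply: eq_Rintegral => s _; rewrite mxE mulN1r.
Qed.

Let adjoint_eqE th (y p : R -> 'cV[R]_n) s : 0 <= s <= T ->
  (jac (dyn_f P s) (y s))^T *m p s +
    adjoint_coupling P s (y s) (control_net P V th y s) (p s) =
  adjoint_mx P V (th, s) (y s) *m p s.
Proof. by move=> sT; rewrite control_netE// adjoint_mxE/= clamp_id. Qed.

Lemma costate_feasible z :
  adjoint_eq P (control_net P V z.1 (state z)) (state z) (costate z).
Proof.
split; [|  |exact: costate_terminal].
  exact: (weak_deriv_H1 (@wQz z) (costate_weak_deriv z)).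
apply: eq_weak_deriv (costate_weak_deriv z) => // t /oo_cc tT.
have := @adjoint_eqE z.1 (state z) (costate z) t tT.
by rewrite /adjoint_rhs /state_adjoint_mx/= => ->.
Qed.

Lemma costate_unique z (y p : R -> 'cV[R]_n) :
  (forall t, 0 <= t <= T -> y t = Y (z, t)) ->
  adjoint_eq P (control_net P V z.1 y) y p ->
  forall t, 0 <= t <= T -> p t = Q (z, t).
Proof.
move=> yY [[wp _ _] pw pT] t tT.
have TT : 0 <= T <= T by rewrite lexx ltW.
pose r s := state_adjoint_mx (z, s) *m p s + B1 *m (Y (z, s) - yd P s).
have {}pw : weak_deriv 0 T p (fun s => - r s).
  apply: eq_weak_deriv pw => // s /oo_cc sT.
  by rewrite (adjoint_eqE z.1 y p sT) /r /state_adjoint_mx/= yY.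
have [Lnr pr] := (weak_derivP T0 _ wp).1 pw.
have Lr : L2 0 T r.
  rewrite (_ : r = fun s => (-1) *: - r s); first exact: L2Z.
  by apply/funext => s; rewrite scaleN1r opprK.
have pr' s i : 0 <= s <= T -> p s i ord0 =
    (B2 *m (Y (z, T) - ydT P)) i ord0 + \int[mu]_(x in `]s, T[) r x i ord0.
  move=> sT; rewrite -yY// -pT (pr i s sT) (pr i T TT).
  have Ir := L2_integrable i Lr; have In := L2_integrable i Lnr.
  rewrite (Rintegral_oo_split sT In) -!addrA; congr (_ + _).
  have /andP[s0 _] := sT.
  rewrite -[LHS]addr0; congr (_ + _).
  rewrite -RintegralD//; [|exact: (@integrable_sub_oo _ T)..].
  rewrite -[LHS](mul0r (fine (mu `]s, T[%classic))) -Rintegral_cst//.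
  by apply: eq_Rintegral => x _; rewrite mxE addNr.
have cA := @state_adjoint_mx_continuous.
have [C C0 HC] := compact_norm_bounded (@segment_compact R 0 T)
  (continuous_section z cA).
have cpc := continuous_clamp_within (ltW T0) wp.
have nC0 : 0 <= n%:R * C by rewrite mulr_ge0.
have := @volterra_stability R T (future T) T0 (future_family T0) n
  (fun t => p (clamp T t)) (costate z)
  (fun=> B2 *m (Y (z, T) - ydT P)) (fun=> B2 *m (Y (z, T) - ydT P))
  r (adjoint_rhs z) (n%:R * C) 0 0 nC0 (lexx 0) (lexx 0) cpc (@cQz _).
rewrite mul0r addr0 mulr0 mul0r => stab.
have : `|p (clamp T t) - Q (z, t)| <= 0.
  apply: stab => //.
  - by move=> i; exact: L2_integrable.
  - by move=> i; apply: L2_integrable; exact: adjoint_rhs_L2.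
  - by move=> s i sT; rewrite /future clamp_id// pr'.
  - by move=> s i sT; rewrite /future clamp_id// eQ.
  - by move=> s _; rewrite subrr normr0.
  - move=> s /oo_cc sT; rewrite add0r clamp_id// /r /adjoint_rhs.
    rewrite opprD addrACA subrr addr0 -mulmxBr.
    rewrite (le_trans (norm_mulmx _ _))// ler_wpM2r// ler_wpM2l//.
    by apply: HC; rewrite /= in_itv.
by rewrite clamp_id// normr_le0 subr_eq0 => /eqP.
Qed.

End trajectories.

(** * Continuity of costs and of solution families *)

Section costs.
Context {R : realType} {n m k : nat}.
Local Notation mu := (@lebesgue_measure R).
Variables (P : ocp R n m) (V : 'cV[R]_k -> R -> 'cV[R]_n -> R) (gamma1 gamma2 : R).
Local Notation T := (horizon P).
Local Notation X := ('cV[R]_k * R)%type.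
Local Notation Z := ('cV[R]_k * 'cV[R]_n)%type.

Lemma cost_ge0 t y u : 0 < beta P -> 0 <= cost P t y u.
Proof.
move=> b0; rewrite /cost /terminal_cost addr_ge0// mulr_ge0// ?sqr_ge0//.
apply: Rintegral_ge0 => s _.
by rewrite addr_ge0 ?sqr_ge0// mulr_ge0 ?sqr_ge0// ltW.
Qed.

Lemma cost_net_ge0 y p th : 0 < beta P -> 0 <= gamma1 -> 0 <= gamma2 ->
  0 <= cost_net P gamma1 gamma2 V y p th.
Proof.
move=> b0 g1 g2; rewrite /cost_net addr_ge0 ?cost_ge0//.
apply: Rintegral_ge0 => s _.
by rewrite addr_ge0// mulr_ge0 ?sqr_ge0// divr_ge0.
Qed.

Lemma eq_cost t y y' u u' : 0 <= t <= T ->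
  (forall s, 0 <= s <= T -> y s = y' s) ->
  (forall s, 0 <= s <= T -> u s = u' s) ->
  cost P t y u = cost P t y' u'.
Proof.
move=> /andP[t0 tT] yy uu; rewrite /cost yy ?lexx ?(le_trans t0)//.
congr (_ * _ + _); apply: eq_Rintegral => s; rewrite inE/= in_itv/=.
move=> /andP[ts sT]; have s0T : 0 <= s <= T.
  by rewrite (ltW sT) (le_trans t0)// ltW.
by rewrite yy// uu.
Qed.

Lemma eq_cost_net y y' p p' th : 0 < T ->
  (forall s, 0 <= s <= T -> y s = y' s) ->
  (forall s, 0 <= s <= T -> p s = p' s) ->
  cost_net P gamma1 gamma2 V y p th = cost_net P gamma1 gamma2 V y' p' th.
Proof.
move=> T0 yy pp.
have uu s : 0 <= s <= T -> control_net P V th y s = control_net P V th y' s.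
  by move=> sT; rewrite /control_net yy.
have T00 : 0 <= (0 : R) <= T by rewrite lexx ltW.
rewrite /cost_net; apply: (congr2 +%R (eq_cost T00 yy uu)).
apply: eq_Rintegral => s; rewrite inE/= in_itv/= => /andP[/ltW s0 /ltW sT].
have s0T : 0 <= s <= T by rewrite s0.
by rewrite (eq_cost s0T yy uu) yy// pp.
Qed.

Hypothesis T0 : 0 < T.
Hypothesis hyd : L2 0 T (yd P).
Hypothesis hA1 : regular_dynamics P.
Hypothesis hVC : Ck_on 4 setT (fun x : 'cV[R]_k * R * 'cV[R]_n => V x.1.1 x.1.2 x.2).
Variables Y Q : Z * R -> 'cV[R]_n.
Hypothesis cY : continuous Y.
Hypothesis cQ : continuous Q.

Local Notation state z := (fun t => Y (z, t)).
Local Notation costate z := (fun t => Q (z, t)).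

Let sqr_continuous (W : topologicalType) (h : W -> R) : continuous h ->
  continuous (fun w => h w ^+ 2).
Proof. by move=> ch w; apply: cvgM; exact: ch. Qed.

Let scale_continuous (W : topologicalType) (a : R) (h : W -> R) : continuous h ->
  continuous (fun w => a * h w).
Proof. by move=> ch w; apply: cvgM; [exact: cvg_cst|exact: ch]. Qed.

Let add_continuous (W : topologicalType) (h g : W -> R) : continuous h ->
  continuous g -> continuous (fun w => h w + g w).
Proof. by move=> ch cg w; apply: cvgD; [exact: ch|exact: cg]. Qed.

Let sub_continuous (W : topologicalType) (h g : W -> R) : continuous h ->
  continuous g -> continuous (fun w => h w - g w).
Proof. by move=> ch cg w; apply: cvgB; [exact: ch|exact: cg]. Qed.

Let cxy : continuous (fun w : Z * R => ((w.1.1, w.2), Y w)).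
Proof.
apply: continuous_pair => //; apply: continuous_pair; last exact: continuous_snd.
by apply: continuous_compose; [exact: continuous_fst|exact: continuous_fst].
Qed.

Let cu : continuous (fun w : Z * R => net_control P V (w.1.1, w.2) (Y w)).
Proof.
exact: (continuous_compose (@cxy) (@net_control_continuous _ _ _ _ _ _ T0 hA1 hVC)).
Qed.

Let cg : continuous (fun w : Z * R => net_grad V (w.1.1, w.2) (Y w)).
Proof.
exact: (continuous_compose (@cxy) (@net_grad_continuous _ _ _ _ hVC)).
Qed.

Let cv : continuous (fun w : Z * R => V w.1.1 w.2 (Y w)).
Proof.
exact: (continuous_compose (@cxy) (@net_value_continuous _ _ _ _ hVC)).
Qed.

Let at_horizon : continuous (fun w : Z * R => (w.1, T)).
Proof.
apply: continuous_pair; first exact: continuous_fst.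
by move=> x; exact: cst_continuous.
Qed.

(** The data [yd] are merely square integrable; expanding the square leaves
    integrals of a jointly continuous function against a fixed integrable one. *)
Lemma tail_cost_family : exists2 J : Z * R -> R, continuous J &
  forall z t, 0 <= t <= T ->
    cost P t (state z) (control_net P V z.1 (state z)) = J (z, t).
Proof.
have fam := future_family T0.
pose h1 (w : Z * R) := \sum_i (Q1 P *m Y w) i ord0 ^+ 2 +
  beta P * enorm (net_control P V (w.1.1, w.2) (Y w)) ^+ 2.
pose h2 i (w : Z * R) := 2 * (Q1 P *m Y w) i ord0.
pose d i s := (Q1 P *m yd P s) i ord0.
pose dd s := \sum_i d i s ^+ 2.
have cQY i : continuous (fun w => (Q1 P *m Y w) i ord0).
  by apply: entry_continuous; exact: continuous_mulmxl.
have ch1 : continuous h1.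
  apply: add_continuous; first by apply: continuous_sumr => i _; exact: sqr_continuous.
  apply: scale_continuous; apply: sqr_continuous; apply: enorm_continuous.
  exact: cu.
have ch2 i : continuous (h2 i) by exact: scale_continuous.
have Ld : L2 0 T (fun s => Q1 P *m yd P s) by exact: L2_mulmx.
have Id i : mu.-integrable `]0, T[ (EFin \o d i) by exact: L2_integrable i Ld.
have Idd : mu.-integrable `]0, T[ (EFin \o dd).
  by apply: integrable_EFin_sum => // i; have [_] := Ld i.
have I1 : mu.-integrable `]0, T[ (EFin \o (fun=> 1 : R)).
  by apply: continuous_integrable_oo => t; exact: cvg_cst.
have c1 : continuous (fun _ : Z * R => 1 : R).
  by move=> x; exact: cst_continuous.
pose A (w : Z * R) := \int[mu]_(s in future T w.2) (h1 (w.1, s) * 1).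
pose B i (w : Z * R) := \int[mu]_(s in future T w.2) (h2 i (w.1, s) * d i s).
pose C (w : Z * R) := \int[mu]_(s in future T w.2) (1 * dd s).
exists (fun w => 2^-1 * ((A w - \sum_i B i w) + C w) +
    2^-1 * enorm (Q2 P *m (Y (w.1, T) - ydT P)) ^+ 2).
  apply: add_continuous; apply: scale_continuous.
    apply: add_continuous.
      apply: sub_continuous; first exact: (continuous_time_Rintegral fam ch1 I1).
      apply: continuous_sumr => i _.
      exact: (continuous_time_Rintegral fam (@ch2 i) (Id i)).
    exact: (continuous_time_Rintegral fam c1 Idd).
  apply: sqr_continuous; apply: enorm_continuous; apply: continuous_mulmxl.
  apply: mx_continuousB; last by move=> x; exact: cst_continuous.
  exact: (continuous_compose (@at_horizon) cY).
move=> z t /[dup] tT /andP[t0 tT']; rewrite /cost /terminal_cost/=.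
congr (_ * _ + _).
have sub (f : R -> R) : mu.-integrable `]0, T[ (EFin \o f) ->
    mu.-integrable `]t, T[ (EFin \o f) by exact: integrable_sub_oo.
have Icz (h : Z * R -> R) (w : R -> R) : continuous h ->
    mu.-integrable `]0, T[ (EFin \o w) ->
    mu.-integrable `]0, T[ (EFin \o (fun s => h (z, s) * w s)).
  move=> ch Iw; have chz := continuous_section z ch.
  have [K K0 hK] := compact_norm_bounded (@segment_compact R 0 T) chz.
  apply: (@integrable_EFinM _ _ _ _ _ _ _ _ K) => //.
    exact: continuous_measurable.
  by move=> s sT; apply: hK; exact: subset_itv_oo_cc sT.
rewrite /A /B /C /future !clamp_id//=.
rewrite -Rintegral_sum//; last by move=> i; apply: sub; exact: Icz.
rewrite -RintegralB//; last 2 first.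
- by apply: sub; exact: Icz.
- by apply: integrable_EFin_sum => // i; apply: sub; exact: Icz.
rewrite -RintegralD//; last 2 first.
- apply: integrable_EFinB => //; first by apply: sub; exact: Icz.
  by apply: integrable_EFin_sum => // i; apply: sub; exact: Icz.
- by apply: sub; apply: (Icz (fun=> 1)).
apply: eq_Rintegral => s; rewrite inE/= in_itv/= => /andP[ts sT].
have s0T : 0 <= s <= T by rewrite (ltW sT) (le_trans t0)// ltW.
have -> : enorm (Q1 P *m (Y (z, s) - yd P s)) ^+ 2 =
    \sum_i (Q1 P *m Y (z, s)) i ord0 ^+ 2 - \sum_i h2 i (z, s) * d i s + dd s.
  rewrite sqr_enorm_cV /dd -sumrB -big_split/=; apply: eq_bigr => i _.
  rewrite mulmxBr mxE [X in _ + X]mxE /h2 /d.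
  by move: (_ i ord0) (_ i ord0) => a b; rewrite /=; ring.
rewrite control_netE// mulr1 mul1r /h1/=.
have arith (a b c e : R) : a - b + c + e = a + e - b + c by ring.
exact: arith.
Qed.

Lemma net_cost_continuous :
  continuous (fun z => cost_net P gamma1 gamma2 V (state z) (costate z) z.1).
Proof.
have [J cJ JE] := tail_cost_family.
pose h (w : Z * R) := gamma1 / 2 * `|V w.1.1 w.2 (Y w) - J w| ^+ 2 +
  gamma2 / 2 * enorm (net_grad V (w.1.1, w.2) (Y w) - Q w) ^+ 2.
have ch : continuous h.
  apply: add_continuous; apply: scale_continuous; apply: sqr_continuous.
    move=> w; apply: cvg_norm; apply: sub_continuous => //.
  apply: enorm_continuous; apply: mx_continuousB => //.
have T00 : 0 <= (0 : R) <= T by rewrite lexx ltW.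
have E z : cost_net P gamma1 gamma2 V (state z) (costate z) z.1 =
    J (z, 0) + \int[mu]_(t in `]0, T[) h (z, t).
  rewrite /cost_net JE//; congr (_ + _); apply: eq_Rintegral => t.
  rewrite inE/= in_itv/= => /andP[/ltW t0 /ltW tT].
  by rewrite JE ?t0.
rewrite (funext E); apply: add_continuous.
  apply: (continuous_compose _ cJ); apply: continuous_pair => z.
    exact: cvg_id.
  exact: cst_continuous.
exact: (continuous_horizon_Rintegral T0 ch).
Qed.

End costs.

Section continuous_families.
Context {R : realType} {n m : nat} (P : ocp R n m) (Y0 : set 'cV[R]_n).
Local Notation T := (horizon P).
Hypothesis T0 : 0 < T.

(** The summand [b], common to all derivatives, cancels in differences. It is
    there for the costate, to whose derivative the desired state contributes a
    term that is merely square integrable. *)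
Lemma continuous_in_CY0W (y v : 'cV[R]_n * R -> 'cV[R]_n) (b : R -> 'cV[R]_n) :
  continuous y -> continuous v ->
  (forall y0, weak_deriv 0 T (fun t => y (y0, t)) (fun t => v (y0, t) + b t)) ->
  in_CY0W P Y0 (fun y0 t => y (y0, t)).
Proof.
move=> cy cv yv.
have wy y0 : {within `[0, T], continuous (fun t => y (y0, t))}.
  by apply: continuous_subspaceT; exact: continuous_section.
split=> [y0 _|y0 _ e e0]; first exact: (weak_deriv_H1 (wy y0) (yv y0)).
pose a := n%:R * T; have a0 : 0 <= a by rewrite mulr_ge0// ltW.
pose eta := e / (2 * a + 1).
have den0 : 0 < 2 * a + 1 by rewrite ltr_wpDl// mulr_ge0.
have eta0 : 0 < eta by rewrite divr_gt0.
(* [eta] satisfies [2 * a * eta ^+ 2 < e ^+ 2], and [a * eta ^+ 2] bounds each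
   of the two L^2 terms of the squared norm. *)
have ty := tube_lemma (@segment_compact R 0 T) cy y0 eta0.
have tv := tube_lemma (@segment_compact R 0 T) cv y0 eta0.
have /nbhs_ballP[d /= d0 Hd] : \forall z0 \near y0,
    (forall t, `[0, T]%classic t -> `|y (z0, t) - y (y0, t)| <= eta) /\
    (forall t, `[0, T]%classic t -> `|v (z0, t) - v (y0, t)| <= eta).
  exact: filterI ty tv.
exists d => // z0 _ zd.
have [|Hy Hv] := Hd z0.
  rewrite -ball_normE /ball_/= distrC (le_lt_trans _ zd)//.
  exact: norm_le_enorm.
have cdy : {within `[0, T], continuous (fun t => y (z0, t) - y (y0, t))}.
  by move=> t; apply: cvgB; [exact: wy|exact: wy].
have wd : weak_deriv 0 T (fun t => y (z0, t) - y (y0, t))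
    (fun t => v (z0, t) - v (y0, t)).
  apply: eq_weak_deriv (weak_derivB T0 (wy z0) (wy y0) (yv z0) (yv y0)) => // t _.
  by rewrite opprD addrACA subrr addr0.
have Ly : L2 0 T (fun t => y (z0, t) - y (y0, t)) by exact: continuous_L2.
have Lv : L2 0 T (fun t => v (z0, t) - v (y0, t)) by case: wd.
have b1 := L2norm_le_sup T0 Ly (ltW eta0).
have b2 := L2norm_le_sup T0 Lv (ltW eta0).
have oocc t : 0 < t < T -> `[0, T]%classic t.
  by move=> /andP[/ltW t0 /ltW tT]; rewrite /= in_itv/= t0.
have {}b1 := b1 (fun t tT => Hy t (oocc t tT)).
have {}b2 := b2 (fun t tT => Hv t (oocc t tT)).
have concl (h l1 l2 : R) : 0 <= h -> h ^+ 2 = l1 + l2 ->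
    l1 <= n%:R * eta ^+ 2 * T -> l2 <= n%:R * eta ^+ 2 * T -> h < e.
  move=> h0 hE h1 h2; rewrite -(@ltr_pXn2r _ 2)// ?nnegrE ?(ltW e0)// hE.
  rewrite (@le_lt_trans _ _ (2 * a * eta ^+ 2))//.
    by rewrite (le_trans (lerD h1 h2))// /a le_eqVlt; apply/orP; left; apply/eqP; ring.
  rewrite /eta expr_div_n mulrA ltr_pdivrMr ?exprn_gt0//.
  rewrite mulrC ltr_pM2l ?exprn_gt0//.
  by apply: ltr_sqrD1; rewrite mulr_ge0.
exact: (concl _ _ _ (H1norm_ge0 _ _) (sqr_H1norm T0 cdy wd) b2 b1).
Qed.

End continuous_families.

(** * Feasibility of accurate approximations *)

(** The norm of a constant function is controlled by its value. Positivity is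
    needed for the ball of radius [2 * Mhat] to have interior points, so that
    derivatives relative to it are unique. *)
Lemma embedding_norm_gt0 (R : realType) (n : nat) (T : R) : 0 < T -> (0 < n)%N ->
  0 < embedding_norm 0 T n.
Proof.
case: n => // n T0 _; pose v := unit_vec ord0 : 'cV[R]_n.+1.
have cv : {within `[0, T], continuous (fun=> v)} by move=> t; exact: cvg_cst.
have w0 : weak_deriv 0 T (fun=> v) (fun=> 0).
  apply/(weak_derivP T0 _ cv); split; first by apply: continuous_L2 => t; exact: cvg_cst.
  move=> i t _; rewrite (_ : (fun s => _) = fun=> 0); last first.
    by apply/funext => s; rewrite mxE.
  by rewrite Rintegral_cst//= mul0r addr0.
have hv := weak_deriv_H1 cv w0.
have r0 : 0 < H1norm 0 T (fun=> v) + 1 by rewrite ltr_wpDl ?H1norm_ge0.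
have T00 : 0 <= (0 : R) <= T by rewrite lexx ltW.
have rle : H1norm 0 T (fun=> v) <= H1norm 0 T (fun=> v) + 1 by rewrite lerDl.
have := H1_sup_le T0 hv r0 rle T00.
have v1 : 1 <= enorm v.
  by rewrite (le_trans _ (entry_le_enorm _ ord0 ord0))// mxE eqxx normr1.
move=> /(le_trans v1)/(lt_le_trans ltr01).
by rewrite pmulr_rgt0.
Qed.

Section uniform_feasibility.
Context {R : realType} {n m : nat}.
Local Notation mu := (@lebesgue_measure R).
Variables (P : ocp R n m) (M : R).
Local Notation T := (horizon P).
Local Notation B := (big_ball P M).
Local Notation rad := (2 * Mhat P M).
Hypothesis T0 : 0 < T.
Hypothesis M0 : 0 < M.
Hypothesis hA1 : regular_dynamics P.
Hypothesis hA2 : regular_value P M.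

Local Notation G t := (grad_on B (valueR P t)).

Section gradients.
Variables (k : nat) (V : 'cV[R]_k -> R -> 'cV[R]_n -> R).
Hypothesis hVC : Ck_on 4 setT (fun x : 'cV[R]_k * R * 'cV[R]_n => V x.1.1 x.1.2 x.2).

(** The assumption bounds the gradient of the difference relative to the ball;
    as both functions are differentiable there, it is the difference of the
    gradients. *)
Lemma net_grad_close th d : approximates P M V th d ->
  forall t y, 0 <= t <= T -> B y -> enorm (net_grad V (th, t) y - G t y) <= d.
Proof.
move=> happ t y tT By; have [n0|n0] := posnP n.
  have -> : enorm (net_grad V (th, t) y - G t y) = 0.
    rewrite /enorm big1 ?sqrtr0// => i _; suff : False by [].
    by case: i => i; rewrite n0.
  by rewrite (le_trans _ (happ t y tT By))// !addr_ge0 ?enorm_ge0.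
have r0 : 0 < rad by rewrite !mulr_gt0// embedding_norm_gt0.
have idlin : linear (fun a : R^o => a : R^o) by [].
have id1 (a : R^o) : `|a : R| <= `|a| by [].
pose H1 (x : 'cV[R]_k * R * 'cV[R]_n) : R^o := V x.1.1 x.1.2 x.2.
have dV := @Ck_on_fderiv _ _ _ _ _ _ ((th, t), y) hVC I.
have dV1 := @is_fderiv_on_slice _ _ _ _ _ setT H1 idlin id1 (th, t) setT (V th t) y.
have {}dV1 := dV1 _ (fun _ _ => I) (fun _ => erefl).
rewrite setXTT in dV1; have {}dV1 := dV1 _ dV.
have [_ CV _ _] := hA2.
pose H2 (x : R * 'cV[R]_n) : R^o := valueR P x.1 x.2.
have tT' : `[0, T]%classic t by rewrite /= in_itv.
have dW := @Ck_on_fderiv _ _ _ _ _ _ (t, y) CV (conj tT' By).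
have {}dW := @is_fderiv_on_slice _ _ _ _ _ `[0, T]%classic H2 idlin id1 t B
  (valueR P t) y _ (fun _ _ => tT') (fun _ => erefl) dW.
have dVB := is_fderiv_on_sub (@subsetT _ B) dV1.
have E := grad_on_ballE r0 By (is_fderiv_onB dVB dW).
have -> : net_grad V (th, t) y - G t y =
    grad_on B (fun z => V th t z - valueR P t z) y.
  rewrite E (grad_on_ballE r0 By dW) /net_grad/=.
  apply/colP => i; rewrite !mxE; congr (_ - _).
  by have D := is_derive_fderiv (unit_vec i) dV1; rewrite derive_val.
apply: le_trans (happ t y tT By) => /=.
rewrite -addrA addrCA lerDl addr_ge0// enorm_ge0//.
Qed.

End gradients.

Variables (eps0 : R) (N : R -> nat).
Variable V : forall e : R, 'cV[R]_(N e) -> R -> 'cV[R]_n -> R.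
Variables (th : forall e, 'cV[R]_(N e)) (c : R).
Hypotheses (eps00 : 0 < eps0) (c0 : 0 < c).
Hypothesis hVC : forall e, 0 < e <= eps0 ->
  Ck_on 4 setT (fun x : 'cV[R]_(N e) * R * 'cV[R]_n => V x.1.1 x.1.2 x.2).
Hypothesis happ : forall e, 0 < e <= eps0 -> approximates P M (@V e) (th e) (c * e).

(** The constant [L] does not depend on [e]: the gradient of the network at [z]
    is first exchanged for the gradient of the value function at the same point,
    at the price [c * e], and only the latter, which is Lipschitz by assumption,
    is compared at [z] and [y]. *)
Lemma net_field_close : exists C L, [/\ 0 <= C, 0 <= L &
  forall e t y z, 0 < e <= eps0 -> 0 <= t <= T -> B y -> B z ->
    `|net_field P (@V e) (th e, t) z -
      (dyn_f P t y + dyn_g P t y *m feedback_star P M t y)| <=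
    C * e + L * `|z - y| ].
Proof.
have e0P : 0 < eps0 <= eps0 by rewrite eps00 lexx.
have Bn y : B y -> `|y| <= rad by move=> By; rewrite (le_trans (norm_le_enorm _)).
pose K : set ('cV[R]_(N eps0) * R) := [set th eps0] `*` `[0, T]%classic.
have cK : compact K by apply: compact_setX; [exact: compact_set1|exact: segment_compact].
have Kt t : 0 <= t <= T -> K (th eps0, t) by move=> tT; split => //=; rewrite in_itv.
have [Lf Lf0 HLf] := drift_lipschitz T0 hA1 cK rad.
have cg := @gain_continuous _ _ _ (N eps0) _ T0 hA1.
have cgt := trmx_continuous cg.
have Lg := gain_lipschitz T0 hA1 cK.
have [Lh Lh0 HLh] := loc_lipschitz_mulmx cK cg cgt Lg (loc_lipschitz_trmx Lg) rad.
have [Ch Ch0 HCh] := compact_param_bounded cK rad (mulmx_continuous cg cgt).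
have [Cp Cp0 HCp] := compact_param_bounded cK rad (net_grad_continuous (hVC e0P)).
have [_ _ [LG' HLG'] _] := hA2.
pose LG := `|LG'| * n%:R; pose CG := Cp + c * eps0.
have LG0 : 0 <= LG by rewrite mulr_ge0.
have CG0 : 0 <= CG by rewrite addr_ge0// mulr_ge0// ltW.
have HLG t y z : 0 <= t <= T -> B y -> B z -> `|G t z - G t y| <= LG * `|z - y|.
  move=> tT By Bz; rewrite (le_trans (norm_le_enorm _))//.
  rewrite (le_trans (HLG' t z y tT Bz By))// /LG -mulrA.
  rewrite (@le_trans _ _ (`|LG'| * enorm (z - y)))//.
    by rewrite ler_wpM2r ?enorm_ge0// ler_norm.
  by rewrite ler_wpM2l// enorm_le_norm.
have HCG t y : 0 <= t <= T -> B y -> `|G t y| <= CG.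
  move=> tT By; have := net_grad_close (hVC e0P) (happ e0P) tT By.
  move=> /(le_trans (norm_le_enorm _)) H.
  rewrite -[G t y](subKr (net_grad (@V eps0) (th eps0, t) y)).
  by rewrite (le_trans (ler_normB _ _))// lerD//; apply: HCp; [exact: Kt|exact: Bn].
pose b := `|(beta P)^-1| * n%:R; have b0 : 0 <= b by rewrite mulr_ge0.
exists (b * (Ch * c)), (Lf + b * (Ch * LG + Lh * CG)); split.
- by rewrite !mulr_ge0// ltW.
- by rewrite addr_ge0// mulr_ge0// addr_ge0// mulr_ge0.
move=> e t y z eP tT By Bz.
have clampE : clamp T t = t by rewrite clamp_id.
have KtT := Kt t tT.
have Hf := HLf _ _ _ KtT (Bn _ Bz) (Bn _ By).
have Hh := HLh _ _ _ KtT (Bn _ Bz) (Bn _ By).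
have HC := HCh _ _ KtT (Bn _ Bz).
have Hp := net_grad_close (hVC eP) (happ eP) tT Bz.
rewrite /drift /gain/= clampE in Hf Hh HC.
rewrite /net_field /net_control /feedback_star /feedback /drift /gain/= clampE.
rewrite -!scalemxAr !mulmxA.
set F := dyn_g P t z *m (dyn_g P t z)^T in Hh HC *.
set F' := dyn_g P t y *m (dyn_g P t y)^T in Hh *.
set p := net_grad _ _ _ in Hp *.
rewrite (_ : _ - _ = (dyn_f P t z - dyn_f P t y) -
    (beta P)^-1 *: (F *m (p - G t y) + (F - F') *m G t y)); last first.
  rewrite opprD addrACA; congr (_ + _).
  rewrite -scalerBr -scaleNr; congr (_ *: _).
  by rewrite mulmxBr mulmxBl addrA subrK.
rewrite (le_trans (ler_normB _ _))// normrZ.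
have Hpp : `|p - G t y| <= c * e + LG * `|z - y|.
  rewrite -(subrKA (G t z)) (le_trans (ler_normD _ _))// lerD ?HLG//.
  by rewrite (le_trans (norm_le_enorm _)).
have H1 : `|F *m (p - G t y)| <= n%:R * (Ch * (c * e + LG * `|z - y|)).
  by rewrite (le_trans (norm_mulmx _ _))// -mulrA ler_wpM2l// ler_pM.
have H2 : `|(F - F') *m G t y| <= n%:R * (Lh * `|z - y| * CG).
  by rewrite (le_trans (norm_mulmx _ _))// -mulrA ler_wpM2l// ler_pM// HCG.
have H3 := le_trans (ler_normD _ _) (lerD H1 H2).
have arith (a d x l1 l2 s : R) : 0 <= s -> a <= l1 -> d <= l2 ->
  x = l1 + s * l2 -> a + s * d <= x.
  by move=> s0 al dl ->; rewrite lerD// ler_wpM2l.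
apply: (arith _ _ _ _ _ _ (normr_ge0 _) Hf H3).
by rewrite /b; ring.
Qed.

(** The optimal closed loop stays in the half ball, and by [net_field_close]
    the network field differs from the optimal one by O(e): Gronwall's
    inequality moves the trajectory, in H^1, by O(e) uniformly in the initial
    value, which leaves it in the ball of radius [2 * M] for small [e]. *)
Lemma small_state_energy (Y0 : set 'cV[R]_n) : optimal_closed_loop P Y0 M ->
  exists2 eps1, 0 < eps1 <= eps0 & forall e, 0 < e <= eps1 ->
    forall Y : 'cV[R]_(N e) * 'cV[R]_n * R -> 'cV[R]_n, continuous Y ->
    (forall z t i, 0 <= t <= T -> Y (z, t) i ord0 = z.2 i ord0 +
      \int[mu]_(s in `]0, t[)
        trunc_field P M (@V e) (z.1, s) (Y (z, s)) i ord0) ->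
    forall y0, Y0 y0 -> state_energy P Y (th e, y0) <= (2 * M) ^+ 2.
Proof.
move=> hA3; have [C [L [C0 L0 HCL]]] := net_field_close.
have rad0 : 0 <= rad by rewrite !mulr_ge0 ?embedding_norm_ge0// ltW.
pose L' := L * (2 * n%:R); have L'0 : 0 <= L' by rewrite !mulr_ge0.
pose K1 := 2 * (C * T) * expR ((2 * L' + 1) * T).
have K10 : 0 <= K1 by rewrite !mulr_ge0 ?expR_ge0// ltW.
pose K2 := C + L' * K1; have K20 : 0 <= K2 by rewrite addr_ge0// mulr_ge0.
pose D := n%:R * K2 ^+ 2 * T + n%:R * K1 ^+ 2 * T.
have D0 : 0 <= D by rewrite addr_ge0// !mulr_ge0 ?sqr_ge0// ltW.
have D10 : 0 < D + 1 by rewrite ltr_wpDl.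
exists (Num.min eps0 (M / (D + 1))).
  by rewrite lt_min eps00 divr_gt0//= ge_min lexx.
move=> e /andP[e0]; rewrite le_min => /andP[eeps eM] Y cY eY y0 Yy0.
have eP : 0 < e <= eps0 by rewrite e0.
have [ys [[[hys yw ys0] ysM] _ _]] := hA3 y0 Yy0.
have [cys Lys _] := hys.
set vs := (X in weak_deriv _ _ _ X) in yw.
have [Lvs pvs] := (weak_derivP T0 _ cys).1 yw.
have ysB t : 0 <= t <= T -> B (ys t).
  move=> tT; have := H1_sup_le T0 hys M0 ysM tT => /le_trans; apply.
  by rewrite /Mhat mulrA ler_wpM2r ?embedding_norm_ge0// ler_peMl ?ler1n// ltW.
pose z : 'cV[R]_(N e) * 'cV[R]_n := (th e, y0).
have cYz := continuous_section z cY.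
have oocc t : 0 < t < T -> 0 <= t <= T by move=> /andP[/ltW -> /ltW ->].
have wYz : {within `[0, T], continuous (fun t => Y (z, t))}.
  by apply: continuous_subspaceT.
have yd := @state_weak_deriv _ _ _ _ P M (@V e) T0 M0 hA1 (hVC eP) Y cY eY z.
set v := (X in weak_deriv _ _ _ X) in yd.
have [Lv pv] := (weak_derivP T0 _ wYz).1 yd.
have field s : 0 <= s <= T ->
    `|v s - vs s| <= C * e + L' * `|Y (z, s) - ys s|.
  move=> sT; rewrite (le_trans (HCL e s _ _ eP sT (ysB s sT) (radial_ball rad0 _)))//.
  rewrite lerD2l -mulrA ler_wpM2l//.
  by rewrite -[in leLHS](radial_id (ysB s sT)) radial_norm_lipschitz.
have close t : 0 <= t <= T -> `|Y (z, t) - ys t| <= K1 * e.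
  move=> tT; have := @volterra_stability R T (past T) T0 (past_family T0) n
    (fun t => Y (z, t)) (fun t => ys (clamp T t)) (fun=> y0) (fun=> y0) v vs
    L' 0 (C * e) L'0 (lexx 0).
  rewrite add0r => H.
  have -> : K1 * e = 2 * (C * e * T) * expR ((2 * L' + 1) * T).
    by rewrite /K1; ring.
  have aux : Y (z, t) - ys t = Y (z, t) - ys (clamp T t) by rewrite clamp_id.
  rewrite aux; apply: H; last exact: tT.
  - by rewrite mulr_ge0// ltW.
  - exact: cYz.
  - exact: (continuous_clamp_within (ltW T0) cys).
  - by move=> i; exact: L2_integrable i Lv.
  - by move=> i; exact: L2_integrable i Lvs.
  - by move=> s i sT; rewrite eY// /past clamp_id.
  - by move=> s i sT; rewrite clamp_id// pvs// ys0 /past clamp_id.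
  - by move=> s _; rewrite subrr normr0.
  - move=> s /oocc sT; rewrite clamp_id//; exact: field.
have hY := weak_deriv_H1 wYz yd.
have := sqr_H1normB_le T0 hY hys.
have wd := weak_derivB T0 wYz cys yd yw.
have cd : {within `[0, T], continuous (fun t => Y (z, t) - ys t)}.
  by move=> t; apply: cvgB; [exact: wYz|exact: cys].
have b1 : 0 <= K1 * e by rewrite mulr_ge0// ltW.
have b2 : 0 <= K2 * e by rewrite mulr_ge0// ltW.
have n1 := L2norm_le_sup T0 (continuous_L2 cd) b1 (fun t tT => close t (oocc t tT)).
have n2 := L2norm_le_sup T0 (L2B Lv Lvs) b2.
have {}n2 : L2norm 0 T (fun t => v t - vs t) ^+ 2 <= n%:R * (K2 * e) ^+ 2 * T.
  apply: n2 => t /oocc tT; rewrite (le_trans (field t tT))//.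
  by rewrite /K2 mulrDl lerD2l -(mulrA L') ler_wpM2l// close.
have eD : 2 * (D * e ^+ 2) <= 2 * M ^+ 2.
  rewrite ler_wpM2l//; have eM' : (D + 1) * e <= M by rewrite mulrC -ler_pdivlMr.
  have sq : ((D + 1) * e) ^+ 2 <= M ^+ 2.
    by rewrite ler_pXn2r// nnegrE ?mulr_ge0// ltW.
  apply: le_trans sq; rewrite exprMn ler_wpM2r ?sqr_ge0//.
  exact/ltW/ltr_sqrD1.
have arith (h hs hd l1 l2 : R) : 0 <= hs -> hs <= M -> hd = l2 + l1 ->
    l1 <= n%:R * (K1 * e) ^+ 2 * T -> l2 <= n%:R * (K2 * e) ^+ 2 * T ->
    h <= 2 * hs ^+ 2 + 2 * hd -> h <= (2 * M) ^+ 2.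
  move=> hs0 hsM -> h1 h2 hle; apply: (le_trans hle).
  have -> : (2 * M) ^+ 2 = 2 * M ^+ 2 + 2 * M ^+ 2 by ring.
  apply: lerD; first by rewrite ler_wpM2l// ler_pXn2r// nnegrE// ltW.
  apply: le_trans eD; rewrite ler_wpM2l// (le_trans (lerD h2 h1))//.
  by rewrite le_eqVlt; apply/orP; left; apply/eqP; rewrite /D; ring.
exact: (arith _ _ _ _ _ (H1norm_ge0 _ _) ysM (sqr_H1norm T0 cd wd) n1 n2).
Qed.

End uniform_feasibility.

(** * Coercive minimisation and conditions almost everywhere *)

Section parameter_space.
Context {R : realType} {k : nat}.
Variable ip : 'cV[R]_k -> 'cV[R]_k -> R.
Hypothesis hip : inner_product ip.

Let iplin z : linear (fun x => ip x z : R^o).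
Proof. by have [_ H _] := hip; move=> a x y; rewrite H. Qed.

Lemma inner_product_continuous : continuous (fun x => ip x x).
Proof.
have [ipC _ _] := hip.
have E x : ip x x = \sum_i x i ord0 * \sum_j x j ord0 * ip (unit_vec j) (unit_vec i).
  rewrite {1}(cV_basis x) (linear_fun_sum (@iplin x)); apply: eq_bigr => i _.
  rewrite (linear_funZ (@iplin x)); congr (_ * _).
  rewrite ipC {1}(cV_basis x) (linear_fun_sum (@iplin (unit_vec i))).
  by apply: eq_bigr => j _; rewrite (linear_funZ (@iplin (unit_vec i))).
have cE i : continuous (fun x : 'cV[R]_k => x i ord0).
  by apply: (@entry_continuous _ _ _ _ id) => x; exact: cvg_id.
have cM (W : topologicalType) (f g : W -> R) : continuous f -> continuous g ->
    continuous (fun x => f x * g x).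
  by move=> cf cg x; apply: cvgM; [exact: cf|exact: cg].
rewrite (funext E); apply: continuous_sumr => i _; apply: (cM 'cV[R]_k); first exact: cE.
apply: continuous_sumr => j _; apply: (cM 'cV[R]_k); first exact: cE.
by move=> x; exact: cst_continuous.
Qed.

(** On the compact unit sphere [ip x x] attains a positive minimum. *)
Lemma inner_product_coercive :
  exists2 a, 0 < a & forall x, a * `|x| ^+ 2 <= ip x x.
Proof.
have [ipC _ ip0] := hip.
have ipZ a x : ip (a *: x) (a *: x) = a ^+ 2 * ip x x.
  by rewrite (linear_funZ (@iplin _)) ipC (linear_funZ (@iplin _)) expr2 -mulrA.
have ip00 : ip 0 0 = 0 by exact: (linear_fun0 (@iplin 0)).
pose S := [set x : 'cV[R]_k | `|x| = 1].
have cS : compact S.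
  apply: (@closed_bounded_compact_cV _ _ _ 1) => [|x ->//].
  rewrite (_ : S = (fun x : 'cV[R]_k => `|x|) @^-1` [set 1])//.
  by apply: closed_comp => [x _|]; [exact: norm_continuous|exact: closed_eq].
have [[x0 Sx0]|noS] := pselect (S !=set0); last first.
  exists 1 => // x; have [->|xn0] := eqVneq x 0.
    by rewrite ip00 normr0 expr0n mulr0.
  case: noS; exists (`|x|^-1 *: x).
  by rewrite /S/= normrZ normfV normr_id mulVf// normr_eq0.
have [x1 /[!inE] Sx1 x1min] := compact_EVT_min (ex_intro _ x0 Sx0) cS
  (continuous_subspaceT inner_product_continuous).
have x1n0 : x1 != 0 by rewrite -normr_eq0 Sx1 oner_eq0.
exists (ip x1 x1); first exact: ip0.
move=> x; have [->|xn0] := eqVneq x 0.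
  by rewrite ip00 normr0 expr0n mulr0.
have xp : 0 < `|x| by rewrite normr_gt0.
have Sx : (`|x|^-1 *: x) \in S.
  by rewrite inE /S/= normrZ normfV normr_id mulVf// gt_eqF.
have := x1min _ Sx; rewrite ipZ exprVn mulrC.
by rewrite ler_pdivlMr ?exprn_gt0.
Qed.

(** The sublevel sets of [j] in [S] are closed and bounded, hence compact. *)
Lemma coercive_minimum (S : set 'cV[R]_k) (j : 'cV[R]_k -> R) a th0 :
  closed S -> continuous j -> 0 < a -> (forall x, a * `|x| ^+ 2 <= j x) ->
  S th0 -> exists2 th, S th & forall x, S x -> j th <= j x.
Proof.
move=> clS cj a0 coer S0; pose A := S `&` [set x | j x <= j th0].
have clA : closed A.
  apply: closedI => //.
  rewrite (_ : [set _ | _] = j @^-1` [set r | r <= j th0])//.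
  by apply: closed_comp => [x _|]; [exact: cj|exact: closed_le].
have bA x : A x -> `|x| <= 1 + j th0 / a.
  move=> [_ /= xj]; have H : `|x| ^+ 2 <= j th0 / a.
    by rewrite ler_pdivlMr// mulrC (le_trans (coer x)).
  by move: (normr_ge0 x) H; move: `|x| (j th0 / a) => b d b0 H; nra.
have A0 : A th0 by split => /=.
have [th /[!inE] -[Sth th0j] thmin] := compact_EVT_min (ex_intro _ th0 A0)
  (closed_bounded_compact_cV clA bA) (continuous_subspaceT cj).
exists th => // x Sx; have [xj|/ltW xj] := leP (j x) (j th0).
  by apply: thmin; rewrite inE.
exact: le_trans th0j xj.
Qed.

End parameter_space.

Section mean_functionals.
Context {R : realType} {n : nat}.
Local Notation lam := (@lebesgue_cV R n).
Variable Y0 : set 'cV[R]_n.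
Hypothesis cY0 : compact Y0.

(** The bounds on a weight hold almost everywhere only; clipping its values
    makes them hold everywhere and changes no integral. *)
Lemma weight_model (omega : 'cV[R]_n -> R) c : 0 < c -> weight Y0 omega c ->
  exists w, [/\ lam.-integrable Y0 (EFin \o w), forall y, 0 <= w y &
    {ae lam, forall y, Y0 y -> omega y = w y}].
Proof.
move=> c0 [mom [C aeC] aec]; have mY0 := compact_measurable_cV cY0.
pose w y := Num.max 0 (Num.min (omega y) `|C|).
have w0 y : 0 <= w y by rewrite le_max lexx.
exists w; split => //.
  have mw : measurable_fun Y0 w.
    by apply: measurable_maxr => //; exact: measurable_minr.
  have I1 : lam.-integrable Y0 (EFin \o (fun=> 1 : R)).
    by apply: continuous_integrable_cV => // x; exact: cst_continuous.
  rewrite (_ : w = fun y => w y * 1); last by apply/funext => y; rewrite mulr1.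
  apply: (@integrable_EFinM _ _ _ _ _ mY0 _ _ `|C| I1) => // y _.
  by rewrite ger0_norm// ge_max normr_ge0 ge_min lexx orbT.
apply: filterS2 aeC aec => y yC yc Yy.
have h1 := le_trans (ler_norm _) (le_trans (yC Yy) (ler_norm C)).
have h2 := le_trans (ltW c0) (yc Yy).
by rewrite /w; move/min_idPl : h1 => ->; move/max_idPr : h2.
Qed.

Variable Th : topologicalType.

(** The weight [w] is only integrable; compactness of [Y0] makes the
    dependence of the continuous factor on the parameter uniform. *)
Lemma mean_continuous (h : Th * 'cV[R]_n -> R) w : continuous h ->
  lam.-integrable Y0 (EFin \o w) ->
  continuous (fun th => \int[lam]_(y in Y0) (h (th, y) * w y)).
Proof.
move=> ch Iw; have mY0 := compact_measurable_cV cY0.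
apply: (@continuous_param_Rintegral _ _ _ _ _ mY0 Th (fun th y => h (th, y)) w Iw).
- move=> th; apply: measurable_funS measurableT _ _ => //.
  exact: (continuous_measurable_cV (continuous_section th ch)).
- move=> th; have [C _ HC] := compact_norm_bounded cY0 (continuous_section th ch).
  by exists C.
- by move=> th e e0; exact: (tube_lemma cY0 ch).
Qed.

(** A condition imposed almost everywhere on a continuous quantity says that
    the integral of its positive part vanishes. *)
Lemma closed_ae_le (h : Th * 'cV[R]_n -> R) r : continuous h ->
  closed [set th | {ae lam, forall y, Y0 y -> h (th, y) <= r}].
Proof.
move=> ch; have mY0 := compact_measurable_cV cY0.
pose g (x : Th * 'cV[R]_n) := `|h x - r| + (h x - r).
have cg : continuous g.
  have ch' : continuous (fun x => h x - r).
    by move=> x; apply: cvgB; [exact: ch|exact: cvg_cst].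
  by move=> x; apply: cvgD; [apply: cvg_norm|]; exact: ch'.
have g0 x : 0 <= g x.
  by rewrite /g -lerBlDr sub0r -normrN ler_norm.
have gE x : (h x <= r) <-> g x = 0.
  rewrite /g -(subr_le0 r); move: (h x - r) => s; split.
    by move=> s0; rewrite ler0_norm// addNr.
  by move=> /eqP; rewrite addr_eq0 => /eqP E; rewrite -oppr_ge0 -E.
pose G th := \int[lam]_(y in Y0) (g (th, y) * 1).
have I1 : lam.-integrable Y0 (EFin \o (fun=> 1 : R)).
  by apply: continuous_integrable_cV => // x; exact: cst_continuous.
have cG : continuous G by exact: mean_continuous.
rewrite (_ : [set _ | _] = G @^-1` [set 0]).
  by apply: closed_comp => [x _|]; [exact: cG|exact: closed_eq].
apply/seteqP; split => th /=.
  move=> H; rewrite /G (@eq_Rintegral_ae _ _ _ _ _ _ (fun=> 0)).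
    by rewrite Rintegral_cst// mul0r.
  by apply: filterS H => y H Yy; rewrite mulr1; apply/gE/H.
have Ig := continuous_integrable_cV cY0 (continuous_section th cg).
have mg := measurable_int _ Ig.
rewrite /G => H.
have H0 : (\int[lam]_(y in Y0) `|(EFin \o (fun y => g (th, y))) y| = 0)%E.
  rewrite (eq_integral (EFin \o (fun y => g (th, y)))); last first.
    by move=> y _; rewrite gee0_abs// lee_fin.
  rewrite -(fineK (integrable_fin_num mY0 Ig)); congr EFin.
  by rewrite -[RHS]H; apply: eq_Rintegral => y _; rewrite mulr1.
have /(ae_eq_integral_abs _ mY0 mg) := H0.
by apply: filterS => y Hy Yy; apply/gE; have [] := Hy Yy.
Qed.

End mean_functionals.

(** * The learning problem *)

Section learning_problem.
Context {R : realType} {n m k : nat}.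
Local Notation lam := (@lebesgue_cV R n).
Variables (P : ocp R n m) (Y0 : set 'cV[R]_n) (M : R) (omega : 'cV[R]_n -> R).
Variables (c_omega gamma1 gamma2 gammae : R).
Variables (ip : 'cV[R]_k -> 'cV[R]_k -> R) (V : 'cV[R]_k -> R -> 'cV[R]_n -> R).
Local Notation T := (horizon P).
Local Notation Z := ('cV[R]_k * 'cV[R]_n)%type.
Hypothesis T0 : 0 < T.
Hypothesis beta0 : 0 < beta P.
Hypothesis hyd : L2 0 T (yd P).
Hypothesis cY0 : compact Y0.
Hypothesis hA1 : regular_dynamics P.
Hypothesis M0 : 0 < M.
Hypothesis hip : inner_product ip.
Hypothesis hVC : Ck_on 4 setT (fun x : 'cV[R]_k * R * 'cV[R]_n => V x.1.1 x.1.2 x.2).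
Hypothesis c_omega0 : 0 < c_omega.
Hypothesis homega : weight Y0 omega c_omega.
Hypothesis gamma10 : 0 <= gamma1.
Hypothesis gamma20 : 0 <= gamma2.
Hypothesis gammae0 : 0 < gammae.

Variable Y : Z * R -> 'cV[R]_n.
Hypothesis cY : continuous Y.
Hypothesis eY : forall z t i, 0 <= t <= T -> Y (z, t) i ord0 = z.2 i ord0 +
    \int[@lebesgue_measure R]_(s in `]0, t[)
      trunc_field P M V (z.1, s) (Y (z, s)) i ord0.
Variable Q : Z * R -> 'cV[R]_n.
Hypothesis cQ : continuous Q.
Hypothesis eQ : forall z t i, 0 <= t <= T -> Q (z, t) i ord0 =
    ((Q2 P)^T *m Q2 P *m (Y (z, T) - ydT P)) i ord0 +
    \int[@lebesgue_measure R]_(s in `]t, T[) (state_adjoint_mx P V Y (z, s) *m Q (z, s) +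
       (Q1 P)^T *m Q1 P *m (Y (z, s) - yd P s)) i ord0.

(** The parameters whose closed loop admits feasible trajectories; by uniqueness
    these trajectories, and with them the cost, are functions of the
    parameter. *)
Definition feasible_parameters : set 'cV[R]_k := [set th |
  {ae lam, forall y0, Y0 y0 -> state_energy P Y (th, y0) <= (2 * M) ^+ 2}].

Definition reduced_cost (th : 'cV[R]_k) : R :=
  learning_cost P Y0 omega gamma1 gamma2 ip V gammae
    (fun y0 t => Y ((th, y0), t)) (fun y0 t => Q ((th, y0), t)) th.

Lemma feasible_parameters_closed : closed feasible_parameters.
Proof.
exact: (closed_ae_le cY0 (state_energy_continuous T0 M0 hA1 hVC cY eY)).
Qed.

Let net_cost (z : Z) : R :=
  cost_net P gamma1 gamma2 V (fun t => Y (z, t)) (fun t => Q (z, t)) z.1.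

Let reduced_costE : exists w, [/\ lam.-integrable Y0 (EFin \o w),
  forall y, 0 <= w y & forall th, reduced_cost th =
    (fine (lam Y0))^-1 * (\int[lam]_(y in Y0) (net_cost (th, y) * w y)) +
    gammae / 2 * ip th th].
Proof.
have [w [Iw w0 ow]] := weight_model cY0 c_omega0 homega.
exists w; split => // th; rewrite /reduced_cost /learning_cost /mean_Y0.
congr (_ * _ + _); apply: eq_Rintegral_ae; apply: filterS ow => y oy Yy.
by rewrite oy// mulrC.
Qed.

Lemma reduced_cost_continuous : continuous reduced_cost.
Proof.
have [w [Iw w0 E]] := reduced_costE.
have cn := @net_cost_continuous _ _ _ _ P V gamma1 gamma2 T0 hyd hA1 hVC Y Q cY cQ.
have cm := mean_continuous cY0 cn Iw.
have cM (W : topologicalType) (a : R) (f : W -> R) : continuous f ->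
    continuous (fun x => a * f x).
  by move=> cf x; apply: cvgM; [exact: cvg_cst|exact: cf].
have cD (W : topologicalType) (f g : W -> R) : continuous f -> continuous g ->
    continuous (fun x => f x + g x).
  by move=> cf cg x; apply: cvgD; [exact: cf|exact: cg].
rewrite (funext E); apply: (cD 'cV[R]_k); apply: (cM 'cV[R]_k) => //.
exact: inner_product_continuous.
Qed.

(** All other terms are nonnegative, so the regularisation term alone provides
    the growth. *)
Lemma reduced_cost_coercive :
  exists2 a, 0 < a & forall th, a * `|th| ^+ 2 <= reduced_cost th.
Proof.
have [a a0 Ha] := inner_product_coercive hip.
have [w [Iw w0 E]] := reduced_costE.
exists (gammae / 2 * a) => [|th]; first by rewrite !mulr_gt0 ?invr_gt0.
have h : gammae / 2 * a * `|th| ^+ 2 <= gammae / 2 * ip th th.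
  by rewrite -mulrA ler_wpM2l// divr_ge0// ltW.
rewrite E (le_trans h)// lerDr; apply: mulr_ge0.
  by rewrite invr_ge0 fine_ge0.
apply: Rintegral_ge0 => y _.
by rewrite mulr_ge0// cost_net_ge0.
Qed.

Local Notation state z := (fun t => Y (z, t)).
Local Notation costate z := (fun t => Q (z, t)).

Let oo_cc t : 0 < t < T -> 0 <= t <= T.
Proof. by move=> /andP[/ltW -> /ltW ->]. Qed.

Let wY z : {within `[0, T], continuous (state z)}.
Proof. by apply: continuous_subspaceT; exact: (continuous_section z cY). Qed.

Lemma learning_feasible_parameter y p th :
  learning_feasible P Y0 M V y p th -> feasible_parameters th.
Proof.
have arith (a b : R) : 0 <= a -> b = a -> a <= 2 * M -> b ^+ 2 <= (2 * M) ^+ 2.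
  by move=> a0 -> aM; rewrite ler_pXn2r// nnegrE// mulr_ge0// ltW.
move=> [_ _ _ _]; apply: filterS => y0 H Yy0.
have [ya ys _] := H Yy0; have yE' := state_unique T0 M0 hA1 hVC cY eY ya ys.
have hE : H1norm 0 T (state (th, y0)) = H1norm 0 T (y y0).
  by apply: eq_H1norm => t /oo_cc tT; rewrite yE'.
have [_ yM] := ya.
exact: (arith _ _ (H1norm_ge0 _ _) hE yM).
Qed.

Lemma learning_cost_reduced y p th : learning_feasible P Y0 M V y p th ->
  learning_cost P Y0 omega gamma1 gamma2 ip V gammae y p th = reduced_cost th.
Proof.
move=> [_ _ _ _ H]; rewrite /reduced_cost /learning_cost /mean_Y0.
apply: (congr2 +%R _ erefl); apply: (congr2 *%R erefl).
apply: eq_Rintegral_ae; apply: filterS H => y0 H Yy0.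
have [ya ys yp] := H Yy0; have yE' := state_unique T0 M0 hA1 hVC cY eY ya ys.
have pE := costate_unique T0 hyd hA1 hVC cY cQ eQ yE' yp.
by apply: (congr2 *%R erefl); exact: (eq_cost_net _ _ _ _ T0 yE' pE).
Qed.

(** Feasibility asks for the norm bound at every initial value, but for the
    state equation only at almost every one. Multiplication by [shrink]
    enforces the bound everywhere, depends continuously on the initial value
    and changes nothing where the bound already holds. *)
Let excess (z : Z) : R :=
  `|state_energy P Y z - (2 * M) ^+ 2| + (state_energy P Y z - (2 * M) ^+ 2).
Let shrink (z : Z) : R := (2 * M) ^+ 2 / ((2 * M) ^+ 2 + excess z).

Let M24 : 0 < (2 * M) ^+ 2.
Proof. by rewrite exprn_gt0// mulr_gt0. Qed.

Let excess_ge0 z : 0 <= excess z.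
Proof. by rewrite /excess -lerBlDr sub0r -normrN ler_norm. Qed.

Let energy_le z : state_energy P Y z <= (2 * M) ^+ 2 + excess z.
Proof.
rewrite -lerBlDl /excess; move: (_ - _) => s.
by rewrite lerDr.
Qed.

Let shrink_le z : `|shrink z| ^+ 2 * state_energy P Y z <= (2 * M) ^+ 2.
Proof.
rewrite /shrink; move: (energy_le z) (excess_ge0 z) M24.
have : 0 <= state_energy P Y z by exact: sqr_ge0.
move: (state_energy P Y z) (excess z) ((2 * M) ^+ 2) => a x b a0 ax x0 b0.
have bx0 : 0 < b + x by rewrite ltr_wpDr.
rewrite real_normK ?num_real// expr_div_n mulrAC ler_pdivrMr ?exprn_gt0//.
by rewrite !expr2 -!mulrA ler_pM2l//; nra.
Qed.

Let shrink_id z : state_energy P Y z <= (2 * M) ^+ 2 -> shrink z = 1.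
Proof.
move=> zM; rewrite /shrink (_ : excess z = 0) ?addr0 ?divff ?gt_eqF//.
by rewrite /excess ler0_norm ?subr_le0// addNr.
Qed.

Let shrink_continuous : continuous shrink.
Proof.
have ce := state_energy_continuous T0 M0 hA1 hVC cY eY.
have cs : continuous (fun z : Z => state_energy P Y z - (2 * M) ^+ 2).
  by move=> z; apply: cvgB; [exact: ce|exact: cvg_cst].
have cx : continuous excess.
  by move=> z; apply: cvgD; [apply: cvg_norm|]; exact: cs.
move=> z; apply: cvgM; first exact: cvg_cst.
apply: cvgV; first by rewrite gt_eqF// ltr_wpDr.
by apply: cvgD; [exact: cvg_cst|exact: cx].
Qed.

Let at_parameter th : continuous (fun w : 'cV[R]_n * R => ((th, w.1), w.2) : Z * R).
Proof.
apply: continuous_pair; last exact: continuous_snd.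
by apply: continuous_pair; [move=> x; exact: cst_continuous|exact: continuous_fst].
Qed.

Lemma feasible_parameter_learning th : feasible_parameters th ->
  exists y p, learning_feasible P Y0 M V y p th.
Proof.
move=> Sth.
pose yc (w : 'cV[R]_n * R) := shrink (th, w.1) *: Y ((th, w.1), w.2).
pose qc (w : 'cV[R]_n * R) := Q ((th, w.1), w.2).
have cYth : continuous (fun w : 'cV[R]_n * R => Y ((th, w.1), w.2)).
  exact: (continuous_compose (@at_parameter th) cY).
have cscale (g : 'cV[R]_n * R -> 'cV[R]_n) : continuous g ->
    continuous (fun w => shrink (th, w.1) *: g w).
  have cs1 : continuous (fun w : 'cV[R]_n * R => shrink (th, w.1)).
    apply: continuous_compose (@shrink_continuous); apply: continuous_pair.
      by move=> x; exact: cst_continuous.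
    exact: continuous_fst.
  by move=> cg w; apply: cvgZ; [exact: cs1|exact: cg].
have cyc : continuous yc by exact: cscale.
have ctw : continuous (fun w : 'cV[R]_n * R => (th, w.2) : 'cV[R]_k * R).
  by apply: continuous_pair; [move=> x; exact: cst_continuous|exact: continuous_snd].
have swd z := state_weak_deriv T0 M0 hA1 hVC cY eY z.
have hYz z : H1 0 T (state z) by exact: (weak_deriv_H1 (@wY z) (swd z)).
have yM z : H1norm 0 T (fun t => shrink z *: Y (z, t)) <= 2 * M.
  have := shrink_le z; have HZ := H1normZ T0 (shrink z) (hYz z).
  have arith (h h' s : R) : 0 <= h' -> h' = s * h -> s ^+ 2 * h ^+ 2 <= (2 * M) ^+ 2 ->
      h' <= 2 * M.
    by move=> h0 hE; rewrite -exprMn -hE ler_pXn2r// nnegrE// mulr_ge0// ltW.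
  exact: (arith _ _ _ (H1norm_ge0 _ _) HZ).
exists (fun y0 t => yc (y0, t)), (fun y0 t => qc (y0, t)); split.
- pose vc (w : 'cV[R]_n * R) := shrink (th, w.1) *: trunc_field P M V (th, w.2)
    (Y ((th, w.1), w.2)).
  apply: (@continuous_in_CY0W _ _ _ _ Y0 T0 yc vc (fun=> 0)); first exact: cyc.
    by apply: cscale; exact: trunc_field_continuous.
  move=> y0; have := weak_derivZ T0 (shrink (th, y0)) (@wY (th, y0)) (swd (th, y0)).
  by apply: eq_weak_deriv => // t _; rewrite addr0.
- by move=> y0 _; exact: (yM (th, y0)).
- pose vc (w : 'cV[R]_n * R) := - (state_adjoint_mx P V Y ((th, w.1), w.2) *m qc w +
    (Q1 P)^T *m Q1 P *m Y ((th, w.1), w.2)).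
  have cqc : continuous qc by exact: (continuous_compose (@at_parameter th) cQ).
  apply: (@continuous_in_CY0W _ _ _ _ Y0 T0 qc vc
    (fun t => (Q1 P)^T *m Q1 P *m yd P t)); first exact: cqc.
    rewrite (_ : vc = fun w => (-1) *: (state_adjoint_mx P V Y ((th, w.1), w.2) *m qc w +
      (Q1 P)^T *m Q1 P *m Y ((th, w.1), w.2))); last first.
      by apply/funext => w; rewrite scaleN1r.
    apply: mx_continuousZ; apply: mx_continuousD; last exact: continuous_mulmxl.
    apply: mulmx_continuous => //.
    exact: (continuous_compose (@at_parameter th)
      (state_adjoint_mx_continuous T0 hA1 hVC cY)).
  move=> y0; have := costate_weak_deriv T0 hyd hA1 hVC cY cQ eQ (th, y0).
  apply: eq_weak_deriv => // t _.
  by rewrite /adjoint_rhs /vc/= mulmxBr addrA opprD opprK.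
- apply: (continuous_in_Uad T0 cY0 (Uc := fun w => net_control P V (th, w.2) (yc w))).
    exact: (continuous_compose (continuous_pair ctw cyc) (net_control_continuous T0 hA1 hVC)).
  by move=> y0 t /oo_cc tT; rewrite control_netE.
- apply: filterS Sth => y0 H Yy0; have {}H := H Yy0.
  have -> : (fun t => yc (y0, t)) = state (th, y0).
    by apply/funext => t; rewrite /yc/= shrink_id// scale1r.
  have yad : in_Yad P M (state (th, y0)).
    split; first exact: hYz.
    have := yM (th, y0); rewrite (shrink_id H).
    by under eq_fun do rewrite scale1r.
  split; first exact: yad.
    exact: (state_feasible T0 M0 hA1 hVC cY eY (in_Yad_ball T0 M0 yad)).
  exact: (costate_feasible T0 hyd hA1 hVC cY cQ eQ).
Qed.

Lemma learning_minimizer_exists th0 : feasible_parameters th0 ->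
  exists y p th,
    learning_minimizer P Y0 M omega gamma1 gamma2 ip V gammae y p th.
Proof.
move=> S0; have [a a0 coer] := reduced_cost_coercive.
have [th Sth thmin] := coercive_minimum feasible_parameters_closed
  reduced_cost_continuous a0 coer S0.
have [y [p yp]] := feasible_parameter_learning Sth.
exists y, p, th; split => // y' p' th' yp'.
rewrite (learning_cost_reduced yp) (learning_cost_reduced yp').
exact/thmin/learning_feasible_parameter/yp'.
Qed.

End learning_problem.

Theorem theorem13 (R : realType) (n m : nat) (P : ocp R n m)
    (Y0 : set 'cV[R]_n) (M : R) (eps0 : R) (N : R -> nat)
    (ip : forall e : R, 'cV[R]_(N e) -> 'cV[R]_(N e) -> R)
    (V : forall e : R, 'cV[R]_(N e) -> R -> 'cV[R]_n -> R)
    (omega : 'cV[R]_n -> R) (c_omega gamma1 gamma2 : R) (gamma : R -> R)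
    (hP : ocp_setting P)
    (hY0 : compact Y0) (hY0_pos : (0 < lebesgue_cV n Y0)%E)
    (hA1 : regular_dynamics P)
    (hM : 0 < M) (hA2 : regular_value P M)
    (hA3 : optimal_closed_loop P Y0 M)
    (heps0 : 0 < eps0)
    (hV : forall e, 0 < e <= eps0 -> ansatz P (ip e) (V e))
    (happrox : exists (theta : forall e, 'cV[R]_(N e)) (c : R), 0 < c /\
       forall e, 0 < e <= eps0 -> approximates P M (V e) (theta e) (c * e))
    (hc_omega : 0 < c_omega) (homega : weight Y0 omega c_omega)
    (hgamma1 : 0 <= gamma1) (hgamma2 : 0 <= gamma2)
    (hgamma : forall e, 0 < e <= eps0 -> 0 < gamma e) :
  exists2 eps1 : R, 0 < eps1 <= eps0 &
    forall e, 0 < e <= eps1 ->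
      exists (y p : 'cV[R]_n -> R -> 'cV[R]_n) (theta : 'cV[R]_(N e)),
        learning_minimizer P Y0 M omega gamma1 gamma2 (ip e) (V e) (gamma e)
          y p theta.
Proof.
have [T0 _ _ beta0 hyd] := hP.
have [th [c [c0 happ]]] := happrox.
have hVC e (eP : 0 < e <= eps0) := let: And3 _ H _ := hV e eP in H.
have hip e (eP : 0 < e <= eps0) := let: And3 H _ _ := hV e eP in H.
have [eps1 /andP[eps10 eps1e] small] :=
  small_state_energy T0 hM hA1 hA2 heps0 c0 hVC happ hA3.
exists eps1; first by rewrite eps10.
move=> e /[dup] eP1 /andP[e0 ee1].
have eP : 0 < e <= eps0 by rewrite e0 (le_trans ee1).
have [Y cY eY] := state_family T0 hM hA1 (hVC e eP).
have [Q cQ eQ] := adjoint_family T0 hyd hA1 (hVC e eP) cY.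
apply: (learning_minimizer_exists T0 beta0 hyd hY0 hA1 hM (hip e eP) (hVC e eP)
  hc_omega homega hgamma1 hgamma2 (hgamma e eP) cY eY cQ eQ (th0 := th e)).
by apply: aeW => y0 Yy0; exact: (small e eP1 Y cY eY).
Qed.
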